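(* For every $l\in\mathbb N$, the image of the set $\widehat{\mathrm{SI}}_l\subset\mathbb C^2_{(\mu,r)}$ under the map $(\mu,r)\mapsto(\mu,r^2)$ is an irreducible algebraic curve. Moreover, the algebraic set $\widehat{\mathrm{SI}}_l$ consists of exactly two irreducible components, namely the algebraic curves $\widehat{\mathrm{SI}}_{l,+}$ and $\widehat{\mathrm{SI}}_{l,-}$.
   Context: Fix $\omega>0$. For $(B,A)\in\mathbb R^2$ consider $\frac{d\varphi}{dt}=-\sin\varphi+B+A\cos\omega t$; with $\tau=\omega t$, $l=B/\omega$, $\mu=A/(2\omega)$ this gives the vector field $\dot\varphi=-\frac{\sin\varphi}{\omega}+l+2\mu\cos\tau$, $\dot\tau=1$ on the torus $\mathbb R^2/2\pi\mathbb Z^2$. The rotation number is $\rho(B,A;\omega)=\lim_{k\to+\infty}\varphi(2\pi k)/(2\pi k)$; for $s\in\mathbb Z$, $L_s(\omega)=\{\rho=s\}$ is the phase-lock area. The Poincaré map $h_{(B,A)}$ is the time-$2\pi$ flow map on the circle $\{\tau=0\}$. $\partial L_{s,\pm}(\omega)$ denotes the set of points of $L_s(\omega)$ at which $h_{(B,A)}$ fixes $\pm\frac\pi2\pmod{2\pi}$; $\partial L_s=\partial L_{s,+}\cup\partial L_{s,-}$. A point of some $L_s$ at which $h_{(B,A)}$ is the identity is called a growth point if $A=0$ and a constriction if $A\neq0$. The axis is $\Lambda_l(\omega)=\{B=l\omega\}$. A generalized simple intersection is a point of $\Lambda_l(\omega)\cap\partial L_s(\omega)$ with $s\equiv l\pmod2$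 that is not a constriction. Set $r=\frac1{2\omega}$. For $r>0$ and $l\in\mathbb N$, $\mathrm{SI}_l(r)$ is the set of $\mu$-coordinates $\mu=A/(2\omega)=Ar$ of the generalized simple intersections in $\Lambda_l(\omega)$, and $\mathrm{SI}_l=\bigcup_{r>0}(\mathrm{SI}_l(r)\times\{r\})\subset\mathbb R^2_{(\mu,r)}$. Let $\mathrm{SI}_l^0\subset\mathrm{SI}_l$ be the subset of those $(\mu,r)$ whose corresponding point $(B,A)=(\frac{l}{2r},\frac{\mu}{r})$ is not a growth point (for these the Poincaré map has a unique fixed point, which is $\pm\frac\pi2\pmod{2\pi}$), and $\mathrm{SI}_{l,\pm}^0$ the subset of those for which this fixed point is $\pm\frac\pi2$. $\widehat{\mathrm{SI}}_l$ and $\widehat{\mathrm{SI}}_{l,\pm}$ denote the complex Zariski closures in $\mathbb C^2_{(\mu,r)}$ of $\mathrm{SI}_l$ and of $\mathrm{SI}^0_{l,\pm}$ respectively. *)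

(* Defs.v *)
From mathcomp Require Import all_boot all_order all_algebra.
From mathcomp Require Import all_classical all_reals all_analysis.
From mathcomp Require Import complex Rstruct Rstruct_topology.
Import GRing.Theory Num.Theory numFieldNormedType.Exports.
Local Open Scope classical_set_scope.
Local Open Scope ring_scope.

Notation RR := Rdefinitions.R.
Notation CC := (complex Rdefinitions.R).

(* The dynamical system.  In the time tau = omega t the equation
     d phi/dt = - sin phi + B + A cos (omega t)
   becomes  d phi/d tau = (- sin phi + B + A cos tau) / omega
   (= - sin phi / omega + l + 2 mu cos tau). *)
Definition jsolution (om B A : RR) (phi : RR -> RR) : Prop :=
  forall tau : RR, is_derive (tau : RR^o) (1 : RR^o) (phi : RR^o -> RR^o)
    (((- sin (phi tau) + B + A * cos tau) / om) : RR^o).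

Definition eqmod2pi (x y : RR) : Prop :=
  exists k : int, x - y = k%:~R * (2 * pi).

Definition poincare (om B A x y : RR) : Prop :=
  exists phi, jsolution om B A phi /\ phi 0 = x /\ phi (2 * pi) = y.

Definition pfixes (om B A x : RR) : Prop :=
  exists y, poincare om B A x y /\ eqmod2pi y x.

Definition pidentity (om B A : RR) : Prop := forall x, pfixes om B A x.

Definition rotation_number_is (om B A s : RR) : Prop :=
  exists phi, jsolution om B A phi /\
    (fun k : nat => phi (2 * pi * k%:R) / (2 * pi * k%:R)) @ \oo --> s.

Definition in_L (om : RR) (s : int) (B A : RR) : Prop :=
  rotation_number_is om B A s%:~R.

Definition in_dLp (om : RR) (s : int) (B A : RR) : Prop :=
  in_L om s B A /\ pfixes om B A (pi / 2).
Definition in_dLm (om : RR) (s : int) (B A : RR) : Prop :=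
  in_L om s B A /\ pfixes om B A (- (pi / 2)).
Definition in_dL (om : RR) (s : int) (B A : RR) : Prop :=
  in_dLp om s B A \/ in_dLm om s B A.

Definition constriction (om B A : RR) : Prop :=
  (exists s, in_L om s B A) /\ pidentity om B A /\ A != 0.
Definition growth_point (om B A : RR) : Prop :=
  (exists s, in_L om s B A) /\ pidentity om B A /\ A = 0.

Definition gen_simple_intersection (om : RR) (l : nat) (B A : RR) : Prop :=
  B = l%:R * om /\
  (exists s : int, (s - l%:Z) %% 2 = 0 /\ in_dL om s B A)%Z /\
  ~ constriction om B A.

(* SI_l in R^2_(mu,r):  omega = 1/(2r), B = l omega, A = 2 omega mu = mu/r *)
Definition SI (l : nat) : set (RR * RR) :=
  [set z | 0 < z.2 /\
     gen_simple_intersection (1 / (2 * z.2)) l (l%:R / (2 * z.2)) (z.1 / z.2)].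

Definition SI0 (l : nat) : set (RR * RR) :=
  [set z | SI l z /\ ~ growth_point (1 / (2 * z.2)) (l%:R / (2 * z.2)) (z.1 / z.2)].

Definition SI0p (l : nat) : set (RR * RR) :=
  [set z | SI0 l z /\ pfixes (1 / (2 * z.2)) (l%:R / (2 * z.2)) (z.1 / z.2) (pi / 2)].
Definition SI0m (l : nat) : set (RR * RR) :=
  [set z | SI0 l z /\ pfixes (1 / (2 * z.2)) (l%:R / (2 * z.2)) (z.1 / z.2) (- (pi / 2))].

(* Complex affine plane C^2_(mu,r) and polynomials C[mu,r]:
   p : {poly {poly CC}} is a polynomial in r whose coefficients are
   polynomials in mu. *)
Definition ev2 (p : {poly {poly CC}}) (z : CC * CC) : CC := (p.[z.2%:P]).[z.1].

Definition zero_set (P : set {poly {poly CC}}) : set (CC * CC) :=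
  [set z | forall p, P p -> ev2 p z = 0].

Definition algebraic_set (S : set (CC * CC)) : Prop :=
  exists P, S = zero_set P.

Definition irreducible_algset (S : set (CC * CC)) : Prop :=
  algebraic_set S /\ S <> set0 /\
  forall S1 S2, algebraic_set S1 -> algebraic_set S2 ->
    S = S1 `|` S2 -> S = S1 \/ S = S2.

Definition algebraic_curve (S : set (CC * CC)) : Prop :=
  exists f : {poly {poly CC}}, (forall c : CC, f <> c%:P%:P) /\ S = zero_set [set f].

Definition irreducible_curve (S : set (CC * CC)) : Prop :=
  algebraic_curve S /\ irreducible_algset S.

Definition irreducible_component (X T : set (CC * CC)) : Prop :=
  irreducible_algset T /\ T `<=` X /\
  forall T', irreducible_algset T' -> T `<=` T' -> T' `<=` X -> T' = T.

Definition cplx2 (z : RR * RR) : CC * CC := (Complex z.1 0, Complex z.2 0).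

Definition zariski_closure (S : set (RR * RR)) : set (CC * CC) :=
  [set w | forall p : {poly {poly CC}},
     (forall z, S z -> ev2 p (cplx2 z) = 0) -> ev2 p w = 0].

Definition SIhat (l : nat) := zariski_closure (SI l).
Definition SIhatp (l : nat) := zariski_closure (SI0p l).
Definition SIhatm (l : nat) := zariski_closure (SI0m l).

Definition sqmap (z : CC * CC) : CC * CC := (z.1, z.2 ^+ 2).

(* Main.v *)
(** The phase equation is the projectivization of a linear system on the circle, equivalent
    to a double confluent Heun equation. If the Poincare map fixes pi/2 with winding number
    congruent to l mod 2 and is not the identity (or if mu = 0), the corresponding periodic
    solution of the linear system has only nonnegative Fourier modes, up to a symmetry that
    is excluded, and multiplying it by e^{- mu z} yields a polynomial of degree < l; its
    coefficients form an eigenvector of an explicit l x l matrix M(mu) for the eigenvalue r.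
    Conversely such an eigenvector gives a fixed point. Shifting phi by pi turns r into - r
    and exchanges pi/2 with - pi/2. Hence, with Q(mu, r) the characteristic polynomial of
    M(mu), the points fixing pi/2 lie on Q(mu, r) = 0, those fixing - pi/2 on
    Q(mu, - r) = 0.

    Q is irreducible: Q(mu, 0) = +- mu^l, Q(0, r) has a simple root at 0, and Q has constant
    leading coefficients in both variables, so a factor not vanishing at the origin is
    constant. A polynomial vanishing at infinitely many zeros of Q is then a multiple of Q
    (resultants and the Gauss lemma). Both real loci are infinite because M(mu) is
    symmetrizable for real mu and tr (M^2) > (tr M)^2, so M has positive and negative
    eigenvalues, and because the Poincare map is not the identity when mu is small. The two
    curves differ since tr M <> 0, and they have the same image under (mu, r) -> (mu, r^2). *)
Require Import Defs.
From mathcomp Require Import all_boot all_order all_algebra.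
From mathcomp Require Import Rstruct Rstruct_topology.
From mathcomp Require Import all_classical all_reals all_analysis.
From mathcomp Require Import perm polyXY spectral.
From mathcomp Require Import complex.
From mathcomp Require Import zify ring lra.
Import Order.TTheory GRing.Theory Num.Theory numFieldNormedType.Exports.
Set Implicit Arguments. Unset Strict Implicit. Unset Printing Implicit Defensive.
Local Open Scope classical_set_scope.
Local Open Scope ring_scope.
Local Open Scope complex_scope.

(** * Calculus *)

(** Existence of solutions shapes the analytic half. No flow is assumed: a phase solution that has
    to exist is read off from an explicit solution of the linear system ([sol_jsol]), and a second
    linear solution comes from reduction of order. Uniqueness comes from a Gronwall estimate, and
    rotation numbers of different solutions are compared through boundedness of their difference.
    The algebraic half needs no parametrization of the real loci. On an irreducible plane curve
    every infinite subset is dense, so a sequence of real points with small nonzero [mu] is enough.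
    The bound [10^-1] on [mu] only serves to make a numerical contradiction work when all phases are
    supposed fixed. The value [mu = 0] stays a separate case: growth points belong to [SI] although
    the Poincare map is the identity there, so the argument by uniqueness of the periodic solution
    fails. At [mu = 0] the recurrence between Fourier modes couples only [n] and [l - n], and
    negative modes are killed by a sign. *)

Section Calculus.
Variable R : realType.
Local Notation C := R[i].
Implicit Types (f g u v : R -> R) (F G H : R -> C).

Local Notation re := (@complex.Re R).
Local Notation im := (@complex.Im R).
Definition D1 f f' := forall x : R, is_derive x 1 f (f' x).
Definition CD F F' := D1 (fun x => re (F x)) (fun x => re (F' x)) /\
                      D1 (fun x => im (F x)) (fun x => im (F' x)).

Lemma D1_ext f g f' g' : f =1 g -> f' =1 g' -> D1 f f' -> D1 g g'.
Proof. by move=> /funext <- /funext <-. Qed.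

Lemma D1_cst c : D1 (fun=> c) (fun=> 0).
Proof. by move=> x; exact: is_derive_cst. Qed.
Lemma D1_id : D1 id (fun=> 1).
Proof. by move=> x; exact: is_derive_id. Qed.
Lemma D1_add f f' g g' : D1 f f' -> D1 g g' ->
  D1 (fun x => f x + g x) (fun x => f' x + g' x).
Proof. by move=> hf hg x; apply: is_deriveD. Qed.
Lemma D1_opp f f' : D1 f f' -> D1 (fun x => - f x) (fun x => - f' x).
Proof. by move=> hf x; apply: is_deriveN. Qed.
Lemma D1_sub f f' g g' : D1 f f' -> D1 g g' ->
  D1 (fun x => f x - g x) (fun x => f' x - g' x).
Proof. by move=> hf hg x; apply: is_deriveB. Qed.
Lemma D1_mul f f' g g' : D1 f f' -> D1 g g' ->
  D1 (fun x => f x * g x) (fun x => f' x * g x + f x * g' x).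
Proof.
move=> hf hg x; have H := @is_deriveM _ _ f g x 1 (f' x) (g' x) (hf x) (hg x).
by apply: is_derive_eq H _; rewrite /GRing.scale /= addrC mulrC.
Qed.
Lemma D1_comp f f' u u' : D1 f f' -> D1 u u' ->
  D1 (fun x => f (u x)) (fun x => u' x * f' (u x)).
Proof.
move=> hf hu x.
have H := @is_derive1_comp _ f u x (f' (u x)) (u' x) (hf _) (hu _).
by apply: is_derive_eq H _; rewrite mulrC.
Qed.
Lemma D1_sin : D1 sin cos. Proof. by move=> x; exact: is_derive_sin. Qed.
Lemma D1_cos : D1 cos (fun x => - sin x).
Proof. by move=> x; exact: is_derive_cos. Qed.
Lemma D1_exp : D1 expR expR. Proof. by move=> x; exact: is_derive_expR. Qed.
Lemma D1_inv f f' : (forall x, f x != 0) -> D1 f f' ->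
  D1 (fun x => (f x)^-1) (fun x => - f' x / f x ^+ 2).
Proof.
move=> nz hf x; have H := @is_deriveV _ f x (f' x) 1 (nz x) (hf x).
by apply: is_derive_eq H _; rewrite /GRing.scale /= mulNr mulNr mulrC.
Qed.
Lemma D1_cont f f' : D1 f f' -> continuous f.
Proof.
move=> hf x; apply: differentiable_continuous; apply/derivable1_diffP.
by have [] := hf x.
Qed.
Lemma D1_mvt f f' : D1 f f' -> forall a b, a <= b ->
  exists2 c, a <= c <= b & f b - f a = f' c * (b - a).
Proof.
move=> hf a b ab.
have [c cab ->] := @MVT_segment R f f' a b ab (fun x _ => hf x)
  (continuous_subspaceT (D1_cont hf)).
by exists c.
Qed.
Lemma D1_le f f' : D1 f f' -> (forall x, 0 <= f' x) -> {homo f : x y / x <= y}.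
Proof.
move=> hf h x y xy; have [c _ e] := D1_mvt hf xy.
by rewrite -subr_ge0 e mulr_ge0// subr_ge0.
Qed.
Lemma D1_0 f : D1 f (fun=> 0) -> forall x y, f x = f y.
Proof.
move=> hf x y; apply/le_anti/andP; wlog: x y / x <= y => [h|xy].
  by case/orP: (le_total x y) => /h // [? ?]; split.
by split; first exact: (D1_le hf);
  move: (D1_le (D1_opp hf)); rewrite oppr0 => /(_ (fun=> lexx _) _ _ xy); rewrite lerN2.
Qed.
End Calculus.

(** * Antiderivatives of continuous functions on the whole line *)

Section Primitive.
Variable R : realType.
Implicit Types f : R -> R.
Let mu := @lebesgue_measure R.

Lemma continuous_int f (a b : R) : continuous f ->
  mu.-integrable `[a, b] (EFin \o f).
Proof.
move=> cf; apply: continuous_compact_integrable; first exact: segment_compact.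
exact: continuous_subspaceT.
Qed.

(** An integral with base point [a] is differentiated only to the right of [a], so a global
    antiderivative has to be glued from these half-line ones. *)
Lemma primitive_right f (a : R) : continuous f ->
  exists G : R -> R, forall x, a < x -> is_derive x 1 G (f x).
Proof.
move=> cf; exists (fun x => (\int[mu]_(t in [set` `[a, x]]) (f t))%R) => x ax.
have [d e] := continuous_FTC1_closed (ltr_pwDr ltr01 (lexx x))
  (continuous_int a (x + 1) cf) ax (cf x).
by rewrite -e derive1E; apply: DeriveDef.
Qed.

Lemma eq_primitive (f G H : R -> R) (a x y : R) :
  (forall x, a < x -> is_derive x 1 G (f x)) ->
  (forall x, a < x -> is_derive x 1 H (f x)) ->
  a < x -> a < y -> G x - G y = H x - H y.
Proof.
move=> hG hH; wlog xy : x y / x <= y => [h ax ay|ax _].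
  case/orP: (le_total x y) => xy; first exact: h.
  by apply: oppr_inj; rewrite !opprB; exact: h.
have hD z : a < z -> is_derive z 1 (fun z => G z - H z) 0.
  by move=> az; rewrite -(subrr (f z)); have := hG z az; have := hH z az; move=> ? ?; apply: is_deriveB.
have [z||z _] := @MVT_segment R (fun z => G z - H z) (fun=> 0) x y xy.
- by rewrite in_itv /= => /andP[xz _]; apply: hD; exact: lt_trans xz.
- apply: derivable_within_continuous => z; rewrite in_itv /= => /andP[xz _].
  by have [] := hD z (lt_le_trans ax xz).
- rewrite mul0r => /eqP; rewrite subr_eq0 => /eqP; lra.
Qed.

Lemma primitive_ex f : continuous f -> exists2 F, D1 F f & F 0 = 0.
Proof.
move=> cf; have /choice [G hG] n := primitive_right (- n%:R - 1) cf.
pose N (x : R) := (Num.truncn `|x|).+1.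
(* Every [G n] is an antiderivative near 0, so subtracting its value there makes all of them agree
   on overlaps ([key]). As [N x] exceeds [|x|], the formula with this fixed index also describes [F]
   near [x]. *)
pose F x := G (N x) x - G (N x) 0.
have N1 (x : R) : - (N x)%:R - 1 < x.
  have := truncnS_gt `|x|; rewrite -/(N x).
  by move: (ler_norm (- x)); rewrite normrN; set n := (N x)%:R; lra.
have N2 n : - n%:R - 1 < 0 :> R by rewrite ltrBlDr add0r ltrNl (lt_le_trans _ (ler0n _ n))// ltrN10.
have key n x : - n%:R - 1 < x -> F x = G n x - G n 0.
  move=> hx; rewrite /F; case/orP: (le_total (N x)%:R (n%:R : R)) => nN.
  - apply: (@eq_primitive f _ _ (- (N x)%:R - 1)) => //.
    by move=> z hz; apply: hG; apply: le_lt_trans hz; rewrite lerD2r lerN2.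
  - apply: (@eq_primitive f _ _ (- n%:R - 1)) => //.
    by move=> z hz; apply: hG; apply: le_lt_trans hz; rewrite lerD2r lerN2.
exists F; last by rewrite /F subrr.
move=> x; apply: (@near_eq_is_derive _ _ _ (fun y => G (N x) y - G (N x) 0)).
  apply: filterS (_ : nbhs x [set y | - (N x)%:R - 1 < y]).
    by move=> y /= /key ->.
  exact: (lt_nbhsr (N1 x)).
by rewrite -[f x]subr0; have := hG _ _ (N1 x) => ?; apply: is_deriveB.
Qed.
End Primitive.

(** * Complex functions of a real variable and the exponential e^{ix} *)

Section ComplexCalculus.
Variable R : realType.
Local Notation C := R[i].
Local Notation re := (@complex.Re R).
Local Notation im := (@complex.Im R).
Local Notation ii := (@Complex (Real.sort R) 0 1).
Local Notation normc := (@ComplexField.Normc.normc R).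
Implicit Types (f g u v : R -> R) (F G H : R -> C).

Lemma re_mul (z w : C) : re (z * w) = re z * re w - im z * im w.
Proof. by case: z w => [a b] [c d]. Qed.
Lemma im_mul (z w : C) : im (z * w) = re z * im w + im z * re w.
Proof. by case: z w => [a b] [c d]. Qed.
Lemma ReD (z w : C) : re (z + w) = re z + re w.
Proof. by case: z w => [a b] [c d]. Qed.
Lemma ImD (z w : C) : im (z + w) = im z + im w.
Proof. by case: z w => [a b] [c d]. Qed.
Lemma ReN (z : C) : re (- z) = - re z. Proof. by case: z. Qed.
Lemma ImN (z : C) : im (- z) = - im z. Proof. by case: z. Qed.
Lemma ReJ (z : C) : re ((conjc z)) = re z. Proof. by case: z. Qed.
Lemma ImJ (z : C) : im ((conjc z)) = - im z. Proof. by case: z. Qed.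
Lemma complex_eq (z w : C) : re z = re w -> im z = im w -> z = w.
Proof. by case: z w => [a b] [c d] /= -> ->. Qed.

Definition cxE := (re_mul, im_mul, ReD, ImD, ReN, ImN, ReJ, ImJ).

Lemma CD_ext F F' G G' : CD F F' -> F =1 G -> F' =1 G' -> CD G G'.
Proof. by move=> + /funext <- /funext <-. Qed.
Lemma CD_eq F F' G' : CD F F' -> F' =1 G' -> CD F G'.
Proof. by move=> + /funext <-. Qed.
Lemma D1_eq f f' g' : D1 f f' -> f' =1 g' -> D1 f g'.
Proof. by move=> + /funext <-. Qed.

Lemma CD_cst (c : C) : CD (fun=> c) (fun=> 0).
Proof. by split; exact: D1_cst. Qed.
Lemma CD_add F F' G G' : CD F F' -> CD G G' ->
  CD (fun x => F x + G x) (fun x => F' x + G' x).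
Proof.
move=> [F1 F2] [G1 G2]; split.
- by apply: D1_ext (D1_add F1 G1) => x; rewrite ?cxE.
- by apply: D1_ext (D1_add F2 G2) => x; rewrite ?cxE.
Qed.
Lemma CD_opp F F' : CD F F' -> CD (fun x => - F x) (fun x => - F' x).
Proof.
move=> [F1 F2]; split.
- by apply: D1_ext (D1_opp F1) => x; rewrite ?cxE.
- by apply: D1_ext (D1_opp F2) => x; rewrite ?cxE.
Qed.
Lemma CD_sub F F' G G' : CD F F' -> CD G G' ->
  CD (fun x => F x - G x) (fun x => F' x - G' x).
Proof. by move=> hF /CD_opp hG; exact: CD_add. Qed.
Lemma CD_mul F F' G G' : CD F F' -> CD G G' ->
  CD (fun x => F x * G x) (fun x => F' x * G x + F x * G' x).
Proof.
move=> [F1 F2] [G1 G2]; split.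
- by apply: D1_ext (D1_sub (D1_mul F1 G1) (D1_mul F2 G2)) => x; rewrite ?cxE; ring.
- by apply: D1_ext (D1_add (D1_mul F1 G2) (D1_mul F2 G1)) => x; rewrite ?cxE; ring.
Qed.
Lemma CD_scale (c : C) F F' : CD F F' -> CD (fun x => c * F x) (fun x => c * F' x).
Proof. by move=> hF; apply: CD_eq (CD_mul (CD_cst c) hF) _ => x; rewrite mul0r add0r. Qed.
Lemma CD_conj F F' : CD F F' -> CD (fun x => (conjc (F x))) (fun x => (conjc (F' x))).
Proof.
move=> [F1 F2]; split.
- by apply: D1_ext F1 => x; rewrite ?cxE.
- by apply: D1_ext (D1_opp F2) => x; rewrite ?cxE.
Qed.
Lemma CD_real f f' : D1 f f' -> CD (fun x => (f x)%:C) (fun x => (f' x)%:C).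
Proof. by move=> hf; split => //; exact: D1_cst. Qed.
Lemma CD_comp F F' u u' : CD F F' -> D1 u u' ->
  CD (fun x => F (u x)) (fun x => (u' x)%:C * F' (u x)).
Proof.
move=> [F1 F2] hu; split.
- by apply: D1_ext (D1_comp F1 hu) => x; rewrite ?cxE /= ?mul0r ?subr0.
- by apply: D1_ext (D1_comp F2 hu) => x; rewrite ?cxE /= ?mul0r ?addr0.
Qed.
Lemma CD_refl F F' : CD F F' -> CD (fun x => F (- x)) (fun x => - F' (- x)).
Proof.
move=> hF; apply: CD_eq (CD_comp hF (D1_opp (@D1_id R))) _ => x /=.
by rewrite rmorphN /= rmorph1 mulN1r.
Qed.
Lemma CD_shift F F' a : CD F F' -> CD (fun x => F (x + a)) (fun x => F' (x + a)).
Proof.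
move=> hF; apply: CD_eq (CD_comp hF (D1_add (@D1_id R) (D1_cst a))) _ => x /=.
by rewrite addr0 rmorph1 mul1r.
Qed.
Lemma CD_0 F : CD F (fun=> 0) -> forall x y, F x = F y.
Proof. by move=> [F1 F2] x y; apply: complex_eq; [exact: (D1_0 F1)|exact: (D1_0 F2)]. Qed.

Definition cis (x : R) : C := cos x +i* sin x.

Lemma CD_cis u u' : D1 u u' -> CD (fun x => cis (u x)) (fun x => ii * (u' x)%:C * cis (u x)).
Proof.
move=> hu; split.
- by apply: D1_ext (D1_comp (@D1_cos R) hu) => x; rewrite ?cxE /=; ring.
- by apply: D1_ext (D1_comp (@D1_sin R) hu) => x; rewrite ?cxE /=; ring.
Qed.
Lemma cisD x y : cis (x + y) = cis x * cis y.
Proof. by apply: complex_eq; rewrite ?cxE /= ?cosD ?sinD //; ring. Qed.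
Lemma cisN x : cis (- x) = (conjc (cis x)).
Proof. by apply: complex_eq; rewrite ?cxE /= ?cosN ?sinN. Qed.
Lemma cis0 : cis 0 = 1. Proof. by rewrite /cis cos0 sin0. Qed.
Lemma cisNM x : cis (- x) * cis x = 1. Proof. by rewrite -cisD addNr cis0. Qed.
Lemma cisMN x : cis x * cis (- x) = 1. Proof. by rewrite -cisD subrr cis0. Qed.
Lemma cis_neq0 x : cis x != 0.
Proof.
by apply/eqP => h; have := cisNM x; rewrite h mulr0 => /esym/eqP; rewrite oner_eq0.
Qed.
Lemma cis2pi : cis (2 * pi) = 1.
Proof. by rewrite /cis mulr_natl cos2pi sin2pi. Qed.
Lemma cis_pihalf : cis (pi / 2) = ii.
Proof. by rewrite /cis cos_pihalf sin_pihalf. Qed.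
Lemma cisMn (n : nat) x : cis (n%:R * x) = cis x ^+ n.
Proof.
elim: n => [|n IH]; first by rewrite mul0r cis0.
by rewrite -addn1 natrD mulrDl mul1r cisD IH exprD expr1.
Qed.
Lemma cisMz (n : int) x : cis (n%:~R * x) = cis x ^ n.
Proof.
case: n => n; first exact: cisMn.
rewrite NegzE mulrNz mulNr -exprnN; apply: (mulIf (cis_neq0 (n.+1%:R * x))).
by rewrite cisNM cisMn mulVf// expf_neq0// cis_neq0.
Qed.
(** After removal of whole turns, an angle [y] strictly between 0 and 2 pi would have sin (y/2) > 0,
    whereas cos y = 1 forces sin (y/2) = 0 by the double-angle formula. *)
Lemma cis_eq1 x : cis x = 1 -> exists k : int, x = k%:~R * (2 * pi).
Proof.
move=> h; pose k := Num.floor (x / (2 * pi)); exists k.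
have p0 := pi_gt0 R.
have pp : 0 < 2 * pi :> R by lra.
set y := x - k%:~R * (2 * pi).
have hy : cis y = 1.
  by rewrite /y cisD h mul1r -mulNr -mulrNz cisMz cis2pi exp1rz.
have y0 : 0 <= y.
  by rewrite /y subr_ge0 -ler_pdivlMr// Num.Theory.ge_floor.
have y1 : y < 2 * pi.
  by rewrite /y ltrBlDl -[X in _ + X]mul1r -mulrDl -ltr_pdivrMr// -[1]/(1%:~R) -intrD; exact: floorD1_gt.
suff : y = 0 by move/eqP; rewrite subr_eq0 => /eqP.
have [c1 s1] : cos y = 1 /\ sin y = 0 by case: hy.
apply/eqP/negPn/negP => yn.
have hs := cos2Dsin2 (y / 2).
have s2 : sin (y / 2) != 0.
  by apply: lt0r_neq0; apply: sin_gt0_pi; lra.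
have : cos ((y / 2) *+ 2) = 1 by rewrite -mulr_natr divfK.
rewrite cos_mulr2n => c2; move/eqP: s2; apply.
have : sin (y / 2) ^+ 2 = 0.
  by move: hs c2; rewrite mulr2n; set a := cos _ ^+ 2; set b := sin _ ^+ 2; lra.
by move/eqP; rewrite expf_eq0 /= => /eqP.
Qed.
End ComplexCalculus.

(** * Means and Fourier coefficients *)
Section Mean.
Variable R : realType.
Local Notation C := R[i].
Local Notation re := (@complex.Re R).
Local Notation im := (@complex.Im R).
Local Notation normc := (@ComplexField.Normc.normc R).
Implicit Types (f g u v : R -> R) (F G H : R -> C).

Definition Ccont F := continuous (fun x => re (F x)) /\ continuous (fun x => im (F x)).

Lemma CD_cont F F' : CD F F' -> Ccont F.
Proof. by move=> [h1 h2]; split; [exact: (D1_cont h1)|exact: (D1_cont h2)]. Qed.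
Lemma continuous_eq f g : f =1 g -> continuous f -> continuous g.
Proof. by move=> /funext <-. Qed.
Lemma Ccont_ext F G : F =1 G -> Ccont F -> Ccont G.
Proof. by move=> /funext <-. Qed.
Lemma cont_cst (c : R) : continuous (fun _ : R => c).
Proof. by move=> x; exact: cst_continuous. Qed.
Lemma cont_add f g : continuous f -> continuous g -> continuous (fun x => f x + g x).
Proof. by move=> hf hg x; exact: (cvgD (hf x) (hg x)). Qed.
Lemma cont_sub f g : continuous f -> continuous g -> continuous (fun x => f x - g x).
Proof. by move=> hf hg x; exact: (cvgB (hf x) (hg x)). Qed.
Lemma cont_mul f g : continuous f -> continuous g -> continuous (fun x => f x * g x).
Proof. by move=> hf hg x; exact: (cvgM (hf x) (hg x)). Qed.
Lemma cont_comp f g : continuous f -> continuous g -> continuous (fun x => f (g x)).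
Proof. by move=> hf hg x; apply: continuous_comp; [exact: hg|exact: hf]. Qed.

Lemma Ccont_cst (c : C) : Ccont (fun=> c).
Proof. by split; exact: cont_cst. Qed.
Lemma Ccont_add F G : Ccont F -> Ccont G -> Ccont (fun x => F x + G x).
Proof.
move=> [F1 F2] [G1 G2]; split.
- by apply: continuous_eq (cont_add F1 G1) => x; rewrite ?cxE.
- by apply: continuous_eq (cont_add F2 G2) => x; rewrite ?cxE.
Qed.
Lemma Ccont_sub F G : Ccont F -> Ccont G -> Ccont (fun x => F x - G x).
Proof.
move=> [F1 F2] [G1 G2]; split.
- by apply: continuous_eq (cont_sub F1 G1) => x; rewrite ?cxE.
- by apply: continuous_eq (cont_sub F2 G2) => x; rewrite ?cxE.
Qed.
Lemma Ccont_mul F G : Ccont F -> Ccont G -> Ccont (fun x => F x * G x).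
Proof.
move=> [F1 F2] [G1 G2]; split.
- by apply: continuous_eq (cont_sub (cont_mul F1 G1) (cont_mul F2 G2)) => x; rewrite ?cxE.
- by apply: continuous_eq (cont_add (cont_mul F1 G2) (cont_mul F2 G1)) => x; rewrite ?cxE.
Qed.
Lemma Ccont_refl F : Ccont F -> Ccont (fun x => F (- x)).
Proof.
move=> [F1 F2].
have h : continuous (fun x : R => - x) := D1_cont (D1_opp (@D1_id R)).
by split; [exact: (cont_comp F1 h)|exact: (cont_comp F2 h)].
Qed.
Lemma Ccont_conj F : Ccont F -> Ccont (fun x => (conjc (F x))).
Proof.
move=> [F1 F2]; split.
- by apply: continuous_eq F1 => x; rewrite ?cxE.
- by apply: continuous_eq (cont_sub (@cont_cst 0) F2) => x; rewrite ?cxE ?sub0r.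
Qed.
Lemma Ccont_real f : continuous f -> Ccont (fun x => (f x)%:C).
Proof. by move=> hf; split => //; exact: cont_cst. Qed.
Lemma Ccont_sum (I : Type) (r : seq I) (P : pred I) (F : I -> R -> C) :
  (forall i, Ccont (F i)) -> Ccont (fun x => \sum_(i <- r | P i) F i x).
Proof.
move=> h; elim: r => [|i r IH].
  by apply: Ccont_ext (Ccont_cst 0) => x; rewrite big_nil.
case Pi: (P i).
  by apply: Ccont_ext (Ccont_add (h i) IH) => x; rewrite big_cons Pi.
by apply: Ccont_ext IH => x; rewrite big_cons Pi.
Qed.
Lemma Ccont_prim F : Ccont F -> exists G, CD G F.
Proof.
move=> [/primitive_ex [G1 h1 _] /primitive_ex [G2 h2 _]].
by exists (fun x => G1 x +i* G2 x); split.
Qed.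

(** The mean over one period, encoded by a chosen antiderivative. It is meaningful only when an
    antiderivative exists; [primitive_ex] provides one for continuous [f]. *)
Definition rmean f : R :=
  let F := get [set F | D1 F f] in (F pi - F (- pi)) / (2 * pi).
Definition cmean F : C := rmean (fun x => re (F x)) +i* rmean (fun x => im (F x)).

Lemma rmeanE g f : D1 g f -> rmean f = (g pi - g (- pi)) / (2 * pi).
Proof.
move=> hg; rewrite /rmean; set F := get _.
have hF : D1 F f by apply: (@getPex _ [set F | D1 F f]); exists g.
congr (_ / _); have := @D1_0 R (fun x => F x - g x) _ pi (- pi).
have h : D1 (fun x => F x - g x) (fun=> 0).
  by apply: D1_ext (D1_sub hF hg) => x //; rewrite subrr.
by move=> /(_ h); lra.
Qed.
Lemma cmeanE G F : CD G F -> cmean F = (G pi - G (- pi)) * ((2 * pi)^-1)%:C.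
Proof.
move=> [h1 h2]; apply: complex_eq; rewrite ?cxE /= ?mulr0 ?mul0r ?subr0 ?addr0.
- by rewrite (rmeanE h1).
- by rewrite (rmeanE h2) add0r mulrC.
Qed.

Lemma twopi_gt0 : 0 < 2 * pi :> R. Proof. by have := pi_gt0 R; lra. Qed.

Lemma rmeanD f g : continuous f -> continuous g ->
  rmean (fun x => f x + g x) = rmean f + rmean g.
Proof.
move=> /primitive_ex [F hF _] /primitive_ex [G hG _].
by rewrite (rmeanE hF) (rmeanE hG) (rmeanE (D1_add hF hG)); ring.
Qed.
Lemma rmeanZ a f : continuous f -> rmean (fun x => a * f x) = a * rmean f.
Proof.
move=> /primitive_ex [F hF _]; rewrite (rmeanE hF).
have h : D1 (fun x => a * F x) (fun x => a * f x).
  by apply: D1_eq (D1_mul (D1_cst a) hF) _ => x; rewrite mul0r add0r.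
by rewrite (rmeanE h); ring.
Qed.
Lemma rmean_cst c : rmean (fun=> c) = c.
Proof.
have h : D1 (fun x : R => c * x) (fun=> c).
  by apply: D1_eq (D1_mul (D1_cst c) (@D1_id R)) _ => x; rewrite mul0r add0r mulr1.
rewrite (rmeanE h); have := twopi_gt0; move/lt0r_neq0 => nz.
by apply: (mulIf nz); rewrite divfK//; ring.
Qed.
Lemma rmean_le f g : continuous f -> continuous g ->
  (forall x, - pi <= x <= pi -> f x <= g x) -> rmean f <= rmean g.
Proof.
move=> /primitive_ex [F hF _] /primitive_ex [G hG _] le.
rewrite (rmeanE hF) (rmeanE hG) ler_pM2r ?invr_gt0 ?twopi_gt0//.
have pp : - pi <= pi :> R by have := pi_gt0 R; lra.
have [c hc] := D1_mvt (D1_sub hG hF) pp.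
have := le c hc; rewrite -subr_ge0 => h e.
have : 0 <= (g c - f c) * (pi - - pi) by rewrite mulr_ge0// subr_ge0.
by rewrite -e; lra.
Qed.
Lemma rmean_ge0 f : continuous f -> (forall x, 0 <= f x) -> 0 <= rmean f.
Proof. by move=> hf h; rewrite -(rmean_cst 0); apply: rmean_le => //; exact: cont_cst. Qed.
(** If the mean were zero, the monotone antiderivative would have equal values at both ends, hence
    be constant on the period, against its positive derivative at 0. *)
Lemma rmean_gt0 f : continuous f -> (forall x, 0 <= f x) -> 0 < f 0 -> 0 < rmean f.
Proof.
move=> cf f0 fp; rewrite lt_neqAle rmean_ge0// andbT eq_sym.
have [F hF _] := primitive_ex cf; rewrite (rmeanE hF).
rewrite mulf_eq0 invr_eq0 (gt_eqF twopi_gt0) orbF; apply/eqP => e.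
have p0 := pi_gt0 R.
have mono := D1_le hF f0.
have key : forall x, - pi <= x <= pi -> F x = F 0.
  move=> x /andP[x1 x2]; have := mono _ _ x1; have := mono _ _ x2.
  have := mono _ _ (ltW p0); have : - pi <= 0 :> R by lra.
  by move=> /mono; lra.
have d0 : is_derive (0 : R) 1 F 0.
  apply: (@near_eq_is_derive _ _ _ (fun=> F 0)).
    have hp : - pi < 0 :> R by lra.
    apply: filterS2 (lt_nbhsr hp) (lt_nbhsl p0) => x h1 h2.
    by apply/esym/key; rewrite !ltW.
have [_ h1] := hF 0; have [_ h2] := d0; move: fp; rewrite -h1 h2 ltxx.
by [].
Qed.

Lemma cmeanD F G : Ccont F -> Ccont G -> cmean (fun x => F x + G x) = cmean F + cmean G.
Proof.
move=> /Ccont_prim[F0 hF] /Ccont_prim[G0 hG].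
by rewrite (cmeanE hF) (cmeanE hG) (cmeanE (CD_add hF hG)); ring.
Qed.
Lemma cmeanZ c F : Ccont F -> cmean (fun x => c * F x) = c * cmean F.
Proof.
move=> /Ccont_prim[F0 hF].
by rewrite (cmeanE hF) (cmeanE (CD_scale c hF)); ring.
Qed.
Lemma cmean_ext F G : F =1 G -> cmean F = cmean G.
Proof. by move=> /funext ->. Qed.
Lemma cmeanB F G : Ccont F -> Ccont G -> cmean (fun x => F x - G x) = cmean F - cmean G.
Proof.
move=> /Ccont_prim[F0 hF] /Ccont_prim[G0 hG].
by rewrite (cmeanE hF) (cmeanE hG) (cmeanE (CD_sub hF hG)); ring.
Qed.
Lemma cmean_sum (I : Type) (r : seq I) (P : pred I) (F : I -> R -> C) :
  (forall i, Ccont (F i)) ->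
  cmean (fun x => \sum_(i <- r | P i) F i x) = \sum_(i <- r | P i) cmean (F i).
Proof.
move=> h; elim: r => [|i r IH].
  rewrite big_nil (@cmean_ext _ (fun=> 0 * 0)); last by move=> x; rewrite big_nil mul0r.
  by rewrite cmeanZ ?mul0r//; exact: Ccont_cst.
rewrite big_cons; case Pi: (P i).
  rewrite -IH -cmeanD//; last exact: Ccont_sum.
  by apply: cmean_ext => x; rewrite big_cons Pi.
by rewrite -IH; apply: cmean_ext => x; rewrite big_cons Pi.
Qed.
Lemma cmean_refl F : Ccont F -> cmean (fun x => F (- x)) = cmean F.
Proof.
move=> /Ccont_prim[G hG]; rewrite (cmeanE hG).
have h : CD (fun x => - G (- x)) (fun x => F (- x)).
  by apply: CD_eq (CD_opp (CD_refl hG)) _ => x; rewrite opprK.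
by rewrite (cmeanE h) !opprK; ring.
Qed.
Lemma cmean_cst c : cmean (fun=> c) = c.
Proof. by apply: complex_eq; rewrite /= rmean_cst. Qed.
Lemma cmean_per F F' : CD F F' -> F pi = F (- pi) -> cmean F' = 0.
Proof. by move=> h e; rewrite (cmeanE h) e subrr mul0r. Qed.

Lemma normc_ge0 (z : C) : 0 <= normc z.
Proof. by case: z => a b /=; exact: sqrtr_ge0. Qed.
Lemma normc_real (x : R) : normc x%:C = `|x|.
Proof. by rewrite /= expr0n /= addr0 sqrtr_sqr. Qed.
Lemma normc_cis x : normc (cis x) = 1.
Proof. by rewrite /= cos2Dsin2 sqrtr1. Qed.
Lemma normc_conj (z : C) : normc ((conjc z)) = normc z.
Proof. by case: z => a b /=; rewrite sqrrN. Qed.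
Lemma normc_opp (z : C) : normc (- z) = normc z.
Proof. by case: z => a b /=; rewrite !sqrrN. Qed.
Lemma normc_sqr (z : C) : normc z ^+ 2 = re z ^+ 2 + im z ^+ 2.
Proof. by case: z => a b /=; rewrite sqr_sqrtr// addr_ge0// sqr_ge0. Qed.
Lemma mulcJ (z : C) : z * (conjc z) = (normc z ^+ 2)%:C.
Proof. by rewrite normc_sqr; apply: complex_eq; rewrite ?cxE /=; ring. Qed.
Lemma re_le_normc (z : C) : re z <= normc z.
Proof.
case: z => a b /=; apply: le_trans (ler_norm a) _.
by rewrite -sqrtr_sqr ler_sqrt ?addr_ge0 ?sqr_ge0// lerDl sqr_ge0.
Qed.
Lemma normc_le2 (z : C) : normc z <= `|re z| + `|im z|.
Proof.
have h : 0 <= `|re z| + `|im z| by rewrite addr_ge0.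
rewrite -[X in _ <= X](ger0_norm h) -sqrtr_sqr; case: z h => a b /= h.
rewrite ler_sqrt ?sqr_ge0// sqrrD (real_normK (num_real a)) (real_normK (num_real b)).
have : 0 <= `|a| * `|b| by rewrite mulr_ge0.
by rewrite mulr2n; lra.
Qed.
Lemma normc_triangle (z w : C) : normc (z + w) <= normc z + normc w.
Proof.
have := ler_normD z w; rewrite !normc_def -(rmorphD (real_complex R)) lecR.
by case: z w => [a b] [c d].
Qed.
(** Multiplying by the unit number [w] that makes the mean real and positive reduces the estimate to
    real parts, where monotonicity of [rmean] applies. *)
Lemma cmean_le F g : Ccont F -> continuous g ->
  (forall x, - pi <= x <= pi -> normc (F x) <= g x) -> normc (cmean F) <= rmean g.
Proof.
move=> hF hg le; set m := cmean F.
have [m0|mn] := eqVneq m 0.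
  rewrite m0 ComplexField.Normc.normc0 -(rmean_cst 0); apply: rmean_le => //; first exact: cont_cst.
  by move=> x /le; apply: le_trans; exact: normc_ge0.
have nm : 0 < normc m.
  by rewrite lt_neqAle normc_ge0 andbT eq_sym; apply/eqP => /ComplexField.Normc.eq0_normc; apply/eqP.
pose w := (conjc m) * ((normc m)^-1)%:C.
have nw : normc w = 1.
  rewrite ComplexField.Normc.normcM normc_conj normc_real ger0_norm ?invr_ge0 ?normc_ge0//.
  by rewrite divff// lt0r_neq0.
have e : w * m = (normc m)%:C.
  rewrite /w mulrAC [(conjc _) * _]mulrC mulcJ -rmorphM /=; congr (_%:C).
  by rewrite expr2 -mulrA divff ?mulr1// lt0r_neq0.
rewrite -[normc m]/(re ((normc m)%:C)) -e -cmeanZ// /cmean /=.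
have [h _] := Ccont_mul (Ccont_cst w) hF.
apply: rmean_le => // x /le; apply: le_trans.
apply: le_trans (re_le_normc _) _.
by rewrite ComplexField.Normc.normcM nw mul1r.
Qed.
Lemma Ccont_normc F : Ccont F -> continuous (fun x => normc (F x)).
Proof.
move=> [h1 h2].
have hs : continuous (fun x => (re (F x) * re (F x) + im (F x) * im (F x))).
  by apply: cont_add; apply: cont_mul.
apply: continuous_eq (cont_comp (@sqrt_continuous R) hs) => x.
by case: (F x) => a b /=; rewrite !expr2.
Qed.
End Mean.

(** * Fourier coefficients and multiplication by e^{az} *)

Section FourierCoefficients.
Variable R : realType.
Local Notation C := R[i].
Local Notation re := (@complex.Re R).
Local Notation im := (@complex.Im R).
Local Notation ii := (@Complex (Real.sort R) 0 1).
Local Notation normc := (@ComplexField.Normc.normc R).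
Implicit Types (f g u v : R -> R) (F G H : R -> C) (m n k : int).

Definition ech n (x : R) : C := cis (n%:~R * x).
Definition fcoef n F : C := cmean (fun x => ech (- n) x * F x).

Lemma echD m n x : ech (m + n) x = ech m x * ech n x.
Proof. by rewrite /ech intrD mulrDl cisD. Qed.
Lemma ech0 x : ech 0 x = 1. Proof. by rewrite /ech mul0r cis0. Qed.
Lemma ech1 x : ech 1 x = cis x. Proof. by rewrite /ech mul1r. Qed.
Lemma ech_refl n x : ech n (- x) = ech (- n) x.
Proof. by rewrite /ech mulrN -mulNr -mulrNz. Qed.
Lemma ech_conj n x : (conjc (ech n x)) = ech (- n) x.
Proof. by rewrite /ech -cisN -mulNr -mulrNz. Qed.
Lemma ech_at0 n : ech n 0 = 1 :> C. Proof. by rewrite /ech mulr0 cis0. Qed.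
Lemma ech_pi n : ech n pi = ech n (- pi).
Proof.
apply: (mulIf (cis_neq0 (n%:~R * pi))); rewrite -!cisD mulrN addNr cis0.
by rewrite -mulrDr -mulr2n -mulr_natl cisMz cis2pi exp1rz.
Qed.
Lemma ech_per n x : ech n (x + 2 * pi) = ech n x.
Proof. by rewrite /ech mulrDr cisD [X in _ * X]cisMz cis2pi exp1rz mulr1. Qed.
Lemma CD_ech n : CD (ech n) (fun x => ii * (n%:~R)%:C * ech n x).
Proof.
apply: CD_cis; apply: D1_eq (D1_mul (D1_cst n%:~R) (@D1_id R)) _ => x.
by rewrite mul0r add0r mulr1.
Qed.
Lemma Ccont_ech n : Ccont (@ech n). Proof. exact: CD_cont (CD_ech n). Qed.
Lemma normc_ech n x : normc (ech n x) = 1. Proof. exact: normc_cis. Qed.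

Lemma fcoef_ext n F G : F =1 G -> fcoef n F = fcoef n G.
Proof. by move=> /funext ->. Qed.
Lemma Ccont_coef n F : Ccont F -> Ccont (fun x => ech n x * F x).
Proof. by move=> ?; apply: Ccont_mul => //; exact: Ccont_ech. Qed.
Lemma Ccont_scale (c : C) F : Ccont F -> Ccont (fun x => c * F x).
Proof. by move=> ?; apply: Ccont_mul => //; exact: Ccont_cst. Qed.
Lemma fcoefD n F G : Ccont F -> Ccont G -> fcoef n (fun x => F x + G x) = fcoef n F + fcoef n G.
Proof.
move=> hF hG; rewrite /fcoef -cmeanD; [|exact: Ccont_coef..].
by apply: cmean_ext => x; rewrite mulrDr.
Qed.
Lemma fcoefB n F G : Ccont F -> Ccont G -> fcoef n (fun x => F x - G x) = fcoef n F - fcoef n G.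
Proof.
move=> hF hG; rewrite /fcoef -cmeanB; [|exact: Ccont_coef..].
by apply: cmean_ext => x; rewrite mulrBr.
Qed.
Lemma fcoefZ n c F : Ccont F -> fcoef n (fun x => c * F x) = c * fcoef n F.
Proof.
move=> hF; rewrite /fcoef -cmeanZ; last exact: Ccont_coef.
by apply: cmean_ext => x; rewrite mulrCA.
Qed.
Lemma fcoef_sum n (I : Type) (r : seq I) (P : pred I) (F : I -> R -> C) :
  (forall i, Ccont (F i)) ->
  fcoef n (fun x => \sum_(i <- r | P i) F i x) = \sum_(i <- r | P i) fcoef n (F i).
Proof.
move=> h; rewrite /fcoef -cmean_sum => [|i]; last exact: Ccont_coef.
by apply: cmean_ext => x; rewrite mulr_sumr.
Qed.
Lemma fcoef_shift n k F : fcoef n (fun x => ech k x * F x) = fcoef (n - k) F.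
Proof. by apply: cmean_ext => x; rewrite mulrA -echD opprB addrC. Qed.
Lemma fcoef_refl n F : Ccont F -> fcoef n (fun x => F (- x)) = fcoef (- n) F.
Proof.
move=> hF; rewrite /fcoef -[RHS]cmean_refl; last exact: Ccont_coef.
by apply: cmean_ext => x; rewrite ech_refl opprK.
Qed.
Lemma fcoef_der n F F' : CD F F' -> Ccont F' -> F pi = F (- pi) ->
  fcoef n F' = ii * (n%:~R)%:C * fcoef n F.
Proof.
move=> hF cF' e; have hp := CD_mul (CD_ech (- n)) hF.
have e' : ech (- n) pi * F pi = ech (- n) (- pi) * F (- pi) by rewrite e ech_pi.
have := cmean_per hp e'; rewrite cmeanD; last 2 first.
- apply: Ccont_mul (CD_cont hF); apply: Ccont_mul (Ccont_ech _); exact: Ccont_cst.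
- by apply: Ccont_coef.
rewrite -/(fcoef n F') (@cmean_ext _ _ (fun x => ii * ((- n)%:~R)%:C * (ech (- n) x * F x))).
  rewrite cmeanZ -/(fcoef n F); last by apply: Ccont_coef (CD_cont hF).
  by move/eqP; rewrite addr_eq0 => /eqP; rewrite mulrNz rmorphN /= mulrN mulNr => /oppr_inj <-.
by move=> x; rewrite mulrA.
Qed.
(** After a frequency shift this is [fcoef_der] for the constant 1: zero equals i m times its
    coefficient of index m. *)
Lemma fcoef_ech n k : fcoef n (ech k) = (n == k)%:R.
Proof.
have -> : fcoef n (ech k) = fcoef (n - k) (fun=> 1).
  by rewrite -fcoef_shift; apply: fcoef_ext => x; rewrite mulr1.
rewrite -subr_eq0; set m := n - k.
have [->|mn] := eqVneq m 0.
  rewrite /fcoef (@cmean_ext _ _ (fun=> 1)) ?cmean_cst// => x.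
  by rewrite oppr0 ech0 mulr1.
have := @fcoef_der m (fun=> 1) (fun=> 0) (CD_cst 1) (Ccont_cst 0) erefl.
have -> : fcoef m (fun=> 0) = 0.
  rewrite /fcoef (@cmean_ext _ _ (fun=> 0)) ?cmean_cst// => x.
  by rewrite mulr0.
move/esym/eqP; rewrite !mulf_eq0 => /orP[/orP[]|/eqP ->//].
  by rewrite eq_complex /= oner_eq0 andbF.
by rewrite eq_complex /= eqxx andbT intr_eq0 (negPf mn).
Qed.
Lemma fcoef_le n F : Ccont F -> normc (fcoef n F) <= rmean (fun x => normc (F x)).
Proof.
move=> hF; apply: cmean_le; [exact: Ccont_coef|exact: Ccont_normc|move=> x _].
by rewrite ComplexField.Normc.normcM normc_ech mul1r.
Qed.

(** This is e^{az} at z = e^{ix}: a factor with only nonnegative modes, and with [- x] for [x] only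
    nonpositive ones. *)
Definition cexp (a : R) (x : R) : C := (expR (a * cos x))%:C * cis (a * sin x).

Lemma cexpN a x : cexp (- a) x * cexp a x = 1.
Proof. by rewrite /cexp mulrACA -rmorphM -expRD -cisD !mulNr !addNr expR0 cis0 mulr1. Qed.
Lemma cexp_neq0 a x : cexp a x != 0.
Proof. by apply/eqP => h; have := cexpN a x; rewrite h mulr0 => /esym/eqP; rewrite oner_eq0. Qed.
Lemma CD_cexp a : CD (cexp a) (fun x => ii * (a%:C * ech 1 x) * cexp a x).
Proof.
have h1 : D1 (fun x : R => a * cos x) (fun x => - (a * sin x)).
  by apply: D1_eq (D1_mul (D1_cst a) (@D1_cos R)) _ => x; rewrite mul0r add0r mulrN.
have h2 : D1 (fun x : R => a * sin x) (fun x => a * cos x).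
  by apply: D1_eq (D1_mul (D1_cst a) (@D1_sin R)) _ => x; rewrite mul0r add0r.
apply: CD_eq (CD_mul (CD_real (D1_comp (@D1_exp R) h1)) (CD_cis h2)) _ => x.
by rewrite ech1 /cexp; apply: complex_eq; rewrite !cxE /=; ring.
Qed.
Lemma Ccont_cexp a : Ccont (cexp a). Proof. exact: CD_cont (CD_cexp a). Qed.
Lemma Ccont_cexpM a F : Ccont F -> Ccont (fun x => cexp a x * F x).
Proof. by move=> ?; apply: Ccont_mul => //; exact: Ccont_cexp. Qed.
Lemma cexp_per a x : cexp a (x + 2 * pi) = cexp a x.
Proof. by rewrite /cexp mulr_natl cosD2pi sinD2pi. Qed.

Lemma D1_ge0_from f f' : D1 f f' -> (forall x, 0 <= x -> 0 <= f' x) ->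
  forall x, 0 <= x -> f 0 <= f x.
Proof.
move=> hf h x x0; have [c /andP[c0 _] e] := D1_mvt hf x0.
by rewrite -subr_ge0 e subr0 mulr_ge0// h.
Qed.
Lemma D1_bound f f' g g' : D1 f f' -> D1 g g' -> f 0 = 0 -> g 0 = 0 ->
  (forall x, 0 <= x -> `|f' x| <= g' x) -> forall x, 0 <= x -> `|f x| <= g x.
Proof.
move=> hf hg f0 g0 h x x0; rewrite ler_norml.
have h1 := @D1_ge0_from _ _ (D1_add hg hf) _ x x0.
have h2 := @D1_ge0_from _ _ (D1_sub hg hf) _ x x0.
have h1' : 0 <= g x + f x.
  by move: h1; rewrite f0 g0 addr0; apply => y y0; have := h y y0; rewrite ler_norml => /andP[]; lra.
have h2' : 0 <= g x - f x.
  by move: h2; rewrite f0 g0 subr0; apply => y y0; have := h y y0; rewrite ler_norml => /andP[]; lra.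
by apply/andP; split; lra.
Qed.
Lemma D1_sum (K : nat) (f f' : nat -> R -> R) : (forall k : nat, D1 (f k) (f' k)) ->
  D1 (fun x => \sum_(k < K) f k x) (fun x => \sum_(k < K) f' k x).
Proof.
move=> h; elim: K => [|K IH].
  by apply: D1_ext (D1_cst 0) => x; rewrite big_ord0.
by apply: D1_ext (D1_add IH (h K)) => x; rewrite big_ord_recr.
Qed.
Lemma D1_pow (c : R) (n : nat) : D1 (fun s : R => (s * c) ^+ n.+1 / n.+1`!%:R)
  (fun s => c * ((s * c) ^+ n / n`!%:R)).
Proof.
elim: n => [|n IH].
  apply: D1_ext (D1_mul (@D1_id R) (D1_cst c)) => s; first by rewrite /= expr1 factS fact0 muln1 divr1.
  by rewrite fact0 expr0 divr1 mul1r mulr0 addr0 mulr1.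
have hc := D1_mul (@D1_id R) (D1_cst c).
have H := D1_mul (D1_mul IH hc) (D1_cst (n.+2%:R^-1)).
have nz (k : nat) : k.+1%:R != 0 :> R by rewrite pnatr_eq0.
have fz (k : nat) : k`!%:R != 0 :> R by rewrite pnatr_eq0 -lt0n fact_gt0.
apply: D1_ext H => s /=.
  rewrite [n.+2`!]factS natrM invfM [in RHS]exprS.
  by set A := (n.+2%:R)^-1; set B := (_`!%:R)^-1; ring.
rewrite !mulr0 !addr0 mul1r [n.+1`!]factS natrM exprS.
have -> : n.+2%:R = n.+1%:R + 1 :> R by rewrite -natr1.
have n0 : (n.+1%:R + 1 : R) != 0 by rewrite natr1.
move: (nz n) (fz n) n0; move: (n.+1%:R : R) (n`!%:R : R) => N F N0 F0 N1.
by field; rewrite N1 N0 F0.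
Qed.

(** Taylor estimate for the real part of e^{i al} exp(s a e^{ix}), by induction on [K].
    Differentiating in [s] lowers [K] by one and adds [x] to the phase, which is why [al] must be
    arbitrary; the majorant has a larger derivative. *)
Lemma expR_rem (K : nat) (x al a s : R) : 0 <= s ->
  `| expR (s * (a * cos x)) * cos (s * (a * sin x) + al)
     - \sum_(k < K) (s * a) ^+ k / k`!%:R * cos (k%:R * x + al) |
  <= expR (s * `|a|) * ((s * `|a|) ^+ K / K`!%:R).
Proof.
move=> s0; elim: K s s0 al => [|K IH] s s0 al.
  rewrite big_ord0 subr0 expr0 fact0 divr1 mulr1 normrM.
  rewrite ger0_norm ?expR_ge0//; apply: le_trans (_ : expR (s * (a * cos x)) <= _).
    by rewrite ler_piMr ?expR_ge0// cos_max.
  rewrite ler_expR; apply: ler_wpM2l => //; apply: le_trans (ler_norm _) _.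
  by rewrite normrM ler_piMr// cos_max.
pose f (K : nat) al (s : R) := expR (s * (a * cos x)) * cos (s * (a * sin x) + al)
     - \sum_(k < K) (s * a) ^+ k / k`!%:R * cos (k%:R * x + al).
have hlin c : D1 (fun s : R => s * c) (fun=> c).
  by apply: D1_eq (D1_mul (@D1_id R) (D1_cst c)) _ => y; rewrite mulr0 addr0 mul1r.
have hf : D1 (f K.+1 al) (fun s => a * f K (x + al) s).
  have hS : D1 (fun s => \sum_(k < K.+1) (s * a) ^+ k / k`!%:R * cos (k%:R * x + al))
      (fun s => a * \sum_(k < K) (s * a) ^+ k / k`!%:R * cos (k%:R * x + (x + al))).
    pose F (k : nat) (s : R) := (s * a) ^+ k.+1 / k.+1`!%:R * cos (k.+1%:R * x + al).
    pose F' (k : nat) (s : R) := a * ((s * a) ^+ k / k`!%:R * cos (k%:R * x + (x + al))).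
    have hF (k : nat) : D1 (F k) (F' k).
      apply: D1_eq (D1_mul (D1_pow a k) (D1_cst _)) _ => y.
      rewrite mulr0 addr0 /F' -!mulrA; congr (_ * (_ * (_ * cos _))).
      by rewrite -natr1; ring.
    apply: D1_ext (D1_add (D1_cst (cos al)) (@D1_sum K _ _ hF)) => y.
      rewrite big_ord_recl expr0 fact0 divr1 mul1r mul0r add0r; congr (_ + _).
    by rewrite add0r mulr_sumr.
  have hE := D1_mul (D1_comp (@D1_exp R) (hlin (a * cos x)))
    (D1_comp (@D1_cos R) (D1_add (hlin (a * sin x)) (D1_cst al))).
  apply: D1_eq (D1_sub hE hS) _ => y; rewrite /f mulrBr; congr (_ - _).
  by rewrite (_ : _ + (x + al) = (y * (a * sin x) + al) + x) ?[cos (_ + x)]cosD; ring.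
have hg : D1 (fun s => expR (s * `|a|) * ((s * `|a|) ^+ K.+1 / K.+1`!%:R))
   (fun s => `|a| * expR (s * `|a|) * ((s * `|a|) ^+ K.+1 / K.+1`!%:R)
      + expR (s * `|a|) * (`|a| * ((s * `|a|) ^+ K / K`!%:R))).
  by apply: D1_mul (D1_pow _ _); exact: D1_comp (@D1_exp R) (hlin _).
apply: (@D1_bound _ _ _ _ hf hg _ _ _ s s0).
- rewrite /f !mul0r expR0 mul1r add0r big_ord_recl big1; last first.
    by move=> i _; rewrite expr0n /= !mul0r.
  by rewrite addr0 /= expr0 fact0 divr1 mul1r mul0r add0r subrr.
- by rewrite !mul0r expr0n /= mul0r mulr0.
- move=> y y0; rewrite normrM; apply: le_trans (_ : `|a| * (expR (y * `|a|) * ((y * `|a|) ^+ K / K`!%:R)) <= _).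
    by apply: ler_wpM2l => //; exact: IH.
  rewrite mulrCA lerDr; apply: mulr_ge0; first by rewrite mulr_ge0// expR_ge0.
  by rewrite divr_ge0// exprn_ge0// mulr_ge0.
Qed.

Lemma cexp_rem (K : nat) (a x : R) :
  normc (cexp a x - \sum_(k < K) (a ^+ k / k`!%:R)%:C * ech k x)
  <= 2 * (expR `|a| * (`|a| ^+ K / K`!%:R)).
Proof.
apply: le_trans (normc_le2 _) _; rewrite mulr_natl mulr2n.
have h al := @expR_rem K x al a 1 ler01; move: h; rewrite !mul1r => h.
have rs (r : seq 'I_K) (F : 'I_K -> C) : re (\sum_(i <- r) F i) = \sum_(i <- r) re (F i).
  by elim: r => [|i r IH]; rewrite ?big_nil// !big_cons cxE IH.
have ims (r : seq 'I_K) (F : 'I_K -> C) : im (\sum_(i <- r) F i) = \sum_(i <- r) im (F i).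
  by elim: r => [|i r IH]; rewrite ?big_nil// !big_cons cxE IH.
apply: lerD.
- have := h 0; rewrite ?cxE rs /= mul0r subr0 !addr0; apply: le_trans.
  rewrite le_eqVlt; apply/orP; left; apply/eqP; congr (`| _ - _ |).
  by apply: eq_bigr => k _; rewrite mul0r subr0 addr0.
(* The phase - pi/2 turns cosines into sines and thus yields the imaginary part. *)
- have := h (- (pi / 2)); rewrite ?cxE ims /= mul0r addr0; apply: le_trans.
  rewrite le_eqVlt; apply/orP; left; apply/eqP; congr (`| _ - _ |).
    by rewrite cosBpihalf.
  by apply: eq_bigr => k _; rewrite ?cxE /= mul0r addr0 cosBpihalf.
Qed.
End FourierCoefficients.

(** * Functions without Fourier modes vanish at the origin *)

Section FourierUniqueness.
Variable R : realType.
Local Notation C := R[i].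
Local Notation normc := (@ComplexField.Normc.normc R).
Local Notation normcM := (ComplexField.Normc.normcM).
Implicit Types (f g u v : R -> R) (F G H : R -> C) (m n k : int).

(** A truncated convolution formula with explicit error. Its limit gives the vanishing statement
    [fcoef_cexp_van]; at order [l.+1] it gives the quantitative bound in [not_all_fixed]. *)
Lemma fcoef_cexp_rem (K : nat) (a : R) n F : Ccont F ->
  normc (fcoef n (fun x => cexp a x * F x)
         - \sum_(k < K) (a ^+ k / k`!%:R)%:C * fcoef (n - k%:Z) F)
  <= 2 * (expR `|a| * (`|a| ^+ K / K`!%:R)) * rmean (fun x => normc (F x)).
Proof.
move=> hF; set B := 2 * _.
have cK (k : nat) : Ccont (fun x => (a ^+ k / k`!%:R)%:C * (ech k x * F x)).
  exact: Ccont_scale (Ccont_coef _ hF).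
have -> : \sum_(k < K) (a ^+ k / k`!%:R)%:C * fcoef (n - k%:Z) F
   = fcoef n (fun x => \sum_(k < K) (a ^+ k / k`!%:R)%:C * (ech k x * F x)).
  rewrite fcoef_sum => [|k]; last exact: cK.
  by apply: eq_bigr => k _; rewrite fcoefZ ?fcoef_shift//; exact: Ccont_coef.
have cE : Ccont (fun x => cexp a x * F x) by exact: Ccont_cexpM.
have cS : Ccont (fun x => \sum_(k < K) (a ^+ k / k`!%:R)%:C * (ech k x * F x)).
  by apply: Ccont_sum => k; exact: cK.
rewrite -fcoefB//; apply: le_trans (fcoef_le _ (Ccont_sub cE cS)) _.
rewrite -rmeanZ; last exact: Ccont_normc.
apply: rmean_le.
- exact: Ccont_normc (Ccont_sub cE cS).
- by apply: cont_mul; [exact: cont_cst|exact: Ccont_normc].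
move=> x _; rewrite (_ : _ - _ = (cexp a x - \sum_(k < K) (a ^+ k / k`!%:R)%:C * ech k x) * F x).
  by rewrite normcM ler_wpM2r ?normc_ge0// cexp_rem.
by rewrite mulrBl mulr_suml; congr (_ - _); apply: eq_bigr => k _; rewrite mulrA.
Qed.

Lemma squeeze_le0 (z M : R) (w : nat -> R) : w @ \oo --> 0 ->
  (forall K, z <= M * w K) -> z <= 0.
Proof.
move=> w0 h; rewrite -(mulr0 M).
have hc : (fun K => M * w K) @ \oo --> M * 0 by apply: cvgMr.
rewrite -(cvg_lim _ hc)//; apply: limr_ge; first by apply/cvg_ex; exists (M * 0).
by near=> K; exact: h.
Unshelve. all: by end_near. Qed.

Lemma normc_le0 (z : C) : normc z <= 0 -> z = 0.
Proof.
by move=> h; apply: ComplexField.Normc.eq0_normc; apply/le_anti; rewrite h normc_ge0.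
Qed.

(** Multiplication by e^{az} only raises frequencies, so all truncated convolutions are zero and
    only the remainder is left, which tends to 0. *)
Lemma fcoef_cexp_van (a : R) n F : Ccont F -> (forall m, m <= n -> fcoef m F = 0) ->
  fcoef n (fun x => cexp a x * F x) = 0.
Proof.
move=> hF h; apply: normc_le0; apply: (@squeeze_le0 _ (2 * expR `|a| * rmean (fun x => normc (F x))) (exp_coeff `|a|)).
  exact: cvg_exp_coeff.
move=> K; have := @fcoef_cexp_rem K a n F hF; rewrite big1 ?subr0 => [|k _].
  by move/le_trans; apply; rewrite le_eqVlt; apply/orP; left; apply/eqP; rewrite /exp_coeff /=; ring.
by rewrite h ?mulr0// lerBlDr lerDl.
Qed.

(** Powers of [K] are trigonometric polynomials that concentrate at 0, and their moments are
    computable by parts. *)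
Let K (x : R) : R := cos (x / 2) ^+ 2.

Let halfD : D1 (fun x : R => x / 2) (fun=> 2^-1).
Proof. by apply: D1_eq (D1_mul (@D1_id R) (D1_cst 2^-1)) _ => x; rewrite mulr0 addr0 mul1r. Qed.
Let sinhD : D1 (fun x : R => sin (x / 2)) (fun x => 2^-1 * cos (x / 2)).
Proof. exact: D1_comp (@D1_sin R) halfD. Qed.
Let coshD : D1 (fun x : R => cos (x / 2)) (fun x => 2^-1 * - sin (x / 2)).
Proof. exact: D1_comp (@D1_cos R) halfD. Qed.
Let cont_K N : continuous (fun x : R => K x ^+ N).
Proof.
elim: N => [|N IH]; first exact: cont_cst.
apply: continuous_eq (cont_mul (cont_mul (D1_cont coshD) (D1_cont coshD)) IH) => x.
by rewrite exprS /K expr2.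
Qed.
Let cont_s2K N : continuous (fun x : R => sin (x / 2) ^+ 2 * K x ^+ N).
Proof.
apply: continuous_eq (cont_mul (cont_mul (D1_cont sinhD) (D1_cont sinhD)) (@cont_K N)) => x.
by rewrite expr2.
Qed.
Let I N := rmean (fun x => K x ^+ N).
Let S N := rmean (fun x => sin (x / 2) ^+ 2 * K x ^+ N).

Let I_gt0 N : 0 < I N.
Proof.
apply: rmean_gt0; first exact: cont_K.
  by move=> x; rewrite exprn_ge0// sqr_ge0.
by rewrite /K mul0r cos0 !expr1n.
Qed.

Let cosnD (n : nat) : D1 (fun x : R => cos (x / 2) ^+ n.+1)
   (fun x => - (n.+1%:R / 2) * (sin (x / 2) * cos (x / 2) ^+ n)).
Proof.
elim: n => [|n IH].
  by apply: D1_ext coshD => x; rewrite ?expr1// expr0; field.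
apply: D1_ext (D1_mul IH coshD) => x; first by rewrite [RHS]exprSr.
rewrite -[n.+2%:R]natr1 exprSr; by field.
Qed.

(** This measures the concentration: sin^2 (x/2) has relative weight 1/(2N+2). Combine sin^2 = 1 -
    cos^2 with the vanishing mean of the derivative of sin (x/2) cos^{2N+1} (x/2). *)
Let S_I N : (2 * N.+1)%:R * S N = I N.
Proof.
have SI : S N = I N - I N.+1.
  rewrite -[I N.+1]opprK -mulN1r opprK; apply/eqP; rewrite eq_sym; apply/eqP.
  rewrite -[I N.+1]/(rmean _) -[- _]mulN1r -rmeanZ; last exact: cont_K.
  rewrite -rmeanD; [|exact: cont_K|by apply: cont_mul; [exact: cont_cst|exact: cont_K]].
  congr rmean; apply/funext => x; rewrite sin2cos2 -/(K x) exprS; ring.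
have parts : I N.+1 = (2 * N.+1)%:R * S N - S N.
  have hD := D1_mul sinhD (cosnD N.*2).
  have := rmeanE hD; set f := (X in rmean X) => e.
  have {}e : rmean f = 0 by rewrite e mulNr cos_pihalf cosN cos_pihalf !exprS !mul0r !mulr0 subrr mul0r.
  have e2 : rmean f =
     2^-1 * I N.+1 + - (N.*2.+1%:R / 2) * S N.
    rewrite -!rmeanZ; [|exact: cont_s2K|exact: cont_K].
    rewrite -rmeanD; [|by apply: cont_mul; [exact: cont_cst|exact: cont_K]
                      |by apply: cont_mul; [exact: cont_cst|exact: cont_s2K]].
    congr rmean; apply/funext => x; rewrite /f /K -!exprM !mul2n doubleS.
    rewrite !exprS; by ring.
  move: e; rewrite e2; have -> : (2 * N.+1)%:R = N.*2.+1%:R + 1 :> R.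
    by rewrite natr1; congr (_%:R); lia.
  by set a := N.*2.+1%:R; set b := I _; set c := S _; nra.
by move: SI parts; set a := _%:R; set b := S N; nra.
Qed.

(** For x >= 0, sin (x/2) = 2 sin (x/4) cos (x/4) and sin (x/4) = cos c * x/4. Both cosines are
    taken in [0, pi/4], so their product is at least 1/2. *)
Let half_le_sin (x : R) : - pi <= x <= pi -> `|x| <= 4 * `|sin (x / 2)|.
Proof.
wlog x0 : x / 0 <= x => [h /andP[h1 h2]|/andP[_ xpi]].
  case/orP: (le_total 0 x) => hx; first by apply: h => //; apply/andP.
  have := h (- x); rewrite normrN mulNr sinN normrN oppr_ge0; apply => //.
  by apply/andP; split; lra.
have p0 := pi_gt0 R.
have q0 : 0 <= x / 4 by lra.
have [c /andP[c0 c1]] := D1_mvt (@D1_sin R) q0; rewrite sin0 !subr0 => e.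
have e2 : sin (x / 2) = (cos (x / 4) * sin (x / 4)) *+ 2.
  by rewrite -sin_mulr2n; congr sin; rewrite mulr2n; field.
have mono (y : R) : 0 <= y -> y <= pi / 2 / 2 -> 1 <= cos y ^+ 2 *+ 2 /\ 0 < cos y.
  move=> y0 y1; have : 0 <= cos (y *+ 2).
    by apply: cos_ge0_pihalf; rewrite mulr2n; move: y0 y1 p0; set p := pi / 2; rewrite (_ : pi = 2 * p) /p; [|by field]; move=> *; apply/andP; split; lra.
  rewrite cos_mulr2n; split; first by lra.
  by apply: cos_gt0_pihalf; apply/andP; split; lra.
have q1 : x / 4 <= pi / 2 / 2 by lra.
have q2 : c <= pi / 2 / 2 by lra.
have [m1 m2] := mono _ q0 q1; have [m3 m4] := mono c c0 q2.
rewrite ger0_norm// e2 e; apply: le_trans (ler_norm _) _ => //.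
rewrite ger0_norm// ger0_norm; last first.
  by rewrite mulrn_wge0// !mulr_ge0// ltW.
rewrite mulr2n; move: m1 m3; rewrite !mulr2n !expr2; set a := cos _ in m2 *; set b := cos _ in m4 * => m1 m3.
have ab : 1 <= 2 * (a * b).
  have h1 : 1 <= (2 * (a * b)) ^+ 2 by rewrite expr2; nra.
  have : 0 < 2 * (a * b) by rewrite !mulr_gt0.
  move=> h2; rewrite leNgt; apply/negP => h3; move: h1; rewrite leNgt => /negP; apply.
  by rewrite expr_lt1// ltW.
nra.
Qed.

(** Multiplication by [K] mixes neighbouring modes, so [K^N F] has no modes either. Hence the mean
    of [K^N] times [- F 0] is the mean of [K^N (F - F 0)], which is relatively small by
    concentration and a Lipschitz bound. *)
Lemma fcoef_uniq0 F F' : CD F F' -> Ccont F' -> (forall n, fcoef n F = 0) -> F 0 = 0.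
Proof.
move=> hF cF' h0; have cF := CD_cont hF.
have cKF N : Ccont (fun x => (K x ^+ N)%:C * F x).
  by apply: Ccont_mul cF; apply: Ccont_real; exact: cont_K.
have van N : forall n, fcoef n (fun x => (K x ^+ N)%:C * F x) = 0.
  elim: N => [|N IH] n; first by rewrite -(h0 n); apply: fcoef_ext => x; rewrite expr0 mul1r.
  set G := fun x => (K x ^+ N)%:C * F x.
  have cG : Ccont G := cKF N.
  have c1 k : Ccont (fun x => ech k x * G x) by exact: Ccont_coef.
  rewrite (@fcoef_ext _ _ _ (fun x => 2^-1 * G x + 4^-1 * (ech 1 x * G x + ech (- 1) x * G x))).
    rewrite fcoefD ?fcoefZ ?fcoefD ?fcoef_shift ?IH ?addr0 ?mulr0//.
    - by rewrite addr0.
    - exact: Ccont_add.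
    - exact: Ccont_scale.
    - by apply: Ccont_scale; exact: Ccont_add.
  move=> x; rewrite /G exprS rmorphM /= -mulrA.
  have -> : (K x)%:C = 2^-1 + 4^-1 * (ech 1 x + ech (-1) x).
    rewrite -ech_conj ech1 /K.
    have e : cos (x / 2) ^+ 2 = (1 + cos x) / 2.
      have : cos ((x / 2) *+ 2) = cos x by congr cos; rewrite mulr2n; field.
      by rewrite cos_mulr2n mulr2n; lra.
    have k4 : (cos (x / 2) ^+ 2)%:C * 4%:R = 2%:R + (cis x + (conjc (cis x))).
      rewrite -(rmorph_nat (real_complex R) 4) -(rmorph_nat (real_complex R) 2) e.
      by apply: complex_eq; rewrite !cxE /=; field.
    have n4 : (4 : C) != 0 by rewrite pnatr_eq0.
    have n2 : (2 : C) != 0 by rewrite pnatr_eq0.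
    by apply: (mulIf n4); rewrite k4; field; rewrite ?n4 ?n2.
  by ring.
have bnd f f' : D1 f f' -> continuous f' -> exists2 L : R, 0 <= L & forall x : R, - pi <= x <= pi -> `|f x - f 0| <= L * `|sin (x / 2)|.
  move=> hf cf'.
  have pp : - pi <= pi :> R by have := pi_gt0 R; lra.
  have [M hM] : exists M, forall x : R, - pi <= x <= pi -> `|f' x| <= M.
    have [c _ hc] := EVT_max pp (continuous_subspaceT (cont_comp (@norm_continuous _ R) cf')).
    by exists `|f' c| => x hx; apply: hc; rewrite in_itv.
  have M0 : 0 <= M by apply: le_trans (hM pi _) => //; apply/andP.
  exists (M * 4) => [|x hx]; first by rewrite mulr_ge0.
  rewrite -mulrA; apply: le_trans (_ : M * `|x| <= _); last first.
    by apply: ler_wpM2l => //; exact: half_le_sin.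
  have p0 := pi_gt0 R; case/andP: hx => hx1 hx2.
  case/orP: (le_total 0 x) => x0.
    have [c /andP[c0 c1] ->] := D1_mvt hf x0.
    by rewrite subr0 normrM ler_wpM2r//; apply: hM; apply/andP; split; lra.
  have [c /andP[c0 c1] e] := D1_mvt hf x0.
  rewrite distrC e sub0r normrM normrN ler_wpM2r//; apply: hM; apply/andP; split; lra.
have [L L0 hL] : exists2 L : R, 0 <= L & forall x : R, - pi <= x <= pi -> normc (F x - F 0) <= L * `|sin (x / 2)|.
  case: hF cF' => [h1 h2] [c1 c2]; have [L1 L10 hL1] := bnd _ _ h1 c1; have [L2 L20 hL2] := bnd _ _ h2 c2.
  exists (L1 + L2) => [|x hx]; first by rewrite addr_ge0.
  apply: le_trans (normc_le2 _) _; rewrite !cxE mulrDl; apply: lerD; [exact: hL1|exact: hL2].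
(* Only the moment of sin^2 (x/2) is known, so the linear bound is traded for a quadratic one by 2 s
   <= d + s^2 / d. *)
have main (d : R) N : 0 < d -> normc (F 0) <= L / 2 * (d + (d * (2 * N.+1)%:R)^-1).
  move=> d0.
  have cKr : Ccont (fun x => (K x ^+ N)%:C) by apply: Ccont_real; exact: cont_K.
  have e1 : (I N)%:C * - F 0 = fcoef 0 (fun x => (K x ^+ N)%:C * (F x - F 0)).
    rewrite (@fcoef_ext _ _ _ (fun x => (K x ^+ N)%:C * F x + - F 0 * (K x ^+ N)%:C)); last by move=> x; ring.
    rewrite fcoefD//; last by exact: Ccont_scale.
    rewrite van add0r fcoefZ// mulrC; congr (_ * _).
    rewrite /fcoef (@cmean_ext _ _ (fun x => (K x ^+ N)%:C)) => [|x]; last by rewrite oppr0 ech0 mul1r.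
    by apply: complex_eq => //=; rewrite rmean_cst.
  have cD : Ccont (fun x => (K x ^+ N)%:C * (F x - F 0)).
    by apply: Ccont_mul => //; apply: Ccont_sub => //; exact: Ccont_cst.
  have := fcoef_le 0 cD; rewrite -e1 normcM normc_real gtr0_norm// normc_opp.
  pose g (x : R) : R := L / 2 * d * K x ^+ N + L / 2 / d * (sin (x / 2) ^+ 2 * K x ^+ N).
  have cg1 : continuous (fun x : R => L / 2 * d * K x ^+ N) by apply: cont_mul (@cont_K N); exact: cont_cst.
  have cg2 : continuous (fun x : R => L / 2 / d * (sin (x / 2) ^+ 2 * K x ^+ N)).
    by apply: cont_mul (@cont_s2K N); exact: cont_cst.
  have cg : continuous g by apply: cont_add.
  have le : rmean (fun x => normc ((K x ^+ N)%:C * (F x - F 0))) <= rmean g.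
    apply: rmean_le => //; first exact: Ccont_normc.
    move=> x hx; have Kp : 0 <= K x ^+ N by apply: exprn_ge0; exact: sqr_ge0.
    rewrite normcM normc_real ger0_norm//.
    rewrite /g [_ * (_ * K x ^+ N)]mulrA -mulrDl mulrC ler_wpM2r//.
    apply: le_trans (hL x hx) _.
    have -> : L / 2 * d + L / 2 / d * sin (x / 2) ^+ 2 = L * ((d + sin (x / 2) ^+ 2 / d) / 2) by field; rewrite lt0r_neq0.
    apply: ler_wpM2l => //; rewrite -(real_normK (num_real (sin (x / 2)))).
    set s := `|_|; rewrite ler_pdivlMr//.
    have : 0 <= (d - s) ^+ 2 / d by rewrite divr_ge0// ?sqr_ge0// ltW.
    have -> : (d - s) ^+ 2 / d = d + s ^+ 2 / d - 2 * s by field; rewrite lt0r_neq0.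
    lra.
  move=> h; have := le_trans h le; rewrite rmeanD// rmeanZ; last exact: cont_K.
  rewrite rmeanZ; last exact: cont_s2K.
  rewrite -/(I N) -/(S N) -(S_I N).
  have nn : (2 * N.+1)%:R != 0 :> R by rewrite pnatr_eq0.
  have SN : 0 < S N by move: (I_gt0 N); rewrite -S_I pmulr_rgt0// ltr0n.
  set n := (2 * N.+1)%:R in nn *.
  have n0 : 0 < n by rewrite ltr0n.
  rewrite (_ : n * S N * normc (F 0) = normc (F 0) * (n * S N)); last by ring.
  rewrite (_ : L / 2 * d * (n * S N) + _ = L / 2 * (d + (d * n)^-1) * (n * S N)).
    by rewrite ler_pM2r// mulr_gt0.
  by clearbody n; field; rewrite nn lt0r_neq0.
apply: normc_le0; apply: (@squeeze_le0 _ L (@harmonic R)); first exact: cvg_harmonic.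
(* With d = 1/(M+1) and N = (M+1)^2 both summands are at most 1/(M+1). *)
move=> M; apply: le_trans (main (harmonic M) (M.+1 * M.+1)%N _) _; first by rewrite /harmonic invr_gt0 ltr0n.
rewrite -mulrA; apply: ler_wpM2l => //; rewrite /harmonic.
have h1 : (M.+1%:R^-1 * (2 * (M.+1 * M.+1).+1)%:R)^-1 <= M.+1%:R^-1 :> R.
  rewrite lef_pV2 ?posrE ?mulr_gt0 ?invr_gt0 ?ltr0n//.
  rewrite ler_pdivlMl ?ltr0n// -natrM ler_nat; lia.
move: h1; set a := _^-1 : R; set b := _^-1 : R. rewrite -[_ M]/b; lra.
Qed.
End FourierUniqueness.

(** * The linear system behind the phase equation *)
Section LinearSystem.
Variable R : realType.
Local Notation C := R[i].
Local Notation re := (@complex.Re R).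
Local Notation im := (@complex.Im R).
Local Notation ii := (@Complex (Real.sort R) 0 1).
Local Notation normc := (@ComplexField.Normc.normc R).
Local Notation normcM := (ComplexField.Normc.normcM).
Implicit Types (f g u v : R -> R) (Z F : R -> C).

(** The product with e^{cx} is nondecreasing and the one with e^{-cx} nonincreasing; they give f <=
    0 to the left and to the right of [x0]. *)
Lemma gronwall0 f f' c x0 : D1 f f' -> (forall x, 0 <= f x) ->
  (forall x, `|f' x| <= c * f x) -> f x0 = 0 -> forall x, f x = 0.
Proof.
move=> hf f0 hc fx0 x.
have hE (s : R) : D1 (fun y => f y * expR (s * y)) (fun y => (f' y + s * f y) * expR (s * y)).
  have h := D1_comp (@D1_exp R) (D1_mul (D1_cst s) (@D1_id R)).
  by apply: D1_eq (D1_mul hf h) _ => y /=; ring.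
have ge0 y : 0 <= f' y + c * f y /\ 0 <= - (f' y - c * f y).
  by have := hc y; rewrite ler_norml => /andP[]; lra.
apply/le_anti; rewrite f0 andbT.
have fin (s : R) : f x * expR (s * x) <= 0 -> f x <= 0.
  by rewrite pmulr_lle0// expR_gt0.
case/orP: (le_total x x0) => xx.
- apply: (fin c); have h := D1_le (hE c) _ xx.
  by rewrite -[0](mul0r (expR (c * x0))) -fx0; apply: h => y; rewrite mulr_ge0 ?expR_ge0//; have [] := ge0 y.
- apply: (fin (- c)); have h := D1_le (D1_opp (hE (- c))) _ xx.
  move: h; rewrite fx0 mul0r oppr0 oppr_ge0; apply => y.
  by rewrite -mulNr mulr_ge0 ?expR_ge0// mulNr; have [] := ge0 y.
Qed.

Variables (l : nat) (mu rho : R).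
Definition gfun (t : R) : R := l%:R + 2 * mu * cos t.
Definition Gfun (t : R) : R := l%:R * t + 2 * mu * sin t.
Definition Efun (t : R) : C := cis (Gfun t).

Lemma D1_Gfun : D1 Gfun gfun.
Proof.
apply: D1_eq (D1_add (D1_mul (D1_cst _) (@D1_id R)) (D1_mul (D1_cst _) (@D1_sin R))) _ => t.
by rewrite /gfun; ring.
Qed.
Lemma cont_gfun : continuous gfun.
Proof.
apply: D1_cont (D1_add (D1_cst l%:R) (D1_mul (D1_cst (2 * mu)) (@D1_cos R))).
Qed.
Lemma CD_Efun : CD Efun (fun t => ii * (gfun t)%:C * Efun t).
Proof. exact: CD_cis D1_Gfun. Qed.
Lemma gfunN t : gfun (- t) = gfun t. Proof. by rewrite /gfun cosN. Qed.
Lemma EfunJ t : Efun t * (conjc (Efun t)) = 1.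
Proof. by rewrite /Efun -cisN cisMN. Qed.
Lemma Efun0 : Efun 0 = 1.
Proof. by rewrite /Efun /Gfun sin0 !mulr0 addr0 cis0. Qed.
Lemma gfun_per t : gfun (t + 2 * pi) = gfun t.
Proof. by rewrite /gfun [in cos _]mulr_natl cosD2pi. Qed.
Lemma Efun_per t : Efun (t + 2 * pi) = Efun t.
Proof.
rewrite /Efun (_ : Gfun _ = Gfun t + l%:R * (2 * pi)).
  by rewrite cisD cisMn cis2pi expr1n mulr1.
by rewrite /Gfun [in sin _]mulr_natl sinD2pi; ring.
Qed.
(** On the circle this reads E = z^l e^{mu z} e^{- mu / z}, separating the factors that raise
    frequencies from those that lower them. *)
Lemma Efun_fact t : Efun t = ech l t * (cexp mu t * cexp (- mu) (- t)).
Proof.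
have -> : cexp mu t * cexp (- mu) (- t) = cis (2 * mu * sin t).
  rewrite /cexp cosN sinN mulrN !mulNr opprK mulrACA -rmorphM -expRD subrr expR0 mul1r -cisD.
  by congr cis; ring.
by rewrite /Efun /Gfun cisD.
Qed.

(* With g = phi' + 2 rho sin phi and Gfun a primitive of g, the phase equation is the
   projectivization of this linear system: see jsol_sol and sol_jsol. Its solutions are
   the restrictions to the unit circle of solutions of a double confluent Heun equation. *)
Definition sol Z F := CD Z (fun t => ii * rho%:C * F t) /\
  CD F (fun t => ii * (gfun t)%:C * F t - ii * rho%:C * Z t).

Lemma sol_lin (a b : C) Z1 F1 Z2 F2 : sol Z1 F1 -> sol Z2 F2 ->
  sol (fun t => a * Z1 t + b * Z2 t) (fun t => a * F1 t + b * F2 t).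
Proof.
move=> [h1 h2] [h3 h4]; split.
- by apply: CD_eq (CD_add (CD_scale a h1) (CD_scale b h3)) _ => t; ring.
- by apply: CD_eq (CD_add (CD_scale a h2) (CD_scale b h4)) _ => t; ring.
Qed.

(** Gronwall for |Z|^2 + |F|^2. The term with [gfun] rotates [F] and drops out of the derivative, so
    the rate 2 |rho| does not depend on time. *)
Lemma sol_eq0 Z F t0 : sol Z F -> Z t0 = 0 -> F t0 = 0 -> forall t, Z t = 0 /\ F t = 0.
Proof.
move=> [[h1 h2] [h3 h4]] z0 f0.
pose N t := re (Z t) ^+ 2 + im (Z t) ^+ 2 + (re (F t) ^+ 2 + im (F t) ^+ 2).
have hN := D1_add (D1_add (D1_mul h1 h1) (D1_mul h2 h2)) (D1_add (D1_mul h3 h3) (D1_mul h4 h4)).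
have N0 t : N t = 0.
  apply: (@gronwall0 _ _ (2 * `|rho|) t0 (D1_ext _ (fun=> erefl) hN)).
  - by move=> x; rewrite /N !expr2.
  - by move=> x; rewrite !addr_ge0// sqr_ge0.
  - move=> x; rewrite !cxE /= /N; move: (re (Z x)) (im (Z x)) (re (F x)) (im (F x)) => a b c d.
    set e := gfun x.
    rewrite [X in `|X|](_ : _ = rho * (4 * (b * c - a * d))); last by ring.
    rewrite normrM [2 * _]mulrC -mulrA; apply: ler_wpM2l => //.
    rewrite ler_norml; apply/andP; split.
      have : 0 <= (b + c) ^+ 2 + (a - d) ^+ 2 by rewrite addr_ge0// sqr_ge0.
      by nra.
    have : 0 <= (b - c) ^+ 2 + (a + d) ^+ 2 by rewrite addr_ge0// sqr_ge0.
    by nra.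
  - by rewrite /N z0 f0 /= expr0n /= !addr0.
move=> t; have := N0 t; rewrite /N => /eqP.
rewrite !paddr_eq0 ?addr_ge0 ?sqr_ge0// !sqrf_eq0 => /andP[/andP[/eqP a /eqP b] /andP[/eqP c /eqP d]].
by split; apply: complex_eq.
Qed.

Lemma sol_uniq Z1 F1 Z2 F2 t0 : sol Z1 F1 -> sol Z2 F2 -> Z1 t0 = Z2 t0 -> F1 t0 = F2 t0 ->
  forall t, Z1 t = Z2 t /\ F1 t = F2 t.
Proof.
move=> h1 h2 ez ef t.
have [||a b] := @sol_eq0 _ _ t0 (sol_lin 1 (-1) h1 h2) _ _ t; rewrite ?ez ?ef; try by ring.
by move: a b; rewrite !mul1r !mulN1r => /eqP; rewrite subr_eq0 => /eqP -> /eqP; rewrite subr_eq0 => /eqP ->.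
Qed.

(** Together with [sol_conj] and [sol_refl] this gives the symmetries of the system. By uniqueness,
    invariance of a solution is tested at time 0. Solutions invariant under [sol_conj] have |Z| =
    |F| and therefore carry a phase. *)
Lemma sol_swap Z F : sol Z F ->
  sol (fun t => Efun t * F (- t)) (fun t => Efun t * Z (- t)).
Proof.
move=> [h1 h2]; split.
- apply: CD_eq (CD_mul CD_Efun (CD_refl h2)) _ => t; rewrite gfunN; ring.
- apply: CD_eq (CD_mul CD_Efun (CD_refl h1)) _ => t; ring.
Qed.
Lemma conj_real (x : R) : (conjc (x%:C)) = x%:C :> C.
Proof. by apply: complex_eq; rewrite /= ?oppr0. Qed.
Lemma conj_i : (conjc (ii : C)) = - ii.
Proof. by apply: complex_eq; rewrite /= ?oppr0. Qed.

Lemma conj_M (x y : C) : conjc (x * y) = conjc x * conjc y. Proof. exact: rmorphM. Qed.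
Lemma conj_B (x y : C) : conjc (x - y) = conjc x - conjc y. Proof. exact: rmorphB. Qed.
Lemma conj_N (x : C) : conjc (- x) = - conjc x. Proof. exact: rmorphN. Qed.
Definition cjE := (conj_M, conj_B, conj_N, conj_real, conj_i).

Lemma sol_conj Z F : sol Z F ->
  sol (fun t => Efun t * (conjc (F t))) (fun t => Efun t * (conjc (Z t))).
Proof.
move=> [h1 h2]; split.
- apply: CD_eq (CD_mul CD_Efun (CD_conj h2)) _ => t.
  by rewrite !cjE; ring.
- apply: CD_eq (CD_mul CD_Efun (CD_conj h1)) _ => t.
  by rewrite !cjE; ring.
Qed.
Lemma sol_refl Z F : sol Z F -> sol (fun t => (conjc (Z (- t)))) (fun t => (conjc (F (- t)))).
Proof.
move=> [h1 h2]; split.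
- apply: CD_eq (CD_conj (CD_refl h1)) _ => t.
  by rewrite !cjE; ring.
- apply: CD_eq (CD_conj (CD_refl h2)) _ => t.
  by rewrite !cjE gfunN; ring.
Qed.
Lemma sol_shift Z F : sol Z F -> sol (fun t => Z (t + 2 * pi)) (fun t => F (t + 2 * pi)).
Proof.
move=> [h1 h2]; split; first exact: CD_shift h1.
by apply: CD_eq (CD_shift (2 * pi) h2) _ => t; rewrite gfun_per.
Qed.

(** Liouville's formula: the trace of the system is i [gfun], the logarithmic derivative of
    [Efun]. *)
Lemma sol_wronsk Z1 F1 Z2 F2 : sol Z1 F1 -> sol Z2 F2 -> forall t,
  Z1 t * F2 t - Z2 t * F1 t = (Z1 0 * F2 0 - Z2 0 * F1 0) * Efun t.
Proof.
move=> [h1 h2] [h3 h4] t.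
have hW := CD_mul (CD_conj CD_Efun) (CD_sub (CD_mul h1 h4) (CD_mul h3 h2)).
have hW0 : CD (fun x => conjc (Efun x) * (Z1 x * F2 x - Z2 x * F1 x)) (fun=> 0).
  by apply: CD_eq hW _ => x; rewrite !cjE; ring.
have := CD_0 hW0 t 0; rewrite Efun0 conjc1 mul1r => <-.
by rewrite mulrAC [conjc _ * _]mulrC EfunJ mul1r.
Qed.

Definition jsol (phi : R -> R) := D1 phi (fun t => - (2 * rho) * sin (phi t) + gfun t).

Lemma cis_mpi2 (x : R) : ii * cis (x - pi / 2) = cis x.
Proof. by rewrite cisD cisN cis_pihalf conj_i mulrCA mulrN -expr2 sqr_i opprK mulr1. Qed.
Lemma cis_ppi2 (x : R) : cis (x + pi / 2) = ii * cis x.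
Proof. by rewrite cisD cis_pihalf mulrC. Qed.
Lemma cisE (x : R) : cis x = (cos x)%:C + ii * (sin x)%:C.
Proof. by apply: complex_eq; rewrite !cxE /=; ring. Qed.

(** The phase is encoded by e^{i phi} = i F / Z, so Z'/Z = rho e^{i phi}. Its real part integrates
    to the logarithm of the amplitude [p]; its imaginary part is the phase equation. *)
Lemma jsol_sol phi : jsol phi ->
  exists p : R -> R, [/\ forall t, 0 < p t, p 0 = 1 &
    sol (fun t => (p t)%:C * cis ((Gfun t + pi / 2 - phi t) / 2))
        (fun t => (p t)%:C * cis ((Gfun t - pi / 2 + phi t) / 2))].
Proof.
move=> hphi.
have [q hq q0] := primitive_ex (cont_mul (@cont_cst R rho) (cont_comp (@continuous_cos R) (D1_cont hphi))).
have hp := D1_comp (@D1_exp R) hq.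
have half u u' : D1 u u' -> D1 (fun t => u t / 2) (fun t => u' t / 2).
  by move=> h; apply: D1_eq (D1_mul h (D1_cst (2^-1))) _ => t; rewrite mulr0 addr0.
have ha := half _ _ (D1_sub (D1_add D1_Gfun (D1_cst (pi / 2))) hphi).
have hb := half _ _ (D1_add (D1_sub D1_Gfun (D1_cst (pi / 2))) hphi).
exists (fun t => expR (q t)); split; [by move=> t; exact: expR_gt0|by rewrite q0 expR0|split].
- apply: CD_eq (CD_mul (CD_real hp) (CD_cis ha)) _ => t.
  have e : ii * cis ((Gfun t - pi / 2 + phi t) / 2) = cis (phi t) * cis ((Gfun t + pi / 2 - phi t) / 2).
    by rewrite -cisD -[RHS]cis_mpi2; congr (_ * cis _); field.
  rewrite [RHS](_ : _ = rho%:C * (expR (q t))%:C * (ii * cis ((Gfun t - pi / 2 + phi t) / 2))); last by ring.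
  rewrite e [cis (phi t)]cisE; rewrite (_ : (_ + 0 - _) / 2 = rho * sin (phi t)); last by field.
  by rewrite !rmorphM /=; ring.
- apply: CD_eq (CD_mul (CD_real hp) (CD_cis hb)) _ => t.
  have e : ii * cis ((Gfun t + pi / 2 - phi t) / 2) = - (cis (- phi t) * cis ((Gfun t - pi / 2 + phi t) / 2)).
    rewrite -cisD (_ : (Gfun t + pi / 2 - phi t) / 2 = (- phi t + (Gfun t - pi / 2 + phi t) / 2) + pi / 2); last by field.
    by rewrite cis_ppi2 mulrA -expr2 sqr_i mulN1r.
  rewrite [RHS](_ : _ = ii * (gfun t)%:C * ((expR (q t))%:C * cis ((Gfun t - pi / 2 + phi t) / 2)) - rho%:C * (expR (q t))%:C * (ii * cis ((Gfun t + pi / 2 - phi t) / 2))); last by ring.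
  rewrite e [cis (- _)]cisE cosN sinN; rewrite (_ : (_ - 0 + _) / 2 = gfun t - rho * sin (phi t)); last by field.
  by rewrite !(rmorphB, rmorphM, rmorphN) /=; ring.
Qed.

(** [Z] has no zero by uniqueness. Instead of choosing an argument of [Z], the phase equation is
    integrated with [k] in place of sin phi; the polar form obtained for [Z] then shows that [k] is
    sin phi. *)
Lemma sol_jsol Z F (p0 x : R) : sol Z F -> (forall t, F t = Efun t * (conjc (Z t))) -> 0 < p0 ->
  Z 0 = p0%:C * cis ((pi / 2 - x) / 2) ->
  exists phi, [/\ jsol phi, phi 0 = x & exists2 Y : R -> R, forall t, 0 < Y t &
    forall t, Z t = (Y t)%:C * cis ((Gfun t + pi / 2 - phi t) / 2)].
Proof.
move=> hs hr p0p Z0; have [hZ hF] := hs.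
have nz t : Z t != 0.
  apply/eqP => zt; have ft : F t = 0 by rewrite hr zt conjc0 mulr0.
  have [z0 _] := sol_eq0 hs zt ft 0.
  move: z0; rewrite Z0 => /eqP; rewrite mulf_eq0 (negPf (cis_neq0 _)) orbF eq_complex /= eqxx andbT.
  by rewrite (gt_eqF p0p).
have cN : continuous (fun t => (normc (Z t) ^+ 2)^-1).
  apply: D1_cont (D1_inv _ (D1_ext _ (fun=> erefl) (D1_add (D1_mul (proj1 hZ) (proj1 hZ)) (D1_mul (proj2 hZ) (proj2 hZ))))).
    move=> t; rewrite sqrf_eq0; apply/eqP => /ComplexField.Normc.eq0_normc; exact/eqP.
  by move=> t; rewrite normc_sqr !expr2.
have [cW1 cW2] := Ccont_mul (CD_cont hF) (Ccont_conj (CD_cont hZ)).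
pose k t := re (F t * (conjc (Z t))) * (normc (Z t) ^+ 2)^-1.
pose j t := - rho * (im (F t * (conjc (Z t))) * (normc (Z t) ^+ 2)^-1).
have ck : continuous k by apply: cont_mul.
have cj : continuous j by apply: cont_mul; [exact: cont_cst|exact: cont_mul].
have [K hK K0] := primitive_ex cj.
have [P hP P0] := primitive_ex (cont_sub cont_gfun (cont_mul (@cont_cst R (2 * rho)) ck)).
pose phi t := x + P t.
have hphi : D1 phi (fun t => gfun t - 2 * rho * k t).
  by apply: D1_eq (D1_add (D1_cst x) hP) _ => t; rewrite add0r.
pose th t := (Gfun t + pi / 2 - phi t) / 2.
have hth : D1 th (fun t => rho * k t).
  apply: D1_eq (D1_mul (D1_sub (D1_add D1_Gfun (D1_cst (pi / 2))) hphi) (D1_cst (2^-1))) _ => t.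
  by field.
(* The logarithmic derivative of [Z], split into growth of modulus [j] and growth of argument
   [rho * k]. *)
have e t : ii * rho%:C * F t = ((j t)%:C + ii * (rho * k t)%:C) * Z t.
  set w := F t * conjc (Z t); set n := normc (Z t) ^+ 2.
  have n0 : n != 0.
    by rewrite sqrf_eq0; apply/eqP => /ComplexField.Normc.eq0_normc; apply/eqP.
  have hn : n%:C * (n^-1)%:C = 1 :> C by rewrite -(rmorphM (real_complex R)) /= divff.
  have ew : ii * rho%:C * w = ((j t)%:C + ii * (rho * k t)%:C) * n%:C.
    by rewrite /j /k -/w -/n; apply: complex_eq; rewrite !cxE /=; field.
  rewrite -[LHS]mulr1 -hn -mulcJ.
  rewrite (_ : _ * (_ * _) = ii * rho%:C * w * Z t * (n^-1)%:C); last by rewrite /w; ring.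
  by rewrite ew -[RHS]mulr1 -hn; ring.
have hY : CD (fun t => (expR (- K t))%:C * (Z t * cis (- th t))) (fun=> 0).
  have h := CD_mul (CD_real (D1_comp (@D1_exp R) (D1_opp hK))) (CD_mul hZ (CD_cis (D1_opp hth))).
  apply: CD_eq h _ => t; rewrite e !(rmorphM, rmorphN) /=; ring.
have Zt t : Z t = (p0 * expR (K t))%:C * cis (th t).
  have := CD_0 hY t 0; rewrite K0 oppr0 expR0 mul1r Z0.
  have -> : th 0 = (pi / 2 - x) / 2.
    by rewrite /th /phi P0 /Gfun sin0 !mulr0 !addr0 add0r.
  rewrite -[RHS]mulrA cisMN mulr1 => h.
  have e1 : (expR (- K t))%:C * (expR (K t))%:C = 1 :> C.
    by rewrite -rmorphM -expRD addNr expR0.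
  have -> : (p0 * expR (K t))%:C = p0%:C * (expR (K t))%:C :> C by apply: rmorphM.
  by rewrite -h -[LHS]mulr1 -{1}(cisNM (th t)) -[LHS]mulr1 -e1; ring.
exists phi; split.
- apply: D1_eq hphi _ => t.
  suff -> : k t = sin (phi t) by ring.
  rewrite /k hr Zt; set y := p0 * _.
  have y0 : y != 0 by rewrite mulf_neq0 ?lt0r_neq0 ?expR_gt0.
  rewrite conj_M conj_real -cisN normcM normc_real normc_cis mulr1 (real_normK (num_real _)).
  rewrite [X in complex.Re X](_ : _ = (y ^+ 2)%:C * cis (Gfun t + - th t + - th t)); last first.
    have -> : (y ^+ 2)%:C = y%:C * y%:C :> C by rewrite expr2; apply: rmorphM.
    by rewrite [cis (_ - th t)]cisD [cis (Gfun t - th t)]cisD /Efun; ring.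
  have -> : Gfun t + - th t + - th t = phi t - pi / 2 by rewrite /th; field.
  by rewrite !cxE /= mul0r subr0 cosBpihalf mulrC mulKf// sqrf_eq0.
- by rewrite /phi P0 addr0.
- by exists (fun t => p0 * expR (K t)) => // t; rewrite mulr_gt0// expR_gt0.
Qed.
End LinearSystem.

(** * Periodic linear solutions and fixed phases *)

Section Periodic.
Variable R : realType.
Local Notation C := R[i].
Local Notation re := (@complex.Re R).
Local Notation im := (@complex.Im R).
Local Notation ii := (@Complex (Real.sort R) 0 1).
Local Notation normc := (@ComplexField.Normc.normc R).
Local Notation normcM := (ComplexField.Normc.normcM).
Implicit Types (f g u v : R -> R) (Z F : R -> C).
Variables (l : nat) (mu rho : R).
Local Notation E := (Efun l mu).
Local Notation sol := (sol l mu rho).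
Local Notation jsol := (jsol l mu rho).

Definition hasfix (x : R) := exists2 phi, jsol phi & phi 0 = x /\ exists k : int, phi (2 * pi) - x = k%:~R * (2 * pi).

Lemma Gfun0 : Gfun l mu 0 = 0. Proof. by rewrite /Gfun sin0 !mulr0 addr0. Qed.
Lemma Gfun2pi : Gfun l mu (2 * pi) = l%:R * (2 * pi).
Proof. by rewrite /Gfun [in sin _]mulr_natl sin2pi mulr0 addr0. Qed.

(** The argument of [Z] contains half of [Gfun - phi], and [Gfun] gains 2 pi l over a period. This
    halving is the origin of the congruence between winding number and [l] modulo 2. *)
Lemma per_fix Z F (p0 x : R) : sol Z F -> (forall t, F t = E t * conjc (Z t)) -> 0 < p0 ->
  Z 0 = p0%:C * cis ((pi / 2 - x) / 2) -> Z (2 * pi) = Z 0 ->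
  exists phi, [/\ jsol phi, phi 0 = x & exists k : int, phi (2 * pi) - x = (l%:Z - 2 * k)%:~R * (2 * pi)].
Proof.
move=> hs hr hp Z0 Zp; have [phi [h1 h2 [Y Yp hY]]] := sol_jsol hs hr hp Z0.
exists phi; split => //.
have := Zp; rewrite !hY Gfun2pi Gfun0 h2 => e.
have eY : Y (2 * pi) = Y 0.
  have := congr1 normc e; rewrite !normcM !normc_real !normc_cis !mulr1.
  by rewrite !gtr0_norm.
move: e; rewrite eY => /mulfI; rewrite eq_complex /= eqxx andbT lt0r_neq0// => /(_ isT) e.
have e1 : cis ((l%:R * (2 * pi) + pi / 2 - phi (2 * pi)) / 2 - (0 + pi / 2 - x) / 2) = 1.
  by rewrite cisD e cisMN.
have [k hk] := cis_eq1 e1; exists k.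
rewrite intrB intrM; move: hk.
rewrite (_ : l%:~R = l%:R :> R)// (_ : 2%:~R = 2 :> R)//; lra.
Qed.

Lemma sol_sym Z F : sol Z F -> F 0 = Z 0 -> forall t, F t = E t * Z (- t).
Proof.
move=> hs h0 t; have := sol_swap hs => hs'.
by have [|| _ ->] := sol_uniq (t0 := 0) hs hs' _ _ t; rewrite ?Efun0 ?oppr0 ?mul1r.
Qed.
Lemma sol_real Z F : sol Z F -> F 0 = conjc (Z 0) -> forall t, F t = E t * conjc (Z t).
Proof.
move=> hs h0 t; have := sol_conj hs => hs'.
by have [|| _ ->] := sol_uniq (t0 := 0) hs hs' _ _ t; rewrite ?Efun0 ?h0 ?conjcK ?mul1r.
Qed.

(** The phase pi/2 corresponds to initial values (1, 1), and the parity of the winding number makes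
    the multiplier over a period a positive number [c]. Invariance under [sol_refl] gives Z(-2 pi) =
    c as well, hence c^2 = 1. *)
Lemma fix_periodic phi (j : int) : jsol phi -> phi 0 = pi / 2 ->
  phi (2 * pi) - pi / 2 = (l%:Z + 2 * j)%:~R * (2 * pi) ->
  exists Z F, [/\ sol Z F, Z 0 = 1, F 0 = 1 & forall t, Z (t + 2 * pi) = Z t /\ F (t + 2 * pi) = F t].
Proof.
move=> hphi p0 p1; have [p [pp pz hs]] := jsol_sol hphi.
set Z := fun t => _ in hs; set F := fun t => _ in hs.
have Z0 : Z 0 = 1 by rewrite /Z pz p0 Gfun0 add0r subrr mul0r cis0 mul1r.
have F0 : F 0 = 1 by rewrite /F pz p0 Gfun0 add0r addNr mul0r cis0 mul1r.
have e : phi (2 * pi) = (l%:R + 2 * j%:~R) * (2 * pi) + pi / 2.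
  by move: p1; rewrite intrD intrM (_ : l%:~R = l%:R :> R)// (_ : 2%:~R = 2 :> R)//; lra.
set c := p (2 * pi).
have Z1 : Z (2 * pi) = c%:C.
  rewrite /Z e Gfun2pi (_ : _ / 2 = (- j)%:~R * (2 * pi)).
    by rewrite cisMz cis2pi exp1rz mulr1.
  by rewrite mulrNz; field.
have F1 : F (2 * pi) = c%:C.
  rewrite /F e Gfun2pi (_ : _ / 2 = (l%:Z + j)%:~R * (2 * pi)).
    by rewrite cisMz cis2pi exp1rz mulr1.
  by rewrite intrD (_ : l%:~R = l%:R :> R)//; field.
have hper t : Z (t + 2 * pi) = c%:C * Z t /\ F (t + 2 * pi) = c%:C * F t.
  have h := sol_lin c%:C 0 hs hs.
  have [|| a b] := sol_uniq (t0 := 0) (sol_shift hs) h _ _ t; rewrite ?add0r ?Z0 ?F0 ?mulr1 ?mulr0 ?addr0//.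
  by rewrite a b !mul0r !addr0.
have refl t : Z (- t) = conjc (Z t).
  have [||a _] := sol_uniq (t0 := 0) hs (sol_refl hs) _ _ (- t); rewrite ?oppr0 ?Z0 ?F0 ?conjc1//.
  by rewrite a opprK.
have cc : c%:C * c%:C = 1 :> C.
  have [h _] := hper (- (2 * pi)); move: h.
  by rewrite addNr Z0 refl Z1 conj_real => <-.
have c1 : c%:C = 1 :> C.
  have c2 : c * c = 1 by have := congr1 re cc; rewrite !cxE /= mul0r subr0.
  have cp : 0 < c := pp _.
  by congr (_%:C); nra.
by exists Z, F; split => // t; have [-> ->] := hper t; rewrite c1 !mul1r.
Qed.

Section SecondSolution.
Variables (Z F : R -> C).
Hypotheses (hs : sol Z F) (Z0 : Z 0 = 1) (F0 : F 0 = 1)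
  (per : forall t, Z (t + 2 * pi) = Z t /\ F (t + 2 * pi) = F t).

Let hr t : F t = E t * conjc (Z t).
Proof. by apply: sol_real => //; rewrite Z0 F0 conjc1. Qed.
Let nz t : Z t != 0.
Proof.
apply/eqP => zt; have ft : F t = 0 by rewrite hr zt conjc0 mulr0.
have [/eqP] := sol_eq0 hs zt ft 0; by rewrite Z0 oner_eq0.
Qed.
Let n t : R := re (Z t) * re (Z t) + im (Z t) * im (Z t).
Let n_neq0 t : n t != 0.
Proof.
rewrite /n -!expr2 -normc_sqr sqrf_eq0.
by apply/eqP => /ComplexField.Normc.eq0_normc; apply/eqP.
Qed.
Let nC t : (n t)%:C = Z t * conjc (Z t).
Proof. by rewrite mulcJ normc_sqr !expr2. Qed.
Let dn : D1 n (fun t => 2 * rho * - im (F t * conjc (Z t))).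
Proof.
have [[h1 h2] _] := hs.
by apply: D1_eq (D1_add (D1_mul h1 h1) (D1_mul h2 h2)) _ => t; rewrite !cxE /=; ring.
Qed.

(* The monodromy of the linear system has determinant 1 and eigenvalue 1, so it is
   unipotent: all phases are fixed iff the entry ka vanishes. *)
Lemma second_sol : exists Z2 F2 (ka : R), [/\ sol Z2 F2, Z2 0 = ii, F2 0 = - ii &
  forall t, Z2 (t + 2 * pi) = Z2 t + ka%:C * Z t /\ F2 (t + 2 * pi) = F2 t + ka%:C * F t].
Proof.
have [hZ hF] := hs.
have cn : continuous (fun t => (n t)^-1) := D1_cont (D1_inv n_neq0 dn).
have [cW _] := Ccont_mul (CD_cont hF) (Ccont_conj (CD_cont hZ)).
have ck : continuous (fun t => 2 * rho * (re (F t * conjc (Z t)) * ((n t)^-1 * (n t)^-1))).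
  by apply: cont_mul; [exact: cont_cst|apply: cont_mul => //; exact: cont_mul].
have [h hh h0] := primitive_ex ck.
(* Reduction of order: the terms with i / n alone give the Wronskian - 2 i E, and the common factor
   [h] is then fixed by the system. Its value at 2 pi is the monodromy entry. *)
pose Z2 t := ii * ((n t)^-1)%:C * Z t + (h t)%:C * Z t.
pose F2 t := - ii * ((n t)^-1)%:C * F t + (h t)%:C * F t.
have din := D1_inv n_neq0 dn.
have inC t : (n t)%:C * ((n t)^-1)%:C = 1 :> C by rewrite -(rmorphM (real_complex R)) /= divff.
have key t (w := F t * conjc (Z t)) : - (2 * rho * - im w) / n t ^+ 2 = 2 * rho * im w * ((n t)^-1 * (n t)^-1).
  by field.
have ZF t : F t * conjc (F t) = (n t)%:C.
  by rewrite hr conj_M conjcK nC; have := EfunJ l mu t; set e := E t; set e' := conjc e => ee; rewrite mulrACA ee mul1r mulrC.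
pose m t := ((n t)^-1)%:C : C.
have hs2 : sol Z2 F2.
  split.
  - have H := CD_add (CD_mul (CD_scale ii (CD_real din)) hZ) (CD_mul (CD_real hh) hZ).
    apply: CD_eq H _ => t; rewrite /F2 key.
    set w := F t * conjc (Z t).
    have rw : (re w)%:C = w - ii * (im w)%:C by apply: complex_eq; rewrite !cxE /=; ring.
    have e1 : (2 * rho * im w * ((n t)^-1 * (n t)^-1))%:C = 2 * rho%:C * (im w)%:C * (m t * m t) :> C.
      by apply: complex_eq; rewrite !cxE /=; ring.
    have e2 : (2 * rho * (re w * ((n t)^-1 * (n t)^-1)))%:C = 2 * rho%:C * (re w)%:C * (m t * m t) :> C.
      by apply: complex_eq; rewrite !cxE /=; ring.
    rewrite e1 e2 rw -/(m t).
    have zw : Z t * w * (m t * m t) = F t * m t.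
      by rewrite /w (_ : _ * _ = F t * m t * (Z t * conjc (Z t) * m t)); [rewrite -nC inC mulr1|ring].
    have i2 : ii * ii = -1 :> C by rewrite -expr2 sqr_i.
    apply/eqP; rewrite -subr_eq0; apply/eqP.
    transitivity (2 * rho%:C * (Z t * w * (m t * m t) - F t * m t) + (1 + ii * ii) * 0); last first.
      by rewrite zw subrr mulr0 mulr0 addr0.
    rewrite mulr0 addr0.
    have e3 : ii * m t * (ii * rho%:C * F t) = - (m t * rho%:C * F t).
      by rewrite (_ : _ * _ = ii * ii * (m t * rho%:C * F t)); [rewrite i2 mulN1r|ring].
    have e4 : ii * rho%:C * (- ii * m t * F t + (h t)%:C * F t) = m t * rho%:C * F t + ii * rho%:C * (h t)%:C * F t.
      by rewrite mulrDr (_ : ii * rho%:C * (- ii * m t * F t) = - (ii * ii) * (m t * rho%:C * F t)); [rewrite i2 opprK mul1r; ring|ring].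
    by rewrite e3 e4; ring.
  - have H := CD_add (CD_mul (CD_scale (- ii) (CD_real din)) hF) (CD_mul (CD_real hh) hF).
    apply: CD_eq H _ => t; rewrite /F2 /Z2 key.
    set w := F t * conjc (Z t).
    have rw : (re w)%:C = conjc w + ii * (im w)%:C by apply: complex_eq; rewrite !cxE /=; ring.
    have e1 : (2 * rho * im w * ((n t)^-1 * (n t)^-1))%:C = 2 * rho%:C * (im w)%:C * (m t * m t) :> C.
      by apply: complex_eq; rewrite !cxE /=; ring.
    have e2 : (2 * rho * (re w * ((n t)^-1 * (n t)^-1)))%:C = 2 * rho%:C * (re w)%:C * (m t * m t) :> C.
      by apply: complex_eq; rewrite !cxE /=; ring.
    rewrite e1 e2 rw -/(m t).
    have zw : F t * conjc w * (m t * m t) = Z t * m t.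
      by rewrite /w conj_M conjcK (_ : _ * _ = Z t * m t * (F t * conjc (F t) * m t)); [rewrite ZF inC mulr1|ring].
    have i2 : ii * ii = -1 :> C by rewrite -expr2 sqr_i.
    apply/eqP; rewrite -subr_eq0; apply/eqP.
    transitivity (2 * rho%:C * (F t * conjc w * (m t * m t) - Z t * m t)); last first.
      by rewrite zw subrr mulr0.
    have e3 : - ii * m t * (ii * (gfun l mu t)%:C * F t - ii * rho%:C * Z t) = ii * (gfun l mu t)%:C * (- ii * m t * F t) - m t * rho%:C * Z t.
      rewrite mulrBr; congr (_ - _); first by ring.
      by rewrite [LHS](_ : _ = - (ii * ii) * (m t * rho%:C * Z t)); [rewrite i2 opprK mul1r|ring].
    have e4 : ii * rho%:C * (ii * m t * Z t + (h t)%:C * Z t) = - (m t * rho%:C * Z t) + ii * rho%:C * (h t)%:C * Z t.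
      by rewrite mulrDr (_ : ii * rho%:C * (ii * m t * Z t) = (ii * ii) * (m t * rho%:C * Z t)); [rewrite i2 mulN1r; ring|ring].
    by rewrite e3 e4; ring.
have n0 : n 0 = 1 by rewrite /n Z0 /=; ring.
have Z20 : Z2 0 = ii by rewrite /Z2 Z0 n0 h0 invr1 !mulr1 addr0.
have F20 : F2 0 = - ii by rewrite /F2 F0 n0 h0 invr1 !mulr1 addr0.
have Zp : Z (2 * pi) = 1 by have [h1 _] := per 0; rewrite -Z0 -h1 add0r.
have Fp : F (2 * pi) = 1 by have [_ h1] := per 0; rewrite -F0 -h1 add0r.
have np : n (2 * pi) = 1 by rewrite /n Zp /=; ring.
exists Z2, F2, (h (2 * pi)); split => // t.
have hl := sol_lin 1 (h (2 * pi))%:C hs2 hs.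
have [||a b] := sol_uniq (t0 := 0) (sol_shift hs2) hl _ _ t.
- by rewrite add0r Z20 Z0 /Z2 np Zp invr1 !mulr1 mul1r.
- by rewrite add0r F20 F0 /F2 np Fp invr1 !mulr1 mul1r.
by rewrite a b !mul1r.
Qed.
End SecondSolution.

(** Real combinations keep the reality condition, and cos th, sin th with th = (pi/2 - x)/2 give
    initial phase [x]. *)
Lemma all_fixed Z F Z2 F2 : sol Z F -> Z 0 = 1 -> F 0 = 1 ->
  sol Z2 F2 -> Z2 0 = ii -> F2 0 = - ii -> Z (2 * pi) = Z 0 -> Z2 (2 * pi) = Z2 0 ->
  forall x, hasfix x.
Proof.
move=> hs Z0 F0 hs2 Z20 F20 Zp Z2p x.
pose th := (pi / 2 - x) / 2.
have hl := sol_lin (cos th)%:C (sin th)%:C hs hs2.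
have [||||phi [h1 h2 [k hk]]] := @per_fix _ _ 1 x hl.
- apply: (sol_real hl); rewrite Z0 F0 Z20 F20.
  by apply: complex_eq; rewrite !cxE /=; ring.
- exact: ltr01.
- by rewrite Z0 Z20 mul1r /cis; apply: complex_eq; rewrite !cxE /=; ring.
- by rewrite Zp Z2p.
by exists phi => //; split => //; exists (l%:Z - 2 * k).
Qed.
End Periodic.

(** * From a fixed point to a polynomial solution *)
Section PeriodicSolutions.
Variable R : realType.
Local Notation C := R[i].
Local Notation re := (@complex.Re R).
Local Notation im := (@complex.Im R).
Local Notation ii := (@Complex (Real.sort R) 0 1).
Local Notation normc := (@ComplexField.Normc.normc R).
Local Notation normcM := (ComplexField.Normc.normcM).
Implicit Types (f g u v : R -> R) (Z F : R -> C).
Variables (l : nat) (mu rho : R).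
Local Notation E := (Efun l mu).
Local Notation sol := (sol l mu rho).

Lemma ii_neq0 : ii != 0 :> C.
Proof. by rewrite eq_complex /= oner_eq0 andbF. Qed.

Lemma gfunE t : (gfun l mu t)%:C = l%:R + mu%:C * (ech 1 t + ech (-1) t).
Proof.
rewrite -(rmorph_nat (real_complex R) l) -ech_conj ech1 /gfun.
by apply: complex_eq; rewrite !cxE /=; ring.
Qed.

Lemma sol_Ccont Z F : sol Z F -> Ccont Z /\ Ccont F.
Proof. by move=> [h1 h2]; split; [exact: CD_cont h1|exact: CD_cont h2]. Qed.

Lemma fcoef_gfun n F : Ccont F ->
  fcoef n (fun t => (gfun l mu t)%:C * F t) = l%:R * fcoef n F + mu%:C * (fcoef (n - 1) F + fcoef (n + 1) F).
Proof.
move=> cF.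
rewrite (@fcoef_ext _ _ _ (fun t => l%:R * F t + mu%:C * (ech 1 t * F t + ech (-1) t * F t))).
  have c1 k : Ccont (fun t => ech k t * F t) by exact: Ccont_coef.
  rewrite fcoefD; [|exact: Ccont_scale|by apply: Ccont_scale; exact: Ccont_add].
  by rewrite !fcoefZ ?fcoefD ?fcoef_shift ?opprK//; exact: Ccont_add.
by move=> t; rewrite gfunE; ring.
Qed.

Lemma sol_coef1 Z F n : sol Z F -> Z pi = Z (- pi) -> n%:~R * fcoef n Z = rho%:C * fcoef n F.
Proof.
move=> hs e; have [cZ cF] := sol_Ccont hs.
have cD : Ccont (fun t => ii * rho%:C * F t) by exact: Ccont_scale.
have := fcoef_der n (proj1 hs) cD e; rewrite fcoefZ//.
rewrite -!mulrA => /(mulfI ii_neq0) ->; congr (_ * _).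
by rewrite (rmorph_int (real_complex R)).
Qed.

Lemma Ccont_gfun F : Ccont F -> Ccont (fun t => (gfun l mu t)%:C * F t).
Proof. by move=> cF; apply: Ccont_mul => //; apply: Ccont_real; exact: cont_gfun. Qed.

Lemma sol_Ccont2 Z F : Ccont Z -> Ccont F ->
  Ccont (fun t => ii * (gfun l mu t)%:C * F t - ii * rho%:C * Z t).
Proof.
move=> cZ cF; apply: Ccont_sub; last exact: Ccont_scale.
by apply: Ccont_ext (Ccont_scale ii (Ccont_gfun cF)) => t; rewrite mulrA.
Qed.

Lemma sol_coef2 Z F n : sol Z F -> F pi = F (- pi) ->
  (n - l%:Z)%:~R * fcoef n F = mu%:C * (fcoef (n - 1) F + fcoef (n + 1) F) - rho%:C * fcoef n Z.
Proof.
move=> hs e; have [cZ cF] := sol_Ccont hs.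
have := fcoef_der n (proj2 hs) (sol_Ccont2 cZ cF) e.
rewrite (@fcoef_ext _ _ _ (fun t => ii * ((gfun l mu t)%:C * F t - rho%:C * Z t))); last by move=> t; ring.
have c1 := Ccont_gfun cF; have c2 := Ccont_scale rho%:C cZ.
rewrite fcoefZ; last exact: Ccont_sub.
rewrite fcoefB// fcoefZ// fcoef_gfun// -!mulrA => /(mulfI ii_neq0).
rewrite (rmorph_int (real_complex R)) intrB => h.
rewrite mulrBl -h (_ : l%:~R = l%:R :> C)//; ring.
Qed.

Lemma cont_bounded f : continuous f -> exists2 M, 0 < M & forall x : R, - pi <= x <= pi -> f x <= M.
Proof.
move=> cf; have pp : - pi <= pi :> R by have := pi_gt0 R; lra.
have [c _ hc] := EVT_max pp (continuous_subspaceT cf).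
exists (`|f c| + 1) => [|x hx]; first by rewrite ltr_pwDr.
have := hc x; rewrite in_itv => /(_ hx) /le_trans; apply.
by apply: le_trans (ler_norm _) _; rewrite lerDl.
Qed.
Lemma Ccont_bounded F : Ccont F -> exists2 M, 0 < M & forall x : R, - pi <= x <= pi -> normc (F x) <= M.
Proof. by move=> /Ccont_normc /cont_bounded. Qed.

Lemma normc_Re_le (z : C) : `|re z| <= normc z.
Proof.
rewrite ler_norml; apply/andP; split; last exact: re_le_normc.
by rewrite lerNl -ReN -[normc z]normc_opp; exact: re_le_normc.
Qed.
Lemma normc_Im_le (z : C) : `|im z| <= normc z.
Proof.
have -> : im z = - re (ii * z) by rewrite !cxE /=; ring.
rewrite normrN; apply: le_trans (normc_Re_le _) _.
by rewrite normcM /= expr0n expr1n /= add0r sqrtr1 mul1r.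
Qed.

Lemma CD_mvt_le F F' B : CD F F' -> (forall x, - pi <= x <= pi -> normc (F' x) <= B) ->
  forall x, - pi <= x <= pi -> normc (F x - F (- pi)) <= 4 * pi * B.
Proof.
move=> [h1 h2] hB x /andP[x1 x2]; apply: le_trans (normc_le2 _) _; rewrite !cxE.
have [c /andP[c1 c2] ->] := D1_mvt h1 x1; have [d /andP[d1 d2] ->] := D1_mvt h2 x1.
have p0 := pi_gt0 R.
have a1 : `|re (F' c)| <= B by apply: le_trans (normc_Re_le _) (hB _ _); apply/andP; split; lra.
have a2 : `|im (F' d)| <= B by apply: le_trans (normc_Im_le _) (hB _ _); apply/andP; split; lra.
rewrite !normrM (ger0_norm (_ : 0 <= x - - pi)); last by lra.
have B0 : 0 <= B by apply: le_trans a1.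
have := normr_ge0 (re (F' c)); have := normr_ge0 (im (F' d)); nra.
Qed.

Section Truncation.
Variables (Z F Z2 F2 : R -> C) (ka : R).
Hypotheses (hs : sol Z F) (Z0 : Z 0 = 1) (F0 : F 0 = 1)
  (per : forall t, Z (t + 2 * pi) = Z t /\ F (t + 2 * pi) = F t)
  (hs2 : sol Z2 F2) (Z20 : Z2 0 = ii) (F20 : F2 0 = - ii)
  (per2 : forall t, Z2 (t + 2 * pi) = Z2 t + ka%:C * Z t /\ F2 (t + 2 * pi) = F2 t + ka%:C * F t)
  (ka0 : ka != 0) (rho0 : rho != 0).

Let a n := fcoef n Z.
Let f n := fcoef n F.
Let pimpi : - pi + 2 * pi = pi :> R. Proof. ring. Qed.
Let Zpi : Z pi = Z (- pi). Proof. by have [] := per (- pi); rewrite pimpi. Qed.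
Let Fpi : F pi = F (- pi). Proof. by have [] := per (- pi); rewrite pimpi. Qed.
Let Z2pi : Z2 pi = Z2 (- pi) + ka%:C * Z (- pi).
Proof. by have [] := per2 (- pi); rewrite pimpi. Qed.
Let F2pi : F2 pi = F2 (- pi) + ka%:C * F (- pi).
Proof. by have [] := per2 (- pi); rewrite pimpi. Qed.
Let rhoC : rho%:C != 0 :> C. Proof. by rewrite eq_complex /= eqxx andbT. Qed.
Let af n : n%:~R * a n = rho%:C * f n. Proof. exact: sol_coef1. Qed.
Let ff n : (n - l%:Z)%:~R * f n = mu%:C * (f (n - 1) + f (n + 1)) - rho%:C * a n.
Proof. exact: sol_coef2. Qed.
Let f00 : f 0 = 0.
Proof. by apply: (mulfI rhoC); rewrite -af mul0r mulr0. Qed.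

(* The relation f 0 = 0 decouples positive from nonpositive Fourier modes, so the partial
   sums ZN, FN over nonnegative modes solve the linear system up to err, which tends to 0;
   since the system has no second periodic solution they converge to a multiple of (Z, F). *)
Let ap (k : nat) : C := if k is 0%N then mu%:C * f 1 / rho%:C else a k.
Let ZN N t := \sum_(k < N.+1) ap k * ech k t.
Let FN N t := \sum_(k < N) f k.+1 * ech k.+1 t.
Let err (N : nat) t := ii * mu%:C * (f N.+1 * ech N t - f N * ech N.+1 t).

Let CD_term (c : C) (k : int) : CD (fun t => c * ech k t) (fun t => ii * k%:~R * (c * ech k t)).
Proof.
apply: CD_eq (CD_scale c (@CD_ech R k)) _ => t.
rewrite (rmorph_int (real_complex R)); ring.
Qed.

Let hZN N : CD (ZN N) (fun t => ii * rho%:C * FN N t).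
Proof.
elim: N => [|N IH].
  apply: CD_ext (CD_cst (ap 0)) _ _ => t; first by rewrite /ZN big_ord1 ech0 mulr1.
  by rewrite /FN big_ord0 mulr0.
apply: CD_ext (CD_add IH (CD_term (a N.+1) N.+1)) _ _ => t.
  by rewrite [RHS]/ZN big_ord_recr.
rewrite [in RHS]/FN big_ord_recr /= mulrDr; congr (_ + _).
by rewrite -[ii * _ * _]mulrA [_%:~R * _]mulrA af; ring.
Qed.

(** Multiplication by [gfun] couples neighbouring modes, so defects arise only at the two ends of
    the sum. The upper end is [err]; the lower one is cancelled by [f 0 = 0] and the choice of
    [ap 0]. *)
Let hFN N : CD (FN N) (fun t => ii * (gfun l mu t)%:C * FN N t - ii * rho%:C * ZN N t + err N t).
Proof.
elim: N => [|N IH].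
  apply: CD_ext (CD_cst 0) _ _ => t; first by rewrite /FN big_ord0.
  rewrite /FN /ZN /err big_ord0 big_ord1 ech0 f00 /=.
  by field.
apply: CD_ext (CD_add IH (CD_term (f N.+1) N.+1)) _ _ => t.
  by rewrite [RHS]/FN big_ord_recr.
have -> : FN N.+1 t = FN N t + f N.+1 * ech N.+1 t by rewrite /FN big_ord_recr.
have -> : ZN N.+1 t = ZN N t + a N.+1 * ech N.+1 t by rewrite /ZN big_ord_recr.
rewrite /err; have := ff N.+1.
have -> : N.+1%:Z - 1 = N by lia.
have -> : N.+1%:Z + 1 = N.+2 by lia.
rewrite intrB (_ : l%:~R = l%:R :> C)// => h.
have e1 : ech 1 t * ech N.+1 t = ech N.+2 t by rewrite -echD; congr ech; lia.
have e2 : ech (-1) t * ech N.+1 t = ech N t by rewrite -echD; congr ech; lia.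
have -> : ii * N.+1%:~R * (f N.+1 * ech N.+1 t) =
   ii * ((l%:R * f N.+1 + (mu%:C * (f N + f N.+2) - rho%:C * a N.+1)) * ech N.+1 t).
  by rewrite -h; ring.
rewrite gfunE -e1 -e2; move: (FN N t) (ZN N t) (ech N.+1 t) (ech 1 t) (ech (-1) t) => u v w p q.
ring.
Qed.

Let cE t := conjc (E t).
(** [al] and [bt] are the Cramer coordinates of the truncated pair in the two solutions, [cE]
    cancelling the Wronskian. By variation of constants their derivatives contain only [err]. *)
Let bt N t := cE t * (Z t * FN N t - ZN N t * F t).
Let al N t := cE t * (ZN N t * F2 t - Z2 t * FN N t).

Let wr t : Z t * F2 t - Z2 t * F t = - 2 * ii * E t.
Proof. by rewrite (sol_wronsk hs hs2) Z0 F0 Z20 F20; congr (_ * _); ring. Qed.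
Let cEE t : cE t * E t = 1. Proof. by rewrite mulrC EfunJ. Qed.
Let cramer N t : al N t * Z t + bt N t * Z2 t = - 2 * ii * ZN N t.
Proof.
have h1 := wr t; have h2 := cEE t; rewrite /al /bt.
move: (FN N t) (ZN N t) (cE t) h1 h2 => u v w h1 h2.
transitivity (w * (- 2 * ii * E t) * v); first by rewrite -h1; ring.
by transitivity (- 2 * ii * v * (w * E t)); [ring|rewrite h2 mulr1].
Qed.
Let cE_D : CD cE (fun t => - (ii * (gfun l mu t)%:C) * cE t).
Proof. by apply: CD_eq (CD_conj (@CD_Efun R l mu)) _ => t; rewrite !cjE /cE; ring. Qed.
Let bt_D N : CD (bt N) (fun t => cE t * Z t * err N t).
Proof.
apply: CD_eq (CD_mul cE_D (CD_sub (CD_mul (proj1 hs) (hFN N)) (CD_mul (hZN N) (proj2 hs)))) _ => t.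
by move: (FN N t) (ZN N t) (err N t) => u v w; ring.
Qed.
Let al_D N : CD (al N) (fun t => - (cE t * Z2 t * err N t)).
Proof.
apply: CD_eq (CD_mul cE_D (CD_sub (CD_mul (hZN N) (proj2 hs2)) (CD_mul (proj1 hs2) (hFN N)))) _ => t.
by move: (FN N t) (ZN N t) (err N t) => u v w; ring.
Qed.
Let eps N : R := `|mu| * (normc (f N.+1) + normc (f N)).
Let err_le N t : normc (err N t) <= eps N.
Proof.
rewrite /err -mulrA normcM; have -> : normc ii = 1 by rewrite /= expr0n expr1n /= add0r sqrtr1.
rewrite mul1r normcM normc_real ler_wpM2l//; apply: le_trans (normc_triangle _ _) _.
by rewrite normc_opp !normcM !normc_ech !mulr1.
Qed.
Let cE1 t : normc (cE t) = 1. Proof. by rewrite normc_conj normc_cis. Qed.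
Let eps_ge0 N : 0 <= eps N. Proof. by rewrite mulr_ge0// addr_ge0// normc_ge0. Qed.
Let FNpi N : FN N pi = FN N (- pi).
Proof. by apply: eq_bigr => k _; rewrite ech_pi. Qed.
Let ZNpi N : ZN N pi = ZN N (- pi).
Proof. by apply: eq_bigr => k _; rewrite ech_pi. Qed.
Let cEpi : cE pi = cE (- pi).
Proof. by rewrite /cE -{1}pimpi Efun_per. Qed.
(** The truncated pair is periodic while the second solution gains [ka] times the first, so [al]
    must jump. As [al] is almost constant and [ka] nonzero, [bt] is small. *)
Let ka_bt N : ka%:C * bt N (- pi) = - (al N pi - al N (- pi)).
Proof. by rewrite /bt /al cEpi F2pi Z2pi FNpi ZNpi; ring. Qed.

Let approx : exists2 K, 0 <= K & forall N n,
  normc (- 2 * ii * fcoef n (ZN N) - al N (- pi) * a n) <= K * eps N.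
Proof.
have [cZ cF] := sol_Ccont hs; have [cZ2 cF2] := sol_Ccont hs2.
have [M1 M10 hM1] := Ccont_bounded cZ; have [M2 M20 hM2] := Ccont_bounded cZ2.
have p0 := pi_gt0 R.
pose K := 4 * pi * M2 * M1 + (4 * pi * M1 + 4 * pi * M2 / `|ka|) * M2.
have ka1 : 0 < `|ka| by rewrite normr_gt0.
have K0 : 0 <= K.
  have q1 : 0 <= 4 * pi * M1 by rewrite !mulr_ge0// ltW.
  have q2 : 0 <= 4 * pi * M2 by rewrite !mulr_ge0// ltW.
  have q3 : 0 <= 4 * pi * M2 / `|ka| by rewrite divr_ge0.
  by rewrite /K; apply: addr_ge0; apply: mulr_ge0 => //; rewrite ?addr_ge0// ltW.
exists K => // N n.
have hb t : - pi <= t <= pi -> normc (bt N t - bt N (- pi)) <= 4 * pi * (M1 * eps N).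
  apply: CD_mvt_le (bt_D N) _ t => t ht; rewrite normcM normcM cE1 mul1r.
  by apply: ler_pM; rewrite ?normc_ge0 ?err_le//; exact: hM1.
have ha t : - pi <= t <= pi -> normc (al N t - al N (- pi)) <= 4 * pi * (M2 * eps N).
  apply: CD_mvt_le (al_D N) _ t => t ht; rewrite normc_opp normcM normcM cE1 mul1r.
  by apply: ler_pM; rewrite ?normc_ge0 ?err_le//; exact: hM2.
have hb0 : normc (bt N (- pi)) <= 4 * pi * M2 / `|ka| * eps N.
  rewrite mulrAC ler_pdivlMr// mulrC -normc_real -normcM ka_bt normc_opp.
  by rewrite -[4 * pi * M2 * _]mulrA; apply: ha; apply/andP; split; lra.
have cZN : Ccont (ZN N) := CD_cont (hZN N).
have c1 := Ccont_scale (- 2 * ii) cZN; have c2 := Ccont_scale (al N (- pi)) cZ.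
rewrite -fcoefZ// -[_ * a n]fcoefZ// -fcoefB//; apply: le_trans (fcoef_le _ (Ccont_sub c1 c2)) _.
rewrite -(rmean_cst (K * eps N)); apply: rmean_le; [exact: Ccont_normc (Ccont_sub c1 c2)|exact: cont_cst|].
move=> t ht; rewrite -cramer.
rewrite (_ : _ - _ = (al N t - al N (- pi)) * Z t + ((bt N t - bt N (- pi)) + bt N (- pi)) * Z2 t); last by ring.
apply: le_trans (normc_triangle _ _) _; rewrite !normcM /K mulrDl; apply: lerD.
  rewrite [X in _ <= X](_ : _ = 4 * pi * (M2 * eps N) * M1); last by ring.
  by apply: ler_pM; rewrite ?normc_ge0//; [exact: ha|exact: hM1].
rewrite [X in _ <= X](_ : _ = (4 * pi * (M1 * eps N) + 4 * pi * M2 / `|ka| * eps N) * M2); last by ring.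
apply: ler_pM; rewrite ?normc_ge0//; last exact: hM2.
by apply: le_trans (normc_triangle _ _) _; apply: lerD => //; exact: hb.
Qed.

Let fcoefZN N (n : int) : fcoef n (ZN N) = \sum_(k < N.+1) ap k * (n == k)%:R.
Proof.
rewrite fcoef_sum => [|k]; last exact: Ccont_scale (@Ccont_ech _ _).
by apply: eq_bigr => k _; rewrite fcoefZ ?fcoef_ech//; exact: Ccont_ech.
Qed.

(** In [ff] the right side is bounded uniformly by the means of |Z| and |F|, and the factor n - l
    supplies the decay. *)
Let f_small : exists2 D, 0 <= D & forall (n K : nat), (0 < n)%N -> normc (f (l + n + K)%N) <= D * harmonic K.
Proof.
have [cZ cF] := sol_Ccont hs.
set B := rmean (fun t => normc (F t)); set A := rmean (fun t => normc (Z t)).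
have B0 : 0 <= B by apply: rmean_ge0; [exact: Ccont_normc|move=> x; exact: normc_ge0].
have A0 : 0 <= A by apply: rmean_ge0; [exact: Ccont_normc|move=> x; exact: normc_ge0].
exists (`|mu| * (B + B) + `|rho| * A) => [|n K n0].
  by rewrite addr_ge0// mulr_ge0// addr_ge0.
rewrite /harmonic /= ler_pdivlMr ?ltr0n//.
have := congr1 normc (ff (l + n + K)%N).
have -> : (l + n + K)%N%:Z - l%:Z = (n + K)%N%:Z by lia.
rewrite normcM => h.
have h1 : normc (f (l + n + K)%N) * K.+1%:R <= normc ((n + K)%N%:Z%:~R) * normc (f (l + n + K)%N).
  rewrite mulrC; apply: ler_wpM2r; first exact: normc_ge0.
  have -> : ((n + K)%N%:Z%:~R : C) = ((n + K)%N%:R : R)%:C by rewrite (rmorph_nat (real_complex R)).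
  by rewrite normc_real ger0_norm// ler_nat; lia.
apply: le_trans h1 _; rewrite h; apply: le_trans (normc_triangle _ _) _.
rewrite normc_opp !normcM !normc_real; apply: lerD; apply: ler_wpM2l => //; last exact: fcoef_le.
by apply: le_trans (normc_triangle _ _) _; apply: lerD; exact: fcoef_le.
Qed.

(** Let x = [al N (- pi)]. By [approx], a negative mode makes x a_m small and a positive mode makes
    (- 2 i - x) a_n small for large [N]. Eliminating the unknown x bounds a_m a_n by quantities
    tending to 0. *)
Lemma dichotomy : (forall m : int, m < 0 -> a m = 0) \/ (forall n : int, 0 < n -> a n = 0).
Proof.
suff key (m n : int) : m < 0 -> 0 < n -> a m * a n = 0.
  case: (pselect (forall m : int, m < 0 -> a m = 0)) => [|/existsNP[m /not_implyP[m0 /eqP am]]]; first by left.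
  right=> n n0; have /eqP := key m n m0 n0; rewrite mulf_eq0 (negPf am) /=; exact: eqP.
move=> m0; case: n => // n; rewrite ltz_nat => n0.
have [K K0 hK] := approx; have [D D0 hD] := f_small.
have apS (k : nat) : (0 < k)%N -> ap k = a k by case: k.
pose M0 := (normc (a n) + normc (a m)) * K * `|mu| * (D + D) / 2.
apply: normc_le0; apply: (@squeeze_le0 _ _ M0 (@harmonic R)); first exact: cvg_harmonic.
move=> k; set N := (l + n + k)%N.
have h1 := hK N m; have h2 := hK N n; move: h1 h2.
rewrite !fcoefZN big1 => [|i _]; last first.
  by rewrite (_ : m == _ = false) ?mulr0//; apply/negbTE/eqP; lia.
have nN : (n < N.+1)%N by rewrite /N; lia.
rewrite (bigD1 (Ordinal nN)) //= eqxx mulr1 big1 => [|i /eqP ni]; last first.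
  rewrite (_ : n%:Z == i = false) ?mulr0//; apply/negbTE/eqP => -[e]; apply: ni.
  by apply: val_inj.
rewrite addr0 mulr0 sub0r normc_opp.
rewrite (apS n n0).
set x := al N _ => h1 h2.
have e : - 2 * ii * (a m * a n) = a m * (- 2 * ii * a n - x * a n) + a n * (x * a m) by ring.
have n2 : normc (- 2 * ii) = 2.
  rewrite normcM mulrC; have -> : normc ii = 1 by rewrite /= expr0n expr1n /= add0r sqrtr1.
  by rewrite mul1r normc_opp -(rmorph_nat (real_complex R) 2) normc_real ger0_norm.
have := congr1 normc e; rewrite normcM n2 => e2.
have h3 : 2 * normc (a m * a n) <= normc (a m) * (K * eps N) + normc (a n) * (K * eps N).
  rewrite e2; apply: le_trans (normc_triangle _ _) _; rewrite [X in X + _]normcM [X in _ + X]normcM.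
  by apply: lerD; apply: ler_wpM2l; rewrite ?normc_ge0.
have h4 : eps N <= `|mu| * (D + D) * harmonic k.
  rewrite /eps -mulrA; apply: ler_wpM2l => //; rewrite mulrDl; apply: lerD; last exact: hD.
  have -> : N.+1 = (l + n.+1 + k)%N by rewrite /N; lia.
  exact: hD.
have h5 : (normc (a m) + normc (a n)) * K * eps N <= (normc (a m) + normc (a n)) * K * (`|mu| * (D + D) * harmonic k).
  by apply: ler_wpM2l => //; rewrite mulr_ge0// addr_ge0// normc_ge0.
rewrite -(@ler_pM2l _ 2)//; apply: le_trans h3 _.
rewrite -mulrDl mulrA; apply: le_trans h5 _.
rewrite le_eqVlt; apply/orP; left; apply/eqP; rewrite /M0 /harmonic /=; move: (k.+1%:R^-1 : R) => h0; by field.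
Qed.
End Truncation.
End PeriodicSolutions.

(** * Removing the exponential factor from a periodic solution *)

Section PolynomialSolution.
Variable R : realType.
Local Notation C := R[i].
Local Notation ii := (@Complex (Real.sort R) 0 1).
Local Notation normc := (@ComplexField.Normc.normc R).
Local Notation normcM := (ComplexField.Normc.normcM).
Implicit Types (f g u v : R -> R) (Z F : R -> C).
Variables (l : nat) (mu rho : R).
Local Notation E := (Efun l mu).
Local Notation sol := (sol l mu rho).

(* The coefficients of a polynomial e^{- mu z} Z(z), which solves a Heun equation: this says
   that rho is an eigenvalue of the matrix heunM below. *)
Definition kernel_vector (t : nat -> C) := t l = 0 /\
  forall k, (k < l)%N -> k.+1%:R * t k.+1 + mu%:C * t k = rho%:C * t (l - k.+1)%N.

Section Gauge.
Variables (Z F : R -> C).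
Hypotheses (rho0 : rho != 0) (hs : sol Z F) (Z0 : Z 0 = 1) (F0 : F 0 = 1)
  (Zpi : Z pi = Z (- pi)) (Fpi : F pi = F (- pi)).

Let cZ : Ccont Z. Proof. by have [] := sol_Ccont hs. Qed.
Let cF : Ccont F. Proof. by have [] := sol_Ccont hs. Qed.
Let hsym t : F t = E t * Z (- t). Proof. by apply: (sol_sym hs); rewrite F0 Z0. Qed.
Let rhoC : rho%:C != 0 :> C. Proof. by rewrite eq_complex /= eqxx andbT. Qed.

Let T t := cexp (- mu) t * Z t.
Let cT : Ccont T. Proof. exact: Ccont_cexpM. Qed.
Let t_ n := fcoef n T.

(** By the swap symmetry e^{- mu z} F equals z^l T(1/z), so the single function [T] satisfies a
    closed equation pairing modes n and l - n. *)
Let Tstar t : cexp (- mu) t * F t = ech l t * T (- t).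
Proof.
rewrite hsym Efun_fact /T; have := cexpN mu t.
by set c := cexp mu t; set d := cexp (- mu) t => h; rewrite [LHS](_ : _ = (d * c) * (ech l t * (cexp (- mu) (- t) * Z (- t)))); [rewrite h mul1r|ring].
Qed.
Let TD : CD T (fun t => ii * (- mu%:C * (ech 1 t * T t) + rho%:C * (ech l t * T (- t)))).
Proof.
apply: CD_eq (CD_mul (@CD_cexp R (- mu)) (proj1 hs)) _ => t.
rewrite mulrDr -Tstar /T [(- mu)%:C](rmorphN (real_complex R)) /=; ring.
Qed.
Let Tpi : T pi = T (- pi).
Proof. by rewrite /T Zpi /cexp cosN sinN sinpi oppr0. Qed.
Let cT1 k : Ccont (fun t => ech k t * T t). Proof. exact: Ccont_coef. Qed.
Let cT2 k : Ccont (fun t => ech k t * T (- t)).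
Proof. by apply: Ccont_coef; exact: Ccont_refl. Qed.

Let trel n : n%:~R * t_ n = - mu%:C * t_ (n - 1) + rho%:C * t_ (l%:Z - n).
Proof.
have c1 := Ccont_scale (- mu%:C) (cT1 1); have c2 := Ccont_scale rho%:C (cT2 l).
have c3 := Ccont_scale ii (Ccont_add c1 c2).
have := fcoef_der n TD c3 Tpi; rewrite fcoefZ ?fcoefD ?fcoefZ ?fcoef_shift ?fcoef_refl ?opprB//; last exact: Ccont_add.
by rewrite -mulrA => /(mulfI (@ii_neq0 R)) ->; rewrite (rmorph_int (real_complex R)).
Qed.

(** Applying [trel] at l - n <= 0 transports vanishing below 0 to vanishing from [l] on. Some mode
    survives by [fcoef_uniq0], since [T 0] is nonzero. *)
Lemma kernel_of_negative : (forall n : int, n < 0 -> t_ n = 0) ->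
  exists2 t : nat -> C, kernel_vector t & exists2 k, (k < l)%N & t k != 0.
Proof.
move=> neg.
have pos n : l%:Z <= n -> t_ n = 0.
  move=> ln; have := trel (l%:Z - n); rewrite [t_ (_ - 1)]neg; last by lia.
  rewrite mulr0 add0r (_ : l%:Z - (l%:Z - n) = n); last by lia.
  move=> h; apply: (mulfI rhoC); rewrite -h mulr0.
  have [->|nl] := eqVneq (l%:Z - n) 0; first by rewrite mul0r.
  by rewrite neg ?mulr0//; lia.
exists (fun k => t_ k).
  split; first exact: pos.
  move=> k kl; have := trel k.+1%:Z; rewrite (_ : k.+1%:Z - 1 = k%:Z); last by lia.
  rewrite (_ : l%:Z - k.+1%:Z = (l - k.+1)%N%:Z); last by lia.
  by rewrite pmulrn => ->; ring.
case: (pselect (exists2 k : nat, (k < l)%N & t_ k != 0)) => // h; exfalso.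
have all0 n : t_ n = 0.
  case: (ltrP n 0) => [/neg//|n0]; case: (lerP l%:Z n) => [/pos//|nl].
  case: n n0 nl => // n _; rewrite ltz_nat => nl.
  by apply/eqP/negPn/negP => tn; apply: h; exists n.
have c1 := Ccont_scale (- mu%:C) (cT1 1); have c2 := Ccont_scale rho%:C (cT2 l).
have c3 := Ccont_scale ii (Ccont_add c1 c2).
have := fcoef_uniq0 TD c3 all0.
by rewrite /T Z0 mulr1 => /eqP; rewrite (negPf (cexp_neq0 _ _)).
Qed.

(** The relations at n and l - n form a two by two system with determinant n (l - n) - rho^2,
    negative for n < 0. *)
Lemma neg_mu0 : mu = 0 -> forall n : int, n < 0 -> t_ n = 0.
Proof.
move=> m0 n n0; have := trel n; have := trel (l%:Z - n).
rewrite m0 oppr0 !mul0r !add0r (_ : l%:Z - (l%:Z - n) = n) => [h1 h2|]; last by lia.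
have h : (n%:~R * (l%:Z - n)%:~R - rho%:C ^+ 2) * t_ n = 0.
  by rewrite mulrBl mulrAC h2 expr2 -!mulrA [t_ _ * _]mulrC h1 subrr.
move/eqP: h; rewrite mulf_eq0 => /orP[|/eqP//].
rewrite -!(rmorph_int (real_complex R)) -(rmorphM (real_complex R)) -(rmorphXn (real_complex R)) -(rmorphB (real_complex R)).
rewrite eq_complex /= eqxx andbT -intrM subr_eq0 => /eqP e.
have : (n * (l%:Z - n))%:~R < 0 :> R by rewrite ltrz0; nia.
by rewrite e ltNge sqr_ge0.
Qed.

Lemma neg_case1 : (forall n : int, n < 0 -> fcoef n Z = 0) -> forall n : int, n < 0 -> t_ n = 0.
Proof. by move=> h n n0; apply: fcoef_cexp_van => // m mn; apply: h; exact: le_lt_trans n0. Qed.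

(** [F] then has only negative modes, so [U] = e^{mu z} F(1/z) has only positive ones. By the swap
    symmetry U(1/z) equals z^l e^{mu z} Z(1/z) and has modes at least l, so [U] has only modes at
    most - l. No mode is left, yet [U 0] is nonzero. *)
Lemma neg_case2 : (forall n : int, 0 < n -> fcoef n Z = 0) -> False.
Proof.
move=> h.
have hf n : 0 <= n -> fcoef n F = 0.
  move=> n0; apply: (mulfI rhoC); rewrite -(sol_coef1 n hs Zpi) mulr0.
  have [->|nn] := eqVneq n 0; first by rewrite mul0r.
  by rewrite h ?mulr0//; lia.
pose U t := cexp mu t * F (- t).
have cFr := Ccont_refl cF; have cU : Ccont U by exact: Ccont_cexpM.
have U1 n : n <= 0 -> fcoef n U = 0.
  move=> n0; apply: fcoef_cexp_van => // m mn; rewrite fcoef_refl// hf//; lia.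
have UE t : U (- t) = ech l t * (cexp mu t * Z (- t)).
  rewrite /U opprK hsym Efun_fact; have := cexpN mu (- t); set c := cexp mu (- t); set d := cexp (- mu) _ => e.
  by rewrite [LHS](_ : _ = (d * c) * (ech l t * (cexp mu t * Z (- t)))); [rewrite e mul1r|ring].
have cZr := Ccont_refl cZ.
have U2 n : 1 - l%:Z <= n -> fcoef n U = 0.
  move=> n0; rewrite -[n]opprK -fcoef_refl//.
  rewrite (@fcoef_ext _ _ _ _ UE) fcoef_shift; apply: fcoef_cexp_van => // m mn.
  by rewrite fcoef_refl// h//; lia.
have UD : CD U (fun t => ii * (mu%:C * ech 1 t) * cexp mu t * F (- t) + cexp mu t * - (ii * (gfun l mu (- t))%:C * F (- t) - ii * rho%:C * Z (- t))).
  exact: CD_mul (@CD_cexp R mu) (CD_refl (proj2 hs)).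
have cD : Ccont (fun t => ii * (mu%:C * ech 1 t) * cexp mu t * F (- t) + cexp mu t * - (ii * (gfun l mu (- t))%:C * F (- t) - ii * rho%:C * Z (- t))).
  apply: Ccont_add.
    apply: Ccont_mul => //; apply: Ccont_mul; last exact: Ccont_cexp.
    by apply: Ccont_scale; apply: Ccont_scale; exact: Ccont_ech.
  apply: Ccont_cexpM; apply: Ccont_ext (Ccont_scale (-1) (Ccont_refl (sol_Ccont2 l mu rho cZ cF))) => t.
  by rewrite mulN1r.
have U0 : U 0 = 0.
  apply: fcoef_uniq0 UD cD _ => n; case: (lerP n 0) => [/U1//|n0]; apply: U2; lia.
by move/eqP: U0; rewrite /U oppr0 F0 mulr1 (negPf (cexp_neq0 _ _)).
Qed.
End Gauge.

Lemma forward phi (j : int) : rho != 0 -> jsol l mu rho phi -> phi 0 = pi / 2 ->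
  phi (2 * pi) - pi / 2 = (l%:Z + 2 * j)%:~R * (2 * pi) ->
  (mu = 0 \/ exists x, ~ hasfix l mu rho x) ->
  exists2 t : nat -> C, kernel_vector t & exists2 k, (k < l)%N & t k != 0.
Proof.
move=> rho0 hphi p0 p1 hyp.
have [Z [F [hs Z0 F0 per]]] := fix_periodic hphi p0 p1.
have pimpi : - pi + 2 * pi = pi :> R by ring.
have Zpi : Z pi = Z (- pi) by have [] := per (- pi); rewrite pimpi.
have Fpi : F pi = F (- pi) by have [] := per (- pi); rewrite pimpi.
apply: (kernel_of_negative rho0 hs Z0 F0 Zpi).
case: hyp => [m0|[x hx]]; first exact: (neg_mu0 rho0 hs Z0 F0 Zpi m0).
have [Z2 [F2 [ka [hs2 Z20 F20 per2]]]] := second_sol hs Z0 F0 per.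
have [k0|k0] := eqVneq ka 0.
  exfalso; apply: hx; apply: (all_fixed hs Z0 F0 hs2 Z20 F20).
    by have [h _] := per 0; rewrite -[2 * pi]add0r h.
  by have [h _] := per2 0; rewrite -[2 * pi]add0r h k0 mul0r addr0.
have [h|h] := dichotomy hs Z0 F0 per hs2 Z20 F20 per2 k0 rho0.
  exact: (neg_case1 hs).
by case: (neg_case2 rho0 hs Z0 F0 Zpi h).
Qed.
End PolynomialSolution.

(** * From a polynomial solution to a fixed point *)
Section FromKernelVector.
Variable R : realType.
Local Notation C := R[i].
Local Notation ii := (@Complex (Real.sort R) 0 1).
Local Notation normc := (@ComplexField.Normc.normc R).
Local Notation normcM := (ComplexField.Normc.normcM).
Implicit Types (f g u v : R -> R) (Z F : R -> C).
Variables (l : nat) (mu rho : R) (t_ : nat -> C).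
Hypotheses (rho0 : rho != 0) (kt : kernel_vector l mu rho t_)
  (tn0 : exists2 k, (k < l)%N & t_ k != 0).
Local Notation E := (Efun l mu).
Local Notation sol := (sol l mu rho).
Let rhoC : rho%:C != 0 :> C. Proof. by rewrite eq_complex /= eqxx andbT. Qed.

Let T x : C := \sum_(k < l) t_ k * ech k x.
Let T' x : C := \sum_(k < l) ii * k%:R * (t_ k * ech k x).

Let CD_term (c : C) (k : nat) : CD (fun t => c * ech k t) (fun t => ii * k%:R * (c * ech k t)).
Proof.
apply: CD_eq (CD_scale c (@CD_ech R k)) _ => t.
rewrite (rmorph_int (real_complex R)) -pmulrn; ring.
Qed.
Let CD_sum (n : nat) (G G' : nat -> R -> C) : (forall k, CD (G k) (G' k)) ->
  CD (fun x => \sum_(k < n) G k x) (fun x => \sum_(k < n) G' k x).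
Proof.
move=> h; elim: n => [|n IH].
  by apply: CD_ext (CD_cst 0) _ _ => x; rewrite big_ord0.
by apply: CD_ext (CD_add IH (h n)) _ _ => x; rewrite big_ord_recr.
Qed.
Let TD : CD T T'.
Proof. exact: (@CD_sum l (fun k x => t_ k * ech k x) _ (fun k => CD_term (t_ k) k)). Qed.
Let cT : Ccont T. Proof. exact: CD_cont TD. Qed.

(** Generating-function form of [kernel_vector]; the condition [t l = 0] closes the sum at its upper
    end. *)
Let T'E x : T' x + ii * (mu%:C * ech 1 x * T x) = ii * rho%:C * (ech l x * T (- x)).
Proof.
have [tl rel] := kt.
have -> : ech l x * T (- x) = \sum_(k < l) t_ (l - k.+1)%N * ech k.+1 x.
  rewrite /T mulr_sumr (reindex_inj rev_ord_inj) /=; apply: eq_bigr => k _.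
  rewrite mulrCA ech_refl -echD; congr (_ * ech _ x).
  have := ltn_ord k; lia.
rewrite -[ii * rho%:C * _]mulrA.
have -> : rho%:C * \sum_(k < l) t_ (l - k.+1)%N * ech k.+1 x =
   \sum_(k < l) (k.+1%:R * t_ k.+1 * ech k.+1 x + mu%:C * t_ k * ech k.+1 x).
  by rewrite mulr_sumr; apply: eq_bigr => k _; rewrite mulrA -rel// mulrDl.
rewrite big_split /= mulrDr; congr (_ + _).
- have -> : T' x = ii * \sum_(k < l.+1) k%:R * t_ k * ech k x.
    rewrite big_ord_recr /= tl mulr0 mul0r addr0 mulr_sumr; apply: eq_bigr => k _; ring.
  by rewrite big_ord_recl /= mul0r mul0r add0r.
- congr (_ * _); rewrite /T mulr_sumr; apply: eq_bigr => k _.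
  have -> : ech k.+1 x = ech 1 x * ech k x by rewrite -echD; congr ech; lia.
  ring.
Qed.

Let Z0 x := cexp mu x * T x.
Let F0 x := cexp mu x * (ech l x * T (- x)).

Let hs0 : sol Z0 F0.
Proof.
split.
- apply: CD_eq (CD_mul (@CD_cexp R mu) TD) _ => x.
  rewrite (_ : _ + _ = cexp mu x * (T' x + ii * (mu%:C * ech 1 x * T x))); last by ring.
  by rewrite T'E /F0; ring.
- apply: CD_eq (CD_mul (@CD_cexp R mu) (CD_mul (@CD_ech R l) (CD_refl TD))) _ => x.
  have h := T'E (- x); rewrite opprK !ech_refl in h.
  have h2 : T' (- x) = ii * rho%:C * (ech (- l%:Z) x * T x) - ii * (mu%:C * ech (- 1) x * T (- x)).
    by rewrite -h addrK.
  have ee : ech l x * ech (- l%:Z) x = 1 by rewrite -echD subrr ech0.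
  rewrite h2 gfunE (rmorph_int (real_complex R)) -pmulrn /F0 /Z0.
  move: (T x) (T (- x)) (cexp mu x) ee => u v w ee.
  apply/eqP; rewrite -subr_eq0; apply/eqP.
  transitivity (ii * rho%:C * w * u * (1 - ech l x * ech (- l%:Z) x)); last by rewrite ee subrr mulr0.
  ring.
Qed.

Let fcoefT n : fcoef n T = \sum_(k < l) t_ k * (n == k%:Z)%:R.
Proof.
rewrite fcoef_sum => [|k]; last exact: Ccont_scale (@Ccont_ech _ _).
by apply: eq_bigr => k _; rewrite fcoefZ ?fcoef_ech//; exact: Ccont_ech.
Qed.
Let fcoefT_nat (k : nat) : (k < l)%N -> fcoef k T = t_ k.
Proof.
move=> kl; rewrite fcoefT (bigD1 (Ordinal kl)) //= eqxx mulr1 big1 ?addr0 => [|i /eqP ik].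
  by [].
rewrite (_ : k%:Z == i = false) ?mulr0//; apply/negbTE/eqP => -[e]; apply: ik.
exact: val_inj.
Qed.
Let fcoefT_van n : (n < 0) || (l%:Z <= n) -> fcoef n T = 0.
Proof.
move=> h; rewrite fcoefT big1// => i _; rewrite (_ : n == _ = false) ?mulr0//.
by apply/negbTE/eqP; have := ltn_ord i; lia.
Qed.

Let F00 : F0 0 = Z0 0.
Proof. by rewrite /F0 /Z0 oppr0 ech_at0 mul1r. Qed.
Let Z00 : Z0 0 != 0.
Proof.
apply/eqP => z0; have := @sol_eq0 R l mu rho Z0 F0 0 hs0 z0; rewrite F00 => /(_ z0) h.
have [k kl /eqP] := tn0; apply; rewrite -fcoefT_nat// (@fcoef_ext _ _ _ (fun=> 0 * 0)).
  by rewrite fcoefZ ?mul0r//; exact: Ccont_cst.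
move=> x; rewrite mul0r; have [/eqP + _] := h x.
by rewrite mulf_eq0 (negPf (cexp_neq0 _ _)) => /eqP.
Qed.

Let c0 := (Z0 0)^-1.
Let Z x := c0 * Z0 x.
Let F x := c0 * F0 x.
Let hs : sol Z F.
Proof.
have [h1 h2] := sol_lin c0 0 hs0 hs0.
split.
- apply: CD_ext h1 _ _ => x; rewrite /Z /F; ring.
- apply: CD_ext h2 _ _ => x; rewrite /Z /F; ring.
Qed.
Let Z1 : Z 0 = 1. Proof. by rewrite /Z /c0 mulVf. Qed.
Let F1 : F 0 = 1. Proof. by rewrite /F F00 /c0 mulVf. Qed.
Let Tper x : T (x + 2 * pi) = T x.
Proof. by apply: eq_bigr => k _; rewrite ech_per. Qed.
Let Zper x : Z (x + 2 * pi) = Z x.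
Proof. by rewrite /Z /Z0 Tper cexp_per. Qed.
Let Fsym x : F x = E x * Z (- x).
Proof. by apply: (sol_sym hs); rewrite F1 Z1. Qed.
Let Fper x : F (x + 2 * pi) = F x.
Proof. by rewrite !Fsym Efun_per opprD -(Zper (_ - _)) subrK. Qed.
Let pimpi : - pi + 2 * pi = pi :> R. Proof. by ring. Qed.
Let Zpi : Z pi = Z (- pi). Proof. by have := Zper (- pi); rewrite pimpi. Qed.
Let Fpi : F pi = F (- pi). Proof. by have := Fper (- pi); rewrite pimpi. Qed.

Lemma backward : exists phi, [/\ jsol l mu rho phi, phi 0 = pi / 2 &
   exists k : int, phi (2 * pi) - pi / 2 = (l%:Z - 2 * k)%:~R * (2 * pi)].
Proof.
apply: (per_fix hs _ ltr01).
- by apply: (sol_real hs); rewrite F1 Z1 conjc1.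
- by rewrite Z1 subrr mul0r cis0 mulr1.
- by rewrite -[2 * pi]add0r Zper.
Qed.

(** Mode 0 vanishes for every periodic solution, and two consecutive zeros propagate upwards because
    [mu] can be divided out. So mode 1 governs all positive modes. *)
Lemma fcoef_F_van Z2 F2 : mu != 0 -> sol Z2 F2 -> Z2 pi = Z2 (- pi) -> F2 pi = F2 (- pi) ->
  fcoef 1 F2 = 0 -> forall n : nat, fcoef n F2 = 0.
Proof.
move=> mu0 h2 e1 e2 f1.
have muC : mu%:C != 0 :> C by rewrite eq_complex /= eqxx andbT.
have f0 : fcoef 0 F2 = 0.
  by apply: (mulfI rhoC); rewrite -(sol_coef1 _ h2 e1) mul0r mulr0.
suff key n : fcoef n%:Z F2 = 0 /\ fcoef n.+1%:Z F2 = 0 by move=> n; have [] := key n.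
elim: n => [//|n [a b]]; split => //.
have a1 : fcoef n.+1 Z2 = 0.
  have n0 : (n.+1%:~R : C) != 0 by rewrite -pmulrn pnatr_eq0.
  by apply: (mulfI n0); rewrite (sol_coef1 _ h2 e1) b !mulr0.
have := sol_coef2 n.+1 h2 e2; rewrite a1 b !mulr0 subr0.
rewrite (_ : n.+1%:Z - 1 = n%:Z); last by lia.
rewrite (_ : n.+1%:Z + 1 = n.+2%:Z); last by lia.
by rewrite a add0r => /esym/eqP; rewrite mulf_eq0 (negPf muC) => /eqP.
Qed.

(** The phase - pi/2 gives initial values (i, - i), odd under [sol_swap]. Its multiplier [s] is 1
    because the Wronskian and the first solution are periodic. *)
Let odd_sol : (forall x, hasfix l mu rho x) -> exists Z2 F2, [/\ sol Z2 F2, Z2 0 = ii, F2 0 = - ii,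
   Z2 pi = Z2 (- pi) & F2 pi = F2 (- pi)].
Proof.
move=> /(_ (- (pi / 2)))[phi hphi [p0 [k pk]]].
have [p [pp pz h2]] := jsol_sol hphi.
set Z2 := fun t => _ in h2; set F2 := fun t => _ in h2.
have Z20 : Z2 0 = ii by rewrite /Z2 pz p0 Gfun0 mul1r (_ : _ / 2 = pi / 2) ?cis_pihalf//; field.
have F20 : F2 0 = - ii.
  by rewrite /F2 pz p0 Gfun0 mul1r (_ : _ / 2 = - (pi / 2)) ?cisN ?cis_pihalf ?conj_i//; field.
have p1 : phi (2 * pi) = k%:~R * (2 * pi) - pi / 2 by move: pk; lra.
pose s : C := (p (2 * pi))%:C * cis ((l%:R - k%:~R) * pi).
have Z21 : Z2 (2 * pi) = s * ii.
  by rewrite /Z2 p1 Gfun2pi /s -mulrA -cis_pihalf -cisD; congr (_ * cis _); field.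
have F21 : F2 (2 * pi) = s * - ii.
  rewrite /F2 p1 Gfun2pi /s -mulrA.
  have -> : - ii = cis (- (pi / 2)) :> C by rewrite cisN cis_pihalf conj_i.
  have -> : cis ((l%:R - k%:~R) * pi) = cis ((l%:R - k%:~R) * pi + k%:~R * (2 * pi)) :> C.
    by rewrite [RHS]cisD [cis (k%:~R * _)]cisMz cis2pi exp1rz mulr1.
  by rewrite -cisD; congr (_ * cis _); field.
have s1 : s = 1.
  have := sol_wronsk hs h2 (2 * pi); rewrite Z21 F21 Z20 F20 Z1 F1.
  rewrite -[2 * pi]add0r Zper Fper Efun_per Efun0 Z1 F1 => h.
  have n2 : - (2 : C) * ii != 0 by rewrite mulf_neq0 ?ii_neq0// oppr_eq0 pnatr_eq0.
  by apply: (mulIf n2); rewrite mul1r; move: h; rewrite !mul1r !mulr1 => h; rewrite -[RHS](_ : - ii - ii = _); [rewrite -h; ring|ring].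
exists Z2, F2; split => //.
- have [||a _] := sol_uniq (t0 := 0) (sol_shift h2) h2 _ _ (- pi).
  + by rewrite add0r Z21 Z20 s1 mul1r.
  + by rewrite add0r F21 F20 s1 mul1r.
  by rewrite -a pimpi.
- have [||_ a] := sol_uniq (t0 := 0) (sol_shift h2) h2 _ _ (- pi).
  + by rewrite add0r Z21 Z20 s1 mul1r.
  + by rewrite add0r F21 F20 s1 mul1r.
  by rewrite -a pimpi.
Qed.

(** [T] times the weight e^{mu (z + 1/z)} = exp (2 mu cos x). *)
Let G x := cexp mu x * cexp mu (- x) * T x.
Let cG : Ccont G.
Proof. by apply: Ccont_mul => //; apply: Ccont_cexpM; exact: Ccont_refl (@Ccont_cexp _ _). Qed.

(** Subtracting [c] times the first solution from the odd one kills mode 1, so [FU], and with it [H]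
    = e^{mu/z} FU, has only negative modes. By the symmetries [H] is also a series with modes at
    least [l] plus a multiple of z^l G(1/z). Comparing modes 0 to l - 1 gives the claim. *)
Let G_van : mu != 0 -> (forall x, hasfix l mu rho x) ->
  forall j : int, 1 <= j -> j <= l%:Z -> fcoef j G = 0.
Proof.
move=> mu0 /odd_sol[Z2 [F2 [h2 Z20 F20 Z2pi F2pi]]].
have [cZ cF] := sol_Ccont hs; have [cZ2 cF2] := sol_Ccont h2.
have f_van (n : int) : n <= 0 -> fcoef n F = 0.
  move=> n0; rewrite fcoefZ; last by apply: Ccont_cexpM; apply: Ccont_coef; exact: Ccont_refl.
  rewrite fcoef_cexp_van ?mulr0//; first by apply: Ccont_coef; exact: Ccont_refl.
  move=> m mn; rewrite fcoef_shift fcoef_refl// fcoefT_van//; apply/orP; right; lia.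
have f1 : fcoef 1 F != 0.
  apply/eqP => f1; have h := fcoef_F_van mu0 hs Zpi Fpi f1.
  have all0 (n : int) : fcoef n F = 0.
    by case: (lerP n 0) => [/f_van//|]; case: n => // k _; exact: h.
  have := fcoef_uniq0 (proj2 hs) (sol_Ccont2 l mu rho cZ cF) all0.
  by rewrite F1 => /eqP; rewrite oner_eq0.
pose c := fcoef 1 F2 / fcoef 1 F.
pose ZU x := 1 * Z2 x + - c * Z x; pose FU x := 1 * F2 x + - c * F x.
have hU : sol ZU FU by exact: sol_lin.
have [cZU cFU] := sol_Ccont hU.
have ZUpi : ZU pi = ZU (- pi) by rewrite /ZU Z2pi Zpi.
have FUpi : FU pi = FU (- pi) by rewrite /FU F2pi Fpi.
have fU1 : fcoef 1 FU = 0.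
  rewrite fcoefD; [|exact: Ccont_scale|exact: Ccont_scale].
  rewrite fcoefZ// [fcoef 1 (fun x => - c * _)]fcoefZ//.
  by rewrite /c mul1r mulNr divfK ?subrr.
have fU := fcoef_F_van mu0 hU ZUpi FUpi fU1.
have aU (n : int) : 0 < n -> fcoef n ZU = 0.
  case: n => // k; rewrite ltz_nat => n0; have nn : (k%:~R : C) != 0 by rewrite -pmulrn pnatr_eq0 -lt0n.
  by apply: (mulfI nn); rewrite (sol_coef1 _ hU ZUpi) fU !mulr0.
have F2E x : F2 x = - (E x * Z2 (- x)).
  have h3 := sol_lin (-1) 0 (sol_swap h2) h2.
  have [||_ a] := sol_uniq (t0 := 0) h2 h3 _ _ x; rewrite ?oppr0 ?Efun0 ?Z20 ?F20; try by ring.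
  by rewrite a; ring.
pose H x := cexp mu (- x) * FU x.
have Hr x : H (- x) = cexp mu x * FU (- x) by rewrite /H opprK.
have cH : Ccont H by apply: Ccont_mul => //; exact: Ccont_refl (@Ccont_cexp _ _).
have H_van (n : int) : 0 <= n -> fcoef n H = 0.
  move=> n0; rewrite -[n]opprK -fcoef_refl// (@fcoef_ext _ _ _ _ Hr).
  apply: fcoef_cexp_van; first exact: Ccont_refl.
  move=> m mn; rewrite fcoef_refl//; have : 0 <= - m by lia.
  by case: (- m) => // k _; exact: fU.
have HE x : H x = - (ech l x * (cexp mu x * ZU (- x))) + (- (2 * c * c0)) * (ech l x * G (- x)).
  rewrite /H /FU F2E Fsym /ZU /G /Z /Z0 Efun_fact opprK.
  have := cexpN mu (- x).
  set p := cexp mu x; set q := cexp mu (- x); set q' := cexp (- mu) (- x) => e.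
  move: (T (- x)) (Z2 (- x)) (ech l x) e => u v w e.
  apply/eqP; rewrite -subr_eq0; apply/eqP.
  transitivity (w * p * (v + c * c0 * q * u) * (1 - q' * q)); last by rewrite e subrr mulr0.
  by ring.
have cGr := Ccont_refl cG; have cZUr := Ccont_refl cZU.
have cA : Ccont (fun x => ech l x * (cexp mu x * ZU (- x))).
  by apply: Ccont_coef; exact: Ccont_cexpM.
have A_van (n : int) : n < l%:Z -> fcoef n (fun x => ech l x * (cexp mu x * ZU (- x))) = 0.
  move=> nl; rewrite fcoef_shift fcoef_cexp_van// => m mn.
  by rewrite fcoef_refl// aU//; lia.
have HC (n : int) : n < l%:Z -> fcoef n H = - (2 * c * c0) * fcoef (l%:Z - n) G.
  move=> nl; rewrite (@fcoef_ext _ _ _ (fun x => (-1) * (ech l x * (cexp mu x * ZU (- x))) + (- (2 * c * c0)) * (ech l x * G (- x)))).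
    rewrite fcoefD ?fcoefZ ?A_van ?fcoef_shift ?fcoef_refl ?opprB ?mulr0 ?add0r//.
    - exact: Ccont_coef.
    - exact: Ccont_scale.
    - by apply: Ccont_scale; exact: Ccont_coef.
  by move=> x; rewrite HE mulN1r.
have c00 : c0 != 0 by rewrite invr_neq0.
(* For [c = 0] the comparison below [l] would remove the negative modes of [H] too, although [H 0]
   is nonzero. *)
have cn0 : c != 0.
  apply/eqP => c_0.
  have HD := CD_mul (CD_refl (@CD_cexp R mu)) (proj2 hU).
  have cHD := Ccont_add (Ccont_mul (Ccont_scale (-1) (Ccont_refl (Ccont_mul (Ccont_scale ii (Ccont_scale mu%:C (@Ccont_ech R 1))) (@Ccont_cexp R mu)))) cFU) (Ccont_mul (Ccont_refl (@Ccont_cexp R mu)) (sol_Ccont2 l mu rho cZU cFU)).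
  have : H 0 = 0.
    apply: (fcoef_uniq0 HD) => [|n].
      by apply: Ccont_ext cHD => x; rewrite mulN1r.
    case: (lerP 0 n) => [/H_van//|n0]; rewrite HC ?c_0 ?mulr0 ?mul0r ?oppr0 ?mul0r//; lia.
  move/eqP; rewrite /H mulf_eq0 (negPf (cexp_neq0 _ _)) /= /FU c_0 oppr0 mul0r addr0 mul1r F20 oppr_eq0.
  by rewrite (negPf (@ii_neq0 R)).
move=> j j1 jl; have n2 : - (2 * c * c0) != 0.
  by rewrite oppr_eq0; apply: mulf_neq0 => //; apply: mulf_neq0 => //; rewrite pnatr_eq0.
apply: (mulfI n2); rewrite mulr0.
have := HC (l%:Z - j); rewrite (_ : l%:Z - (l%:Z - j) = j); last by lia.
by move=> <-; [rewrite H_van//; lia|lia].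
Qed.

(* If all phases were fixed, a combination of the two periodic solutions would have no
   positive modes, and the polynomial solution T would be almost orthogonal to itself
   for the weight exp (2 mu cos), which is close to 1. *)
Lemma not_all_fixed : mu != 0 -> `|mu| <= 10^-1 -> ~ (forall x, hasfix l mu rho x).
Proof.
move=> mu0 mule hall; have A_van := G_van mu0 hall.
set e1 := expR `|mu|; have e1p : 0 < e1 := expR_gt0 _.
have cN : continuous (fun x => normc (T x)) := Ccont_normc cT.
set m := rmean (fun x => normc (T x)).
have T0 : T 0 != 0.
  by move: Z00; rewrite /Z0 mulf_eq0 (negPf (cexp_neq0 _ _)).
have m0 : 0 < m.
  apply: rmean_gt0 => // [x|]; first exact: normc_ge0.
  by rewrite lt_neqAle normc_ge0 andbT eq_sym; apply/eqP => /ComplexField.Normc.eq0_normc; exact/eqP.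
pose wt (x : R) := expR (mu * cos x) * expR (mu * cos x).
have wtE x : cexp mu x * cexp mu (- x) = (wt x)%:C.
  rewrite /cexp cosN sinN mulrN mulrACA cisMN mulr1; exact/esym/rmorphM.
have bnd (x : R) : mu * cos x <= `|mu| /\ - `|mu| <= mu * cos x.
  have := cos_max x; have := normrM mu (cos x); have := ler_norm (mu * cos x).
  have := ler_norm (- (mu * cos x)); rewrite normrN => h1 h2 h3 h4.
  have : `|mu| * `|cos x| <= `|mu| by rewrite ler_piMr.
  by rewrite -h3; lra.
have wt_le x : wt x <= e1 * e1.
  by apply: ler_pM; rewrite ?expR_ge0// ler_expR; have [] := bnd x.
have wt_ge x : e1^-1 * e1^-1 <= wt x.
  by rewrite -expRN; apply: ler_pM; rewrite ?expR_ge0// ler_expR; have [] := bnd x.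
have wt0 x : 0 <= wt x by rewrite mulr_ge0 ?expR_ge0.
have cwt : continuous wt.
  have h : continuous (fun x : R => expR (mu * cos x)).
    apply: cont_comp; first exact: continuous_expR.
    by apply: cont_mul; [exact: cont_cst|exact: continuous_cos].
  exact: cont_mul.
set A := fcoef 0 G.
(* Multiplying [G] by e^{- mu z} leaves e^{mu/z} T, which has no mode [l]. In the expansion of e^{-
   mu z} to order l the modes 1 to l of [G] drop out, so the single term with [A] is bounded by the
   remainder. *)
have up : `|mu| ^+ l / l`!%:R * normc A <= 2 * (e1 * (`|mu| ^+ l.+1 / l.+1`!%:R)) * (e1 * e1 * m).
  have cR : Ccont (fun x => ech (- l%:Z) x * G x) by exact: Ccont_coef.
  have := @fcoef_cexp_rem R l.+1 (- mu) 0 _ cR; rewrite normrN -/e1.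
  have -> : fcoef 0 (fun x => cexp (- mu) x * (ech (- l%:Z) x * G x)) = 0.
    have e x : cexp (- mu) x * (ech (- l%:Z) x * G x) = ech (- l%:Z) x * (cexp mu (- x) * T x).
      rewrite /G [LHS](_ : _ = (cexp (- mu) x * cexp mu x) * (ech (- l%:Z) x * (cexp mu (- x) * T x))); last by ring.
      by rewrite cexpN mul1r.
    rewrite (@fcoef_ext _ _ _ _ e) fcoef_shift sub0r opprK.
    have cTr := Ccont_refl cT.
    pose W y := cexp mu y * T (- y).
    have cW : Ccont W by exact: Ccont_cexpM.
    rewrite (@fcoef_ext _ _ _ (fun x => W (- x))); last by move=> x; rewrite /W opprK.
    rewrite fcoef_refl//; apply: fcoef_cexp_van => // k kl; rewrite fcoef_refl// fcoefT_van//; apply/orP; right; lia.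
  rewrite big_ord_recr /= big1 => [|k _]; last first.
    rewrite fcoef_shift A_van ?mulr0//; have := ltn_ord k; lia.
  rewrite fcoef_shift (_ : 0 - l%:Z - - l%:Z = 0); last by lia.
  rewrite !add0r normc_opp normcM normc_real -/A => h.
  rewrite (_ : `|mu| ^+ l / l`!%:R = `|(- mu) ^+ l / l`!%:R|); last first.
    by rewrite normrM normrX normrN [X in _ = _ * X]ger0_norm ?invr_ge0.
  apply: le_trans h _; apply: ler_wpM2l.
    by rewrite !mulr_ge0 ?expR_ge0 ?exprn_ge0 ?invr_ge0.
  rewrite -rmeanZ//; apply: rmean_le.
  - exact: Ccont_normc.
  - by apply: cont_mul => //; exact: cont_cst.
  - move=> x _; rewrite normcM normc_ech mul1r /G wtE normcM normc_real ger0_norm//.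
    by apply: ler_wpM2r => //; exact: normc_ge0.
(* The weighted square norm of [T] reduces to conj (t_0) A, since the modes 1 to l - 1 of [G]
   vanish; moreover |t_0| <= m and m^2 is at most the mean of |T|^2. *)
have low : e1^-1 * e1^-1 * m <= normc A.
  have cTJ := Ccont_conj cT.
  have cGT : Ccont (fun x => conjc (T x) * G x) by exact: Ccont_mul.
  have mE : cmean (fun x => conjc (T x) * G x) = conjc (t_ 0%N) * A.
    have e x : conjc (T x) * G x = \sum_(k < l) conjc (t_ k) * (ech (- k%:Z) x * G x).
      rewrite /T rmorph_sum mulr_suml; apply: eq_bigr => k _.
      by rewrite rmorphM /= -ech_conj mulrA.
    rewrite (cmean_ext e) cmean_sum => [|k]; last by apply: Ccont_scale; exact: Ccont_coef.
    have [k0 k0l _] := tn0; have l0 : (0 < l)%N by lia.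
    rewrite (bigD1 (Ordinal l0)) //= big1 ?addr0 => [|k /eqP kn].
      by rewrite cmeanZ//; exact: Ccont_coef.
    rewrite cmeanZ; last exact: Ccont_coef.
    rewrite -/(fcoef k G) A_van ?mulr0//.
      have : (k : nat) != 0%N by apply/eqP => e0; apply: kn; apply: val_inj.
      lia.
    by have := ltn_ord k; lia.
  have t0m : normc (t_ 0%N) <= m.
    have [k0 k0l _] := tn0; have l0 : (0 < l)%N by lia.
    by rewrite -fcoefT_nat//; exact: fcoef_le.
  have m2 : m * m <= rmean (fun x => normc (T x) * normc (T x)).
    have c2 : continuous (fun x => normc (T x) * normc (T x)) by exact: cont_mul.
    have c3 : continuous (fun x => (-2 * m) * normc (T x)) by apply: cont_mul => //; exact: cont_cst.
    have c4 : continuous (fun x => normc (T x) * normc (T x) + (-2 * m) * normc (T x)) by exact: cont_add.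
    have : 0 <= rmean (fun x => (normc (T x) * normc (T x) + (-2 * m) * normc (T x)) + m * m).
      apply: rmean_ge0; first by apply: cont_add => //; exact: cont_cst.
      move=> x; rewrite (_ : _ + _ = (normc (T x) - m) ^+ 2) ?sqr_ge0//; ring.
    rewrite rmeanD//; last exact: cont_cst.
    by rewrite rmean_cst rmeanD// [rmean (fun x => -2 * m * _)]rmeanZ// -/m; lra.
  have key : e1^-1 * e1^-1 * (m * m) <= normc (t_ 0%N) * normc A.
    rewrite -normc_conj -normcM -mE; apply: le_trans (re_le_normc _); rewrite /cmean /=.
    have c2 : continuous (fun x => normc (T x) * normc (T x)) by exact: cont_mul.
    apply: le_trans (_ : rmean (fun x => e1^-1 * e1^-1 * (normc (T x) * normc (T x))) <= _).
      by rewrite rmeanZ//; apply: ler_wpM2l => //; rewrite mulr_ge0// invr_ge0 ltW.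
    apply: rmean_le; [by apply: cont_mul => //; exact: cont_cst|by case: cGT|].
    move=> x _; rewrite /G wtE (_ : _ * (_ * T x) = (wt x)%:C * (T x * conjc (T x))); last by ring.
    rewrite mulcJ !cxE /= mul0r subr0 expr2; apply: ler_wpM2r => //.
    by rewrite mulr_ge0// normc_ge0.
  rewrite -(ler_pM2r m0) [X in X <= _](_ : _ = e1^-1 * e1^-1 * (m * m)); last by ring.
  apply: le_trans key _; rewrite mulrC.
  by apply: ler_wpM2l => //; exact: normc_ge0.
have fl : 0 < l`!%:R :> R by rewrite ltr0n fact_gt0.
have mup : 0 < `|mu| by rewrite normr_gt0.
have P0 : 0 < `|mu| ^+ l / l`!%:R by rewrite divr_gt0// exprn_gt0.
have h1 : e1^-1 * e1^-1 * m * (`|mu| ^+ l / l`!%:R) <= 2 * (e1 * (`|mu| ^+ l.+1 / l.+1`!%:R)) * (e1 * e1 * m).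
  by apply: le_trans up; rewrite mulrC; apply: ler_wpM2l => //; exact: ltW.
have h2 : 2 * (e1 * (`|mu| ^+ l.+1 / l.+1`!%:R)) * (e1 * e1 * m) = 2 * (e1 * e1 * e1) * (`|mu| / l.+1%:R) * (m * (`|mu| ^+ l / l`!%:R)).
  by rewrite exprS factS natrM invfM; ring.
have h3 : e1^-1 * e1^-1 <= 2 * (e1 * e1 * e1) * (`|mu| / l.+1%:R).
  have q0 : 0 < m * (`|mu| ^+ l / l`!%:R) by rewrite mulr_gt0.
  rewrite -(ler_pM2r q0) -[X in _ <= X]h2; apply: le_trans h1.
  by rewrite le_eqVlt; apply/orP; left; apply/eqP; rewrite -!mulrA.
have h4 : `|mu| / l.+1%:R <= 10^-1.
  by apply: le_trans mule; rewrite ler_piMr// invf_le1 ?ltr0n// ler1n.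
(* Here 5 |mu| <= 1/2. Both bounds together give 1 <= 2 e1^5 / 10 <= 4/10, which explains the
   constant [10^-1]. *)
have h5 : e1 ^+ 5 <= 2.
  rewrite -expRM_natl; apply: (@le_trans _ _ (expR 2^-1)).
    by rewrite ler_expR; lra.
  have := expR_ge1Dx (- 2^-1 : R); rewrite expRN => h.
  have q : 2^-1 <= (expR 2^-1)^-1 :> R by lra.
  by rewrite -lef_pV2 ?posrE ?expR_gt0.
have h6 : 1 <= 2 * e1 ^+ 5 * 10^-1.
  have := ler_wpM2l (ltW (mulr_gt0 e1p e1p)) h3; rewrite mulrACA divff ?lt0r_neq0// mulr1 => h.
  apply: le_trans h _; rewrite [X in X <= _](_ : _ = 2 * e1 ^+ 5 * (`|mu| / l.+1%:R)); last by ring.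
  by apply: ler_wpM2l => //; rewrite mulr_ge0// exprn_ge0// ltW.
lra.
Qed.
End FromKernelVector.

(** * Rotation number *)
Section Rotation.
Variable R : realType.
Implicit Types (f g u v phi : R -> R).
Variables (l : nat) (mu rho : R).
Local Notation jsol := (jsol l mu rho).

(** Gronwall for sin^2 of half the difference, a quantity blind to multiples of 2 pi; once it
    vanishes, so does the derivative of the difference. *)
Lemma jsol_diff_const phi1 phi2 c : jsol phi1 -> jsol phi2 ->
  sin ((phi1 c - phi2 c) / 2) = 0 -> forall t, phi1 t - phi2 t = phi1 0 - phi2 0.
Proof.
move=> h1 h2 hc.
pose d t := phi1 t - phi2 t.
have hd : D1 d (fun t => - (4 * rho) * (cos ((phi1 t + phi2 t) / 2) * sin (d t / 2))).
  apply: D1_eq (D1_sub h1 h2) _ => t.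
  set a := (phi1 t + phi2 t) / 2; set b := d t / 2.
  have e1 : sin (phi1 t) = sin (a + b) by congr sin; rewrite /a /b /d; field.
  have e2 : sin (phi2 t) = sin (a - b) by congr sin; rewrite /a /b /d; field.
  by rewrite e1 e2 sinD sinB; ring.
have hs := D1_comp (@D1_sin R) (D1_mul hd (D1_cst 2^-1)).
have S0 t : sin (d t / 2) * sin (d t / 2) = 0.
  apply: (@gronwall0 R _ _ (4 * `|rho|) c (D1_mul hs hs)) => [x|x|]; first by rewrite -expr2 sqr_ge0.
    rewrite [X in `|X|](_ : _ = rho * (- 4 * (cos ((phi1 x + phi2 x) / 2) * cos (d x / 2)) * (sin (d x / 2) * sin (d x / 2)))); last by field.
    rewrite normrM [4 * _]mulrC -!mulrA; apply: ler_wpM2l => //.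
    rewrite !normrM normrN (ger0_norm (_ : 0 <= 4))//; apply: ler_wpM2l => //.
    have q : `|sin (d x / 2)| * `|sin (d x / 2)| = sin (d x / 2) * sin (d x / 2).
      by rewrite -!expr2 real_normK// num_real.
    rewrite q mulrA ler_piMl//; first by rewrite -expr2 sqr_ge0.
    by rewrite mulr_ile1// cos_max.
  by rewrite /d hc mul0r.
have h0 : D1 d (fun=> 0).
  apply: D1_eq hd _ => t; have /eqP := S0 t; rewrite mulf_eq0 orbb => /eqP ->.
  by rewrite !mulr0.
by move=> t; exact: (D1_0 h0 t 0).
Qed.

(** A larger change of the difference would cross a multiple of 2 pi by the intermediate value
    theorem, and there [jsol_diff_const] freezes the difference. *)
Lemma jsol_diff_bounded phi1 phi2 : jsol phi1 -> jsol phi2 ->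
  forall t, `|(phi1 t - phi2 t) - (phi1 0 - phi2 0)| <= 2 * pi.
Proof.
move=> h1 h2 t; pose d x := phi1 x - phi2 x; rewrite -/(d t) -/(d 0).
have cd : continuous d := cont_sub (D1_cont h1) (D1_cont h2).
rewrite leNgt; apply/negP => far.
have p0 := pi_gt0 R; have pp : 0 < 2 * pi :> R by lra.
set m := Num.min (d 0) (d t); set M := Num.max (d 0) (d t).
have mM : m + 2 * pi < M.
  move: far; rewrite /m /M; case: (leP (d 0) (d t)) => ht; case: (ltrP (d 0) (d t)) => ht2;
  rewrite ?ger0_norm ?ler0_norm; lra.
pose k := Num.floor (m / (2 * pi)); pose v : R := (k + 1)%:~R * (2 * pi).
have v1 : m <= v.
  by rewrite /v -ler_pdivrMr// ltW// floorD1_gt.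
have v2 : v <= M.
  apply: le_trans (ltW mM); rewrite /v intrD mulrDl mul1r lerD2r -ler_pdivlMr//.
  exact: Num.Theory.ge_floor.
have [c hc] : exists c, d c = v.
  have cw a b : {within `[a, b], continuous d} by exact: continuous_subspaceT.
  case/orP: (le_total 0 t) => t0.
    have [|c _ e] := IVT t0 (cw _ _) (v := v); first by rewrite -/m -/M v1 v2.
    by exists c.
  have [|c _ e] := IVT t0 (cw _ _) (v := v); first by rewrite minC maxC -/m -/M v1 v2.
  by exists c.
have S0 : sin ((phi1 c - phi2 c) / 2) = 0.
  rewrite -/(d c) hc /v (_ : _ / 2 = (k + 1)%:~R * pi); last by field.
  move: (k + 1) => n.
  have spi (j : nat) : sin (j%:R * pi) = 0 :> R.
    elim: j => [|j IH]; first by rewrite mul0r sin0.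
    by rewrite -natr1 mulrDl mul1r sinDpi IH oppr0.
  case: n => j; first exact: spi.
  by rewrite NegzE mulrNz mulNr sinN spi oppr0.
have e := jsol_diff_const h1 h2 S0 t.
by move: far; rewrite /d e subrr normr0 ltNge (ltW pp).
Qed.

Lemma jsol_per phi (j : int) : jsol phi -> phi (2 * pi) - phi 0 = j%:~R * (2 * pi) ->
  forall k : nat, phi (2 * pi * k%:R) = phi 0 + (j%:~R * k%:R) * (2 * pi).
Proof.
move=> h e.
have h2 : jsol (fun t => phi (t + 2 * pi)).
  by apply: D1_eq (D1_comp h (D1_add (@D1_id R) (D1_cst (2 * pi)))) _ => t /=; rewrite gfun_per addr0 mul1r.
have S0 : sin ((phi (0 + 2 * pi) - phi 0) / 2) = 0.
  rewrite add0r e (_ : _ / 2 = j%:~R * pi); last by field.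
  have spi (i : nat) : sin (i%:R * pi) = 0 :> R.
    elim: i => [|i IH]; first by rewrite mul0r sin0.
    by rewrite -natr1 mulrDl mul1r sinDpi IH oppr0.
  case: j {e} => i; first exact: spi.
  by rewrite NegzE mulrNz mulNr sinN spi oppr0.
have key := jsol_diff_const h2 h S0.
elim=> [|k IH]; first by rewrite !mulr0 mul0r addr0.
have := key (2 * pi * k%:R); rewrite add0r e IH.
rewrite (_ : 2 * pi * k%:R + 2 * pi = 2 * pi * k.+1%:R); last by rewrite -natr1; ring.
by rewrite -natr1 => /(canRL (subrK _)) ->; ring.
Qed.

Lemma bounded_over (b : nat -> R) M : (forall k, `|b k| <= M) ->
  (fun k : nat => b k / (2 * pi * k%:R)) @ \oo --> 0.
Proof.
move=> hM; have p0 := pi_gt0 R; have M0 : 0 <= M by apply: le_trans (hM 0%N).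
rewrite -cvg_shiftS /=.
have hc : (fun k => M * @harmonic R k) @ \oo --> M * 0 by apply: cvgMr; exact: cvg_harmonic.
rewrite mulr0 in hc.
have hcN : (fun k => - (M * @harmonic R k)) @ \oo --> (0 : R) by rewrite -oppr0; exact: cvgN.
have key : \forall k \near \oo, - (M * @harmonic R k) <= b k.+1 / (2 * pi * k.+1%:R) <= M * @harmonic R k.
  near=> k.
  rewrite -ler_norml normrM normfV; apply: ler_pM => //.
  rewrite ger0_norm; last by rewrite !mulr_ge0//; lra.
  rewrite /harmonic /= lef_pV2 ?posrE ?mulr_gt0//.
  by rewrite ler_peMl//; have := pi_ge2 R; lra.
exact: (squeeze_cvgr key hcN hc).
Unshelve. all: by end_near. Qed.

Lemma jsol_rotation phi (j : int) : jsol phi -> phi (2 * pi) - phi 0 = j%:~R * (2 * pi) ->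
  (fun k : nat => phi (2 * pi * k%:R) / (2 * pi * k%:R)) @ \oo --> (j%:~R : R).
Proof.
move=> h e; have hk := jsol_per h e.
have h0 := @bounded_over (fun=> phi 0) `|phi 0| (fun=> lexx _).
have h1 : (fun k : nat => phi 0 / (2 * pi * k%:R) + j%:~R) @ \oo --> (0 + j%:~R : R).
  by apply: cvgD => //; exact: cvg_cst.
rewrite add0r in h1; rewrite -cvg_shiftS /= ; rewrite -cvg_shiftS /= in h1.
apply: cvg_trans h1; apply: near_eq_cvg; near=> k.
have kn : (k.+1%:R : R) != 0 by rewrite pnatr_eq0.
have pn : pi != 0 :> R by rewrite gt_eqF// pi_gt0.
rewrite hk; move: (k.+1%:R : R) (pi : R) kn pn => x p kn pn; field.
by rewrite kn pn.
Unshelve. all: by end_near. Qed.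

(** The rotation number is defined through some solution; this identifies it with the winding number
    of the orbit of a fixed phase. *)
Lemma rotation_unique phi1 phi2 (s : R) (j : int) : jsol phi1 -> jsol phi2 ->
  (fun k : nat => phi1 (2 * pi * k%:R) / (2 * pi * k%:R)) @ \oo --> s ->
  phi2 (2 * pi) - phi2 0 = j%:~R * (2 * pi) -> s = j%:~R.
Proof.
move=> h1 h2 l1 e; have l2 := jsol_rotation h2 e.
have h : (fun k : nat => (phi1 (2 * pi * k%:R) - phi2 (2 * pi * k%:R)) / (2 * pi * k%:R)) @ \oo --> 0.
  apply: (@bounded_over _ (2 * pi + `|phi1 0 - phi2 0|)) => k.
  have := jsol_diff_bounded h1 h2 (2 * pi * k%:R).
  set a := _ - phi2 _; set b := phi1 0 - _ => ab.
  by rewrite -[a](subrK b); apply: le_trans (ler_normD _ _) _; rewrite lerD2r.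
have h3 : (fun k : nat => phi1 (2 * pi * k%:R) / (2 * pi * k%:R) - phi2 (2 * pi * k%:R) / (2 * pi * k%:R)) @ \oo --> s - j%:~R.
  exact: cvgB.
have e3 : (fun k : nat => (phi1 (2 * pi * k%:R) - phi2 (2 * pi * k%:R)) / (2 * pi * k%:R)) @ \oo --> s - j%:~R.
  by apply: cvg_trans h3; apply: near_eq_cvg; near=> k; rewrite mulrBl.
have e2 : s - j%:~R = 0.
  by rewrite -(cvg_lim (@Rhausdorff R) e3) (cvg_lim (@Rhausdorff R) h).
by apply/eqP; rewrite -subr_eq0 e2.
Unshelve. all: by end_near. Qed.
End Rotation.

(** * The spectral polynomial *)
Section HeunMatrix.
Variable K : closedFieldType.
Hypothesis char0 : forall k : nat, (k.+1%:R : K) != 0.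
Variable n : nat.

(* Indices are shifted so that the anti-diagonal and the anti-diagonal below it carry the
   recurrence of kernel_vector with l = m.+1; matrices act on row vectors. *)
Definition heunM (S : nzRingType) m (x : S) : 'M[S]_m.+1 :=
  \matrix_(i, j) (if (i + j == m)%N then x else if (i + j == m.+1)%N then (i : nat)%:R else 0).
Definition heunQ : {poly {poly K}} := char_poly (heunM n 'X).

Lemma heunM_map (S S' : nzRingType) (f : {rmorphism S -> S'}) m x : map_mx f (heunM m x) = heunM m (f x).
Proof.
apply/matrixP => i j; rewrite !mxE; case: ifP => // _; case: ifP => _; last exact: rmorph0.
exact: rmorph_nat.
Qed.

(** Reversing the order of the rows gives a lower triangular matrix at the cost of a sign. *)
Lemma det_antitrig (S : comNzRingType) m (A : 'M[S]_m) :
  (forall i j : 'I_m, (j < i)%N -> A (rev_ord i) j = 0) ->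
  exists b : bool, \det A = (-1) ^+ b * \prod_i A (rev_ord i) i.
Proof.
move=> h; pose s := perm (@rev_ord_inj m); exists s.
have e : \det (row_perm s A) = \prod_i A (rev_ord i) i.
  rewrite -det_tr det_trig; last by apply/is_trig_mxP => i j ij; rewrite !mxE permE h.
  by apply: eq_bigr => i _; rewrite !mxE permE.
by rewrite -e row_permE det_mulmx det_perm mulrA -signr_addb addbb mul1r.
Qed.

Lemma det_heunM (S : comNzRingType) m (x : S) : exists b : bool, \det (heunM m x) = (-1) ^+ b * x ^+ m.+1.
Proof.
have [i j ij|b ->] := @det_antitrig S m.+1 (heunM m x).
  rewrite mxE /=; have := ltn_ord i => ii.
  by do 2![case: eqP => [h|_]; [exfalso; lia|]].
exists b; congr (_ * _); rewrite (eq_bigr (fun=> x)) ?prodr_const ?card_ord// => i _.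
by rewrite mxE /=; case: eqP => // h; exfalso; apply: h; have := ltn_ord i; lia.
Qed.

Lemma heunQ_monic : heunQ \is monic. Proof. exact: char_poly_monic. Qed.
Lemma size_heunQ : size heunQ = n.+2. Proof. exact: size_char_poly. Qed.

Lemma heunQ_r0 : exists b : bool, heunQ`_0 = (-1) ^+ b * 'X^(n.+1).
Proof.
rewrite char_poly_det; have [b ->] := det_heunM n ('X : {poly K}).
by exists (odd n.+1 (+) b); rewrite mulrA signr_addb signr_odd.
Qed.

(** At [mu = 0] row 0 of the matrix is zero, and the remaining block has anti-diagonal entries 1,
    ..., n, nonzero by [char0]. *)
Lemma heunQ_mu0 : exists2 q : {poly K}, map_poly (horner_eval 0) heunQ = 'X * q & q.[0] != 0.
Proof.
rewrite map_char_poly heunM_map /= horner_evalE hornerX.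
rewrite /char_poly (expand_det_row _ ord0) big_ord_recl big1 ?addr0 => [|i _]; last first.
  rewrite (_ : char_poly_mx _ _ _ = 0) ?mul0r// !mxE eq_liftF mulr0n /=.
  by rewrite !if_same polyC0 subr0.
rewrite !mxE /= if_same subr0 mulr1n.
exists (cofactor (char_poly_mx (heunM n 0)) ord0 ord0) => //.
rewrite /cofactor addn0 expr0 mul1r.
rewrite -[X in X != 0]horner_evalE -det_map_mx.
set B := map_mx _ _.
have BE (i j : 'I_n) : B i j = if (i + j).+1 == n then - (i.+1%:R) else 0.
  rewrite !mxE /= horner_evalE hornerD hornerN hornerC.
  rewrite hornerMn hornerX mul0rn add0r ?if_same.
  rewrite /bump /= !add1n addSn addnS eqSS.
  by case: eqP => h1; case: eqP => h2; rewrite ?oppr0//; exfalso; lia.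
have [i j ij|b ->] := @det_antitrig _ n B.
  by rewrite BE /=; case: eqP => // h; exfalso; have := ltn_ord i; lia.
rewrite mulf_neq0 ?signr_eq0//; apply/prodf_neq0 => i _.
have h : ((n - i.+1 + i).+1 == n)%N by apply/eqP; have := ltn_ord i; lia.
by rewrite BE /= h oppr_eq0 char0.
Qed.

(** The matrix is mu J + N with J the exchange matrix, J^2 = 1. Multiplying r - mu J - N by J turns
    the determinant, up to sign, into the characteristic polynomial of J (r - N) in the variable
    mu. *)
Lemma swap_heunQ_lead : exists2 c : K, c != 0 & lead_coef (swapXY heunQ) = c%:P.
Proof.
pose J : 'M[{poly K}]_n.+1 := \matrix_(i, j) (i + j == n)%N%:R.
pose N : 'M[{poly K}]_n.+1 := \matrix_(i, j) (if (i + j == n.+1)%N then (i : nat)%:R else 0).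
have JJ : J *m J = 1%:M.
  apply/matrixP => i k; rewrite !mxE (bigD1 (rev_ord i)) //= big1 ?addr0 => [|j /eqP jn].
    rewrite !mxE /= (_ : (i + _ == n)%N = true); last by apply/eqP; have := ltn_ord i; lia.
    rewrite mul1r; congr (_%:R); congr nat_of_bool; apply/eqP/eqP => [h|<-].
      by apply: val_inj => /=; have := ltn_ord i; have := ltn_ord k; lia.
    by have := ltn_ord i; lia.
  rewrite !mxE; case: eqP => [h|_]; last by rewrite mul0r.
  by exfalso; apply: jn; apply: val_inj => /=; lia.
have detJ : exists b : bool, \det J = (-1) ^+ b.
  have [i j ij|b ->] := @det_antitrig _ n.+1 J.
    by rewrite mxE /=; case: eqP => // h; exfalso; have := ltn_ord i; lia.
  exists b; rewrite big1 ?mulr1// => i _; rewrite mxE /=; case: eqP => // h.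
  by exfalso; apply: h; have := ltn_ord i; lia.
have e : swapXY heunQ = (-1) ^+ n.+1 * (\det J)%:P * char_poly (J *m ('X%:M - N)).
  rewrite /heunQ /char_poly -det_map_mx.
  have -> : (\det J)%:P = \det (map_mx polyC J) by rewrite det_map_mx.
  rewrite -mulrA -det_mulmx -detZ; congr (\det _).
  have e1 (A : 'M[{poly K}]_n.+1) : map_mx polyC J *m char_poly_mx (J *m A) = 'X *: map_mx polyC J - map_mx polyC A.
    by rewrite /char_poly_mx mulmxBr mul_mx_scalar -map_mxM mulmxA JJ mul1mx.
  rewrite e1.
  apply/matrixP => i j; rewrite !mxE rmorphB /= !rmorphMn /= swapXY_X swapXY_polyC.
  rewrite polyCB polyCMn -[_^:P]/(map_poly polyC _).
  have [h|h] := eqVneq (i + j)%N n.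
    rewrite (_ : (i + j == n.+1)%N = false); last by apply/negbTE/eqP; lia.
    by rewrite map_polyX mulr1 polyC0; ring.
  rewrite mulr0; case: (_ == n.+1)%N; last by rewrite rmorph0 polyC0; ring.
  by rewrite !rmorph_nat; ring.
have [b hb] := detJ.
exists ((-1) ^+ n.+1 * (-1) ^+ b); first by rewrite mulf_neq0// signr_eq0.
rewrite e hb lead_coefM (monicP (char_poly_monic _)) mulr1.
have -> : (-1) ^+ n.+1 * ((-1) ^+ b)%:P = ((-1) ^+ n.+1 * (-1) ^+ b)%:P%:P :> {poly {poly K}}.
  by rewrite !polyCM !polyC_exp !polyCN.
exact: lead_coefC.
Qed.
End HeunMatrix.

(** * Irreducibility of the spectral polynomial and polynomials vanishing on its curve *)

Section VanishingPolynomials.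
Variable K : closedFieldType.
Hypothesis char0 : forall k : nat, (k.+1%:R : K) != 0.
Variable n : nat.
Local Notation Q := (heunQ K n).
Implicit Types (G H p u : {poly {poly K}}) (c : {poly K}).

Lemma horner0E G : (map_poly (horner_eval (0 : K)) G).[0] = (G`_0).[0].
Proof. by rewrite horner_coef0 coef_map. Qed.

(** H(mu, 0) divides a power of mu without vanishing at 0, so it is constant. The leading
    coefficient of [H] in mu is constant too, so setting r = 0 does not lower the degree in mu,
    which is therefore 0. *)
Lemma heunQ_factor G H : Q = G * H -> (H`_0).[0] != 0 -> exists2 a : K, a != 0 & H = a%:P%:P.
Proof.
move=> e H0.
have [b hb] := heunQ_r0 K n.
have hH : H`_0 %| ('X - 0%:P) ^+ n.+1.
  have h : G`_0 * H`_0 = (-1) ^+ b * 'X^(n.+1) by rewrite -hb e coef0M.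
  apply/dvdpP; exists ((-1) ^+ b * G`_0).
  by rewrite -mulrA h mulrA -signr_addb addbb mul1r polyC0 subr0.
have [k kn hk] := (dvdp_exp_XsubCP hH).
have k0 : k = 0%N.
  apply/eqP; rewrite -leqn0 leqNgt; apply/negP => k_gt0.
  move: H0; have := eqp_root hk 0; rewrite /root => ->.
  by rewrite horner_exp hornerXsubC subrr expr0n eqn0Ngt k_gt0 eqxx.
rewrite k0 expr0 in hk.
have sH0 : size (H`_0) = 1%N by rewrite (eqp_size hk) size_poly1.
have [c c0 hc] := swap_heunQ_lead K n.
have el : lead_coef (swapXY G) * lead_coef (swapXY H) = c%:P.
  by rewrite -lead_coefM -rmorphM -e hc.
have sl : size (lead_coef (swapXY H)) = 1%N.
  have hs : size (lead_coef (swapXY G) * lead_coef (swapXY H)) = 1%N by rewrite el size_polyC c0.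
  by move/eqP: hs; rewrite size_mul_eq1 => /andP[_ /eqP].
have /size_poly1P[a a0 ha] : size (lead_coef (swapXY H)) == 1%N by rewrite sl.
have eH : H`_0 = map_poly (horner_eval 0) (swapXY H).
  by rewrite -horner_polyC polyC0 horner_coef0.
have sS : size (swapXY H) = 1%N.
  rewrite -sH0 eH size_map_poly_id0//.
  by rewrite ha horner_evalE hornerC.
exists a => //.
have hS : swapXY H = a%:P%:P.
  rewrite [swapXY H]size1_polyC ?sS//; congr _%:P.
  by rewrite -ha lead_coefE sS.
by rewrite -[H]swapXYK hS swapXY_polyC map_polyC.
Qed.

Lemma heunQ_irr G H : Q = G * H ->
  (exists2 a : K, a != 0 & G = a%:P%:P) \/ (exists2 a : K, a != 0 & H = a%:P%:P).
Proof.
move=> e; have [H0|H0] := eqVneq (H`_0).[0] 0; last by right; exact: (heunQ_factor e).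
left; apply: (@heunQ_factor H); first by rewrite mulrC.
apply/eqP => G0; have [q hq q0] := heunQ_mu0 char0 n.
have dv (F : {poly {poly K}}) : (F`_0).[0] = 0 -> exists F1, map_poly (horner_eval (0 : K)) F = F1 * 'X.
  rewrite -horner0E => /eqP F0.
  by have /factor_theorem [F1] := F0; rewrite polyC0 subr0 => ->; exists F1.
have [G1 hG1] := dv _ G0; have [H1 hH1] := dv _ H0.
have : 'X * q = 'X * (G1 * H1 * 'X) by rewrite -hq e rmorphM /= hG1 hH1; ring.
move=> /(mulfI (_ : 'X != 0)) h; move: q0; rewrite h ?polyX_eq0//.
by rewrite hornerM hornerX mulr0 eqxx.
Qed.

(** Linear factors of [c] are removed one at a time: at a root of [c] one of [G], [H] specializes to
    zero, so all its coefficients are divisible by that factor. *)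
Lemma gauss_content p G H c : c != 0 -> c *: p = G * H ->
  exists G' H', [/\ p = G' * H', exists2 a, a != 0 & G = a *: G' & exists2 a, a != 0 & H = a *: H'].
Proof.
have [m] := ubnP (size c); elim: m => // m IH in c G H *; rewrite ltnS => sc c0 e.
have [sc1|sc1] := leqP (size c) 1.
  have /size_poly1P[a a0 ha] : size c == 1%N by rewrite eqn_leq sc1 lt0n size_poly_eq0.
  exists G, (a^-1%:P *: H); split.
  - by rewrite -scalerAr -e ha scalerA -polyCM mulVf// scale1r.
  - by exists 1; rewrite ?oner_neq0// scale1r.
  - by exists a%:P; rewrite ?polyC_eq0// scalerA -polyCM divff// scale1r.
have /closed_rootP [x] : size c != 1%N by rewrite gtn_eqF.
move=> /factor_theorem [c' hc'].
have c'0 : c' != 0 by apply: contraNneq c0 => h; rewrite hc' h mul0r.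
have sc' : (size c' < m)%N.
  by apply: leq_trans sc; rewrite hc' size_mul ?polyXsubC_eq0// size_XsubC addn2.
have ev : map_poly (horner_eval x) G * map_poly (horner_eval x) H = 0.
  rewrite -rmorphM -e; apply/polyP => i.
  by rewrite coef_map coefZ coef0 /= horner_evalE hc' !hornerM hornerXsubC subrr mulr0 mul0r.
have dv (F : {poly {poly K}}) : map_poly (horner_eval x) F = 0 -> exists F1, F = ('X - x%:P) *: F1.
  move=> F0; exists (\poly_(i < size F) (F`_i %/ ('X - x%:P))).
  apply/polyP => i; rewrite coefZ coef_poly; case: ltnP => [_|h]; last by rewrite mulr0 nth_default.
  rewrite mulrC divpK// dvdp_XsubCl /root.
  by have := congr1 (fun q : {poly K} => q`_i) F0; rewrite coef_map coef0 => /eqP.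
have xn0 : 'X - x%:P != 0 by rewrite polyXsubC_eq0.
have canc u v : c *: u = ('X - x%:P) *: v -> c' *: u = v.
  rewrite hc' mulrC -scalerA => /eqP; rewrite -subr_eq0 -scalerBr scale_poly_eq0 (negPf xn0) /= subr_eq0.
  by move/eqP.
move/eqP: ev; rewrite mulf_eq0 => /orP[] /eqP /dv[F1 hF].
- have e1 : c' *: p = F1 * H by apply: canc; rewrite e hF scalerAl.
  have [G' [H' [h1 [a a0 h2] h3]]] := IH _ _ _ sc' c'0 e1.
  exists G', H'; split => //; exists (('X - x%:P) * a); first by rewrite mulf_neq0.
  by rewrite hF h2 scalerA.
- have e1 : c' *: p = G * F1 by apply: canc; rewrite e hF scalerAr.
  have [G' [H' [h1 h3 [a a0 h2]]]] := IH _ _ _ sc' c'0 e1.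
  exists G', H'; split => //; exists (('X - x%:P) * a); first by rewrite mulf_neq0.
  by rewrite hF h2 scalerA.
Qed.

Definition ev2K (p : {poly {poly K}}) (z : K * K) : K := (p.[z.2%:P]).[z.1].

Lemma ev2K_map p x y : ev2K p (x, y) = (map_poly (horner_eval x) p).[y].
Proof.
by rewrite /ev2K /= -[in RHS](hornerC y x) -[(y%:P).[x]]/(horner_eval x y%:P) horner_map.
Qed.
Lemma ev2KM p u z : ev2K (p * u) z = ev2K p z * ev2K u z.
Proof. by rewrite /ev2K !hornerM. Qed.

Lemma finite_roots (p : {poly K}) : p != 0 -> finite_set [set x | root p x].
Proof.
move=> p0; have [rs hrs] := closed_field_poly_normal p.
apply: (@sub_finite_set _ _ [set` rs]); last exact: finite_seq.
move=> x /=; rewrite hrs rootZ ?lead_coef_eq0//.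
by rewrite root_prod_XsubC.
Qed.

(** [Q] is monic in r, so vertical fibres are finite and [S] has infinitely many abscissas. The
    resultant of [p] and [Q] vanishes at all of them, hence is zero, and irreducibility makes the
    common factor [Q] itself, up to content. *)
Lemma heunQ_divides (S : set (K * K)) p : infinite_set S ->
  (forall z, S z -> ev2K Q z = 0) -> (forall z, S z -> ev2K p z = 0) ->
  exists u, p = u * Q.
Proof.
move=> infS SQ Sp.
have infX : infinite_set (fst @` S).
  move=> fin; apply: infS.
  apply: (@sub_finite_set _ _ (\bigcup_(x in fst @` S) [set z | z.1 = x /\ root (map_poly (horner_eval x) Q) z.2])).
    move=> z Sz; exists z.1; first by exists z.
    by split => //; rewrite /root -ev2K_map -surjective_pairing SQ.
  apply: bigcup_finite => // x _.
  have h : finite_set [set y | root (map_poly (horner_eval x) Q) y].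
    by apply: finite_roots; rewrite monic_neq0// monic_map// heunQ_monic.
  apply: sub_finite_set (finite_image (fun y => (x, y)) h).
  by move=> [a b] /= [-> r]; exists b.
have zero (c : {poly K}) : (forall z, S z -> c.[z.1] = 0) -> c = 0.
  move=> h; apply/eqP/negPn/negP => c0; apply: infX.
  apply: sub_finite_set (finite_roots c0).
  by move=> x [z Sz <-]; rewrite /= /root h.
have sQ : (1 < size Q)%N by rewrite size_heunQ.
have [sp|sp] := leqP (size p) 1.
  exists 0; rewrite mul0r [p]size1_polyC// (zero p`_0) ?polyC0//.
  by move=> z /Sp; rewrite /ev2K [p]size1_polyC// hornerC coefC.
have [[a b] /= _ e] := resultant_in_ideal sp sQ.
have r0 : resultant p Q = 0.
  apply: zero => z Sz; have := congr1 (fun q => ev2K q z) e.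
  rewrite /ev2K hornerC => ->; rewrite hornerD hornerD !hornerM.
  have := SQ z Sz; have := Sp z Sz; rewrite /ev2K => -> ->.
  by rewrite !mulr0 addr0.
have := resultant_eq0 p Q; rewrite r0 eqxx => /esym sg.
have /Pdiv.Idomain.dvdpP [[c1 u1] /= c10 e1] := dvdp_gcdl p Q.
have /Pdiv.Idomain.dvdpP [[c2 u2] /= c20 e2] := dvdp_gcdr p Q.
have [u3 [g' [eQ _ [d d0 hg]]]] := gauss_content c20 e2.
have [[k k0 hk]|[k k0 hk]] := heunQ_irr eQ; last first.
  move: sg; rewrite hg hk size_scale// size_polyC polyC_eq0 k0.
  by [].
have eg : g' = k^-1%:P%:P * Q.
  by rewrite eQ hk mulrA -!polyCM mulVf// mul1r.
(* So far [Q] divides only [c1 *: p]. Division by the monic [Q] removes [c1]: the remainder times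
   [c1] is a multiple of [Q] of smaller degree. *)
have [mon mon2] := (heunQ_monic K n, Pdiv.RingMonic.rdivp_eq (heunQ_monic K n) p).
exists (Pdiv.Ring.rdivp p Q); rewrite {1}mon2; apply/eqP; rewrite -subr_eq0 addrAC subrr add0r.
set r := Pdiv.Ring.rmodp p Q.
have er : c1 *: r = (u1 * (d *: k^-1%:P%:P) - c1 *: Pdiv.Ring.rdivp p Q) * Q.
  rewrite (_ : r = p - Pdiv.Ring.rdivp p Q * Q); last by rewrite {1}mon2 addrAC subrr add0r.
  rewrite scalerBr e1 hg eg mulrBl; congr (_ - _); last by rewrite scalerAl.
  by rewrite scalerAl mulrA.
have sr : (size (c1 *: r) < size Q)%N.
  by rewrite size_scale// Pdiv.Ring.ltn_rmodp monic_neq0.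
have : c1 *: r == 0.
  apply: contraTT sr => r0'; rewrite -leqNgt er size_Mmonic//; last first.
    by apply: contraNneq r0' => h; rewrite er h mul0r.
  rewrite -ltnS prednK ?addn_gt0 ?size_heunQ ?orbT//.
  rewrite -[X in (X < _)%N]add0n ltn_add2r lt0n size_poly_eq0.
  by apply: contraNneq r0' => h; rewrite er h mul0r.
by rewrite scale_poly_eq0 (negPf c10).
Qed.
End VanishingPolynomials.

(** * Real eigenvalues *)
Section Eigenvalues.
Variable C : numClosedFieldType.
Variables (n : nat) (mu : C).
Hypothesis muR : mu \is Num.real.
Local Notation M := (heunM n mu).

(* The diagonal matrix of the w i conjugates M into a real symmetric matrix. *)
Let w (i : nat) : C := ('C(n, i)%:R)^-1.
Let w_gt0 (i : 'I_n.+1) : 0 < w i.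
Proof. by rewrite /w invr_gt0 ltr0n bin_gt0 -ltnS ltn_ord. Qed.
Let w_sym (i j : 'I_n.+1) : M i j * w j = M j i * w i.
Proof.
rewrite !mxE [(j + i)%N]addnC; case: eqP => [h|_].
  congr (_ * _); rewrite /w; congr (_%:R^-1).
  by rewrite -bin_sub; [congr ('C(_, _)); lia|lia].
case: eqP => [h|_]; last by rewrite !mul0r.
have ei : (i : nat) = (n.+1 - j)%N by lia.
have jn := ltn_ord j; have inn := ltn_ord i.
have b0 (k : 'I_n.+1) : ('C(n, k)%:R : C) != 0 by rewrite pnatr_eq0 -lt0n bin_gt0 -ltnS ltn_ord.
apply: (mulIf (b0 j)); apply: (mulIf (b0 i)); rewrite /w mulfVK// mulrAC divfK//.
rewrite -!natrM; congr (_%:R).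
case: (i : nat) h inn ei (b0 i) => [|i0] h inn ei _; first lia.
have : (j = (n - i0)%N :> nat) by lia.
move=> ->; rewrite bin_sub; last lia.
have := mul_bin_left n i0; lia.
Qed.
Let MR (i j : 'I_n.+1) : Num.conj (M i j) = M i j.
Proof. by rewrite mxE; case: ifP => _; [exact: conj_Creal|case: ifP => _; [exact: conjC_nat|exact: conjC0]]. Qed.

(** The usual argument for Hermitian matrices with the weighted square norm [N]: [s = a * N] is
    self-conjugate by [w_sym]. *)
Lemma heun_eigen_real a : eigenvalue M a -> a \is Num.real.
Proof.
move=> /eigenvalueP [v hv v0].
pose s := \sum_(i < n.+1) (\sum_(j < n.+1) v 0 j * M j i) * w i * Num.conj (v 0 i).
pose N := \sum_(i < n.+1) w i * `|v 0 i| ^+ 2.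
have sE : s = a * N.
  rewrite /s /N mulr_sumr; apply: eq_bigr => i _.
  have := congr1 (fun A : 'rV_n.+1 => A 0 i) hv; rewrite !mxE => ->.
  by rewrite normCK; ring.
have NR : N \is Num.real.
  by apply: ger0_real; apply: sumr_ge0 => i _; rewrite mulr_ge0 ?exprn_ge0// ltW.
have N0 : N != 0.
  apply: contraNneq v0 => h; apply/eqP/rowP => i; rewrite mxE.
  have h2 : forall i : 'I_n.+1, true -> 0 <= w i * `|v 0 i| ^+ 2.
    by move=> k _; rewrite mulr_ge0 ?exprn_ge0// ltW.
  have /(_ i isT)/eqP := psumr_eq0P h2 h.
  by rewrite mulf_eq0 gt_eqF//= expf_eq0 normr_eq0 => /eqP.
have sR : Num.conj s = s.
  rewrite /s rmorph_sum /=.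
  under eq_bigr do rewrite !rmorphM rmorph_sum /= conjCK (conj_Creal (gtr0_real (w_gt0 _))) mulr_suml mulr_suml.
  under [RHS]eq_bigr do rewrite mulr_suml mulr_suml.
  rewrite exchange_big /=; apply: eq_bigr => i _; apply: eq_bigr => j _.
  rewrite rmorphM /= MR -[_ * w j * _]mulrA [w j * _]mulrC.
  by have := w_sym i j => h; rewrite [LHS](_ : _ = M i j * w j * (Num.conj (v 0 i) * v 0 j)); [rewrite h|]; ring.
have -> : a = s / N by rewrite sE mulfK.
by rewrite rpred_div//; apply/CrealP.
Qed.

Lemma schur_diag (A : 'M[C]_n.+1) : exists d : 'I_n.+1 -> C,
  [/\ forall i, eigenvalue A (d i), \sum_i d i = \tr A & \sum_i d i ^+ 2 = \tr (A *m A)].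
Proof.
have [P Pu Tt0] := Schur A (ltn0Sn n).
have uP : P \in unitmx by exact: unitarymx_unit.
have [T TE] : exists T, T = conjmx P A by exists (conjmx P A).
have Tt : is_trig_mx T by rewrite TE; exact: Tt0.
have e : T = P *m A *m invmx P by rewrite TE; exact: conjumx.
exists (fun i => T i i); split.
- move=> i; apply: (@eigenvalue_conjmx _ _ _ P); rewrite ?row_free_unit//; first by apply: stablemx_unit.
  rewrite -[_ \in _]/(eigenvalue (conjmx P A) (T i i)) -TE eigenvalue_root_char char_poly_trig//.
  by rewrite /root (bigD1 i)//= hornerM hornerXsubC subrr mul0r.
- by rewrite -[LHS]/(\tr T) e mxtrace_mulC mulmxA mulVmx// mul1mx.
- rewrite -[RHS](_ : \tr (T *m T) = _); last first.
    by rewrite e !mulmxA mulmxKV// mxtrace_mulC !mulmxA mulVmx// mul1mx.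
  apply: eq_bigr => i _; rewrite mxE (bigD1 i)//= big1 ?addr0// => j ji.
  have /is_trig_mxP h := Tt.
  by case: (ltngtP i j) ji => [ij|ij|/val_inj ->]; rewrite ?eqxx// (h _ _ ij) ?mul0r ?mulr0.
Qed.

(** Reals of one sign satisfy sum d^2 <= (sum d)^2. Here the opposite strict inequality holds: at
    most one diagonal entry is nonzero, all products M_ij M_ji are nonnegative, and the two corners
    contribute mu^2 > 0. *)
Lemma heun_eigen_signs : mu != 0 -> (0 < n)%N ->
  (exists2 a, eigenvalue M a & 0 < a) /\ (exists2 a, eigenvalue M a & a < 0).
Proof.
move=> mu0 n0; have [d [dE d1 d2]] := schur_diag M.
have dR i : d i \is Num.real by exact: heun_eigen_real.
have MM i j : 0 <= M i j * M j i.
  have -> : M i j * M j i = (M i j) ^+ 2 * (w j / w i).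
    by rewrite expr2 mulrA -(mulrA (M i j)) w_sym mulrA mulfK// gt_eqF.
  apply: mulr_ge0; last by apply: divr_ge0; exact: ltW.
  by rewrite real_exprn_even_ge0//; apply/CrealP/MR.
have key : (\sum_i d i) ^+ 2 < \sum_i d i ^+ 2.
  have dg (i j : 'I_n.+1) : j != i -> M i i * M j j = 0.
    have z (k : 'I_n.+1) : k != n.+1./2 :> nat -> M k k = 0.
      by move=> /eqP kn; rewrite mxE; do 2![case: eqP => [?|_]; first by exfalso; lia].
    move=> ji; have [h|/z ->] := eqVneq (i : nat) n.+1./2; last by rewrite mul0r.
    by rewrite (z j) ?mulr0// -h.
  rewrite d1 d2 expr2 /mxtrace mulr_suml.
  have le i : M i i * (\sum_j M j j) <= (M *m M) i i.
    rewrite mulr_sumr (bigD1 i)//= big1 ?addr0 => [|j /dg//].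
    by rewrite [leRHS]mxE (bigD1 i)//= lerDl sumr_ge0.
  rewrite (bigD1 ord0)//= [ltRHS](bigD1 ord0)//= ltr_leD//; last by apply: ler_sum.
  rewrite mulr_sumr (bigD1 ord0)//= big1 ?addr0 => [|j /dg//].
  rewrite [ltRHS]mxE (bigD1 ord0)//= ltrDl (bigD1 ord_max)/=; last by rewrite -val_eqE /= -lt0n.
  rewrite ltr_wpDr ?sumr_ge0//.
  by rewrite !mxE /= add0n addn0 eqxx -expr2 real_exprn_even_gt0.
have pos (s : C) : s ^+ 2 = 1 -> (forall i, 0 <= s * d i) -> False.
  move=> s2 h; move: key; rewrite le_gtF//.
  rewrite [leRHS](_ : _ = (\sum_i s * d i) ^+ 2); last by rewrite -mulr_sumr exprMn s2 mul1r.
  rewrite [leLHS](_ : _ = \sum_i (s * d i) ^+ 2); last by apply: eq_bigr => i _; rewrite exprMn s2 mul1r.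
  rewrite [leRHS]expr2 mulr_suml; apply: ler_sum => i _; rewrite expr2 ler_wpM2l//.
  by rewrite (bigD1 i)//= lerDl sumr_ge0.
split.
- apply: contrapT => h; apply: (pos (-1)); rewrite ?sqrrN ?expr1n// => i.
  rewrite mulN1r oppr_ge0 real_leNgt ?real0//; apply/negP => di.
  by apply: h; exists (d i).
- apply: contrapT => h; apply: (pos 1); rewrite ?expr1n// => i.
  rewrite mul1r real_leNgt ?real0//; apply/negP => di.
  by apply: h; exists (d i).
Qed.
End Eigenvalues.

Lemma CC_char0 (k : nat) : (k.+1%:R : CC) != 0.
Proof. by rewrite pnatr_eq0. Qed.

Lemma heunQ_root n (x y : CC) : (ev2 (heunQ CC n) (x, y) == 0) = eigenvalue (heunM n x) y.
Proof.
rewrite -[ev2 _ _]/(ev2K _ _) ev2K_map /heunQ map_char_poly heunM_map /= horner_evalE hornerX.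
by rewrite eigenvalue_root_char.
Qed.

(** Column [j] carries the recurrence at index n - j; the condition on [v n.+1] covers column 0,
    which has no entry below the anti-diagonal. *)
Lemma sum_heunM n (x : CC) (v : nat -> CC) (j : 'I_n.+1) : v n.+1 = 0 ->
  \sum_(i < n.+1) v i * heunM n x i j = (n - j).+1%:R * v (n - j).+1 + x * v (n - j)%N.
Proof.
move=> v0; have jn := ltn_ord j.
have [k jk] : exists k : 'I_n.+1, (k : nat) = (n - j)%N by exists (rev_ord j); rewrite /=; lia.
rewrite (bigD1 k)//= mxE (_ : (k + j == n)%N) ?jk; last by apply/eqP; lia.
rewrite addrC mulrC; congr (_ + _).
have [j0|j0] := eqVneq (j : nat) 0%N.
  rewrite j0 subn0 v0 mulr0 big1// => i ik; rewrite mxE j0.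
  have := ltn_ord i; case: eqP => [?|_].
    by exfalso; move/eqP: ik; apply; apply: val_inj => /=; lia.
  by case: eqP => [?|_]; rewrite ?mulr0//; lia.
have kn : ((n - j).+1 < n.+1)%N by lia.
rewrite (bigD1 (Ordinal kn)) /=; last by rewrite -val_eqE /= jk; apply/eqP; lia.
rewrite mxE /= ifF; last by apply/eqP; lia.
rewrite ifT; last by apply/eqP; lia.
rewrite big1 ?addr0 1?mulrC// => i /andP[/eqP i1 /eqP i2]; rewrite mxE; case: eqP => [?|_].
  by exfalso; apply: i1; apply: val_inj => /=; lia.
case: eqP => [?|_]; last by rewrite mulr0.
by exfalso; apply: i2; apply: val_inj => /=; lia.
Qed.

Lemma kernel_vector_root n (mu rho : RR) (t : nat -> CC) k : kernel_vector n.+1 mu rho t ->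
  (k < n.+1)%N -> t k != 0 -> ev2 (heunQ CC n) (mu%:C, rho%:C) = 0.
Proof.
move=> [t0 ht] kn tk; apply/eqP; rewrite heunQ_root; apply/eigenvalueP.
exists (\row_(i < n.+1) t i).
  apply/rowP => j; rewrite !mxE.
  under eq_bigr do rewrite mxE.
  rewrite sum_heunM// ht; last by have := ltn_ord j; lia.
  by congr (_ * t _); have := ltn_ord j; lia.
apply: contraNneq tk => h; have := congr1 (fun A : 'rV_n.+1 => A 0 (Ordinal kn)) h.
by rewrite !mxE => /= ->.
Qed.

Lemma root_kernel_vector n (mu rho : RR) : ev2 (heunQ CC n) (mu%:C, rho%:C) = 0 ->
  exists2 t : nat -> CC, kernel_vector n.+1 mu rho t & exists2 k, (k < n.+1)%N & t k != 0.
Proof.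
move=> /eqP; rewrite heunQ_root => /eigenvalueP [v hv v0].
pose t (i : nat) : CC := if (i < n.+1)%N then v 0 (inord i) else 0.
have tE (i : 'I_n.+1) : t i = v 0 i by rewrite /t ltn_ord inord_val.
have t0 : t n.+1 = 0 by rewrite /t ltnn.
exists t; last first.
  have [i vi] : exists i, v 0 i != 0.
    apply: contrapT => h; move/negP: v0; apply; apply/eqP/rowP => i; rewrite mxE.
    by apply: contrapT => /eqP hi; apply: h; exists i.
  by exists i => //; rewrite tE.
split => // k kn; have jn : (n - k < n.+1)%N by lia.
have := congr1 (fun A : 'rV_n.+1 => A 0 (Ordinal jn)) hv; rewrite !mxE -tE /=.
under eq_bigr do rewrite -tE.
by rewrite sum_heunM//= subKn//= subSS => <-.
Qed.

(** * Generalized simple intersections *)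
Lemma jsolutionE l (mu r : RR) phi : 0 < r ->
  jsolution (1 / (2 * r)) (l%:R / (2 * r)) (mu / r) phi <-> jsol l mu r phi.
Proof.
move=> r0; have e (t : RR) : (- sin (phi t) + l%:R / (2 * r) + mu / r * cos t) / (1 / (2 * r)) =
    - (2 * r) * sin (phi t) + gfun l mu t.
  by rewrite /gfun; field; rewrite gt_eqF.
by split => h t; have := h t; rewrite e.
Qed.

Lemma jsol_flip l (mu rho s : RR) phi : (forall x, sin (x + s) = - sin x) ->
  jsol l mu rho phi -> jsol l mu (- rho) (fun t => phi t + s).
Proof.
move=> hs h; apply: (D1_ext _ _ (D1_add h (D1_cst s))) => //.
by move=> t; rewrite hs addr0; ring.
Qed.

Lemma sin_addpi (x : RR) : sin (x + pi) = - sin x.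
Proof. by rewrite sinD cospi sinpi mulrN1 mulr0 addr0. Qed.
Lemma sin_subpi (x : RR) : sin (x - pi) = - sin x.
Proof. by rewrite sinD cosN sinN cospi sinpi mulrN1 oppr0 mulr0 addr0. Qed.

Lemma hasfix_flip l (mu rho s x : RR) : (forall x, sin (x + s) = - sin x) ->
  hasfix l mu rho x -> hasfix l mu (- rho) (x + s).
Proof.
move=> hs [phi h [<- [k hk]]]; exists (fun t => phi t + s); first exact: jsol_flip.
by split => //; exists k; rewrite -hk; ring.
Qed.

Lemma pfixesE l (mu r x : RR) : 0 < r ->
  pfixes (1 / (2 * r)) (l%:R / (2 * r)) (mu / r) x <-> hasfix l mu r x.
Proof.
move=> r0; split.
  by move=> [y [[phi [/(jsolutionE _ _ _ r0) h [h0 <-]]] hk]]; exists phi.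
move=> [phi /(jsolutionE _ _ _ r0) h [h0 hk]]; exists (phi (2 * pi)); split => //.
by exists phi.
Qed.

Lemma pfixesNE l (mu r : RR) : 0 < r ->
  pfixes (1 / (2 * r)) (l%:R / (2 * r)) (mu / r) (- (pi / 2)) <-> hasfix l mu (- r) (pi / 2).
Proof.
move=> r0; rewrite pfixesE//; split => h.
- rewrite (_ : pi / 2 = - (pi / 2) + pi :> RR); last by field.
  exact: (hasfix_flip sin_addpi).
- rewrite (_ : - (pi / 2) = pi / 2 - pi :> RR); last by field.
  by rewrite -[r]opprK; exact: (hasfix_flip sin_subpi).
Qed.

Lemma pidentityE l (mu r : RR) : 0 < r ->
  pidentity (1 / (2 * r)) (l%:R / (2 * r)) (mu / r) <-> (forall x, hasfix l mu r x).
Proof. by move=> r0; split => h x; move: (h x); rewrite pfixesE. Qed.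

Lemma hasfix_allN l (mu r : RR) : (forall x, hasfix l mu r x) <-> (forall x, hasfix l mu (- r) x).
Proof.
split=> h x.
- by rewrite -[x](subrK pi); apply: (hasfix_flip sin_addpi).
- by rewrite -[x](subrK pi) -[r]opprK; apply: (hasfix_flip sin_addpi).
Qed.

(** The parity condition concerns the rotation number [s], whereas [forward] needs it for the
    winding number of the given orbit; [rotation_unique] equates the two after a shift by pi when
    rho = - r. *)
Lemma fix_root n (mu r rho : RR) (s : int) : 0 < r -> rho = r \/ rho = - r ->
  in_L (1 / (2 * r)) s (n.+1%:R / (2 * r)) (mu / r) -> ((s - n.+1%:Z) %% 2)%Z = 0 ->
  hasfix n.+1 mu rho (pi / 2) -> mu = 0 \/ ~ (forall x, hasfix n.+1 mu r x) ->
  ev2 (heunQ CC n) (mu%:C, rho%:C) = 0.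
Proof.
move=> r0 hrho [phi1 [/(jsolutionE _ _ _ r0) h1 lim]] par [phi2 h2 [h20 [k hk]]] nid.
have [phi3 h3 e3] : exists2 phi3, jsol n.+1 mu r phi3 &
    phi3 (2 * pi) - phi3 0 = phi2 (2 * pi) - phi2 0.
  case: hrho h2 => -> h2; first by exists phi2.
  exists (fun t => phi2 t + pi); first by rewrite -[r]opprK; exact: (jsol_flip sin_addpi).
  by ring.
have /intr_inj sk : (s%:~R : RR) = k%:~R.
  by apply: (rotation_unique h1 h3 lim); rewrite e3 h20.
have [j ej] : exists j : int, k = (n.+1%:Z + 2 * j) by exists ((s - n.+1%:Z) %/ 2)%Z; lia.
have rho0 : rho != 0 by case: hrho => ->; rewrite ?oppr_eq0 gt_eqF.
have nid' : mu = 0 \/ exists x, ~ hasfix n.+1 mu rho x.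
  case: nid => h; [by left|right]; apply/not_existsP => h'; apply: h.
  have h4 x : hasfix n.+1 mu rho x by apply: contrapT; exact: h'.
  by case: hrho => e; rewrite e in h4; [|apply/hasfix_allN].
rewrite ej in hk.
have [t kt [i il ti]] := forward rho0 h2 h20 hk nid'.
exact: kernel_vector_root kt il ti.
Qed.

Lemma root_fix n (mu r rho : RR) : 0 < r -> rho = r \/ rho = - r ->
  ev2 (heunQ CC n) (mu%:C, rho%:C) = 0 ->
  hasfix n.+1 mu rho (pi / 2) /\
  exists2 s, in_L (1 / (2 * r)) s (n.+1%:R / (2 * r)) (mu / r) & ((s - n.+1%:Z) %% 2)%Z = 0.
Proof.
move=> r0 hrho /root_kernel_vector [t kt nz].
have rho0 : rho != 0 by case: hrho => ->; rewrite ?oppr_eq0 gt_eqF.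
have [phi [h h0 [k hk]]] := backward rho0 kt nz.
split; first by exists phi => //; split => //; exists (n.+1%:Z - 2 * k).
exists (n.+1%:Z - 2 * k); last by lia.
have [phi3 h3 e3] : exists2 phi3, jsol n.+1 mu r phi3 &
    phi3 (2 * pi) - phi3 0 = phi (2 * pi) - phi 0.
  case: hrho h => -> h; first by exists phi.
  exists (fun t => phi t + pi); first by rewrite -[r]opprK; exact: (jsol_flip sin_addpi).
  by ring.
exists phi3; split; first by apply/jsolutionE.
by apply: (jsol_rotation h3); rewrite e3 h0.
Qed.

Lemma root_not_identity n (mu r rho : RR) : 0 < r -> rho = r \/ rho = - r ->
  ev2 (heunQ CC n) (mu%:C, rho%:C) = 0 -> mu != 0 -> `|mu| <= 10^-1 ->
  ~ (forall x, hasfix n.+1 mu r x).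
Proof.
move=> r0 hrho /root_kernel_vector [t kt nz] mu0 mu1 h.
have rho0 : rho != 0 by case: hrho => ->; rewrite ?oppr_eq0 gt_eqF.
apply: (not_all_fixed rho0 kt nz mu0 mu1).
by case: hrho => ->; [|apply/hasfix_allN; rewrite opprK].
Qed.

Section IntersectionPoints.
Variable n : nat.
Local Notation Q := (heunQ CC n).

(** A constriction has nonzero [A], so [mu = 0] must remain as an alternative: it covers the growth
    points. *)
Lemma not_identity_gen (mu r : RR) (s : int) : 0 < r ->
  in_L (1 / (2 * r)) s (n.+1%:R / (2 * r)) (mu / r) ->
  ~ constriction (1 / (2 * r)) (n.+1%:R / (2 * r)) (mu / r) ->
  mu = 0 \/ ~ (forall x, hasfix n.+1 mu r x).
Proof.
move=> r0 hs nc; have [->|mu0] := eqVneq mu 0; [by left|right => h; apply: nc].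
split; first by exists s.
by split; [exact/pidentityE|rewrite mulf_neq0// invr_eq0 gt_eqF].
Qed.

Lemma SI_root (z : RR * RR) : SI n.+1 z ->
  ev2 Q (cplx2 z) = 0 \/ ev2 Q (z.1%:C, (- z.2)%:C) = 0.
Proof.
case: z => mu r [/= r0 [_ [[s [par hd]] nc]]].
case: hd => -[hL hf]; [left|right].
- apply: (fix_root r0 (or_introl erefl) hL par); last exact: not_identity_gen hL nc.
  exact/pfixesE.
- apply: (fix_root r0 (or_intror erefl) hL par); last exact: not_identity_gen hL nc.
  exact/pfixesNE.
Qed.

Lemma SI_dL (z : RR * RR) : SI n.+1 z ->
  exists s, [/\ in_L (1 / (2 * z.2)) s (n.+1%:R / (2 * z.2)) (z.1 / z.2), ((s - n.+1%:Z) %% 2)%Z = 0 &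
    z.1 = 0 \/ ~ (forall x, hasfix n.+1 z.1 z.2 x)].
Proof.
case: z => mu r [/= r0 [_ [[s [par hd]] nc]]].
by exists s; split => //; case: hd => -[hL hf] //; exact: not_identity_gen hL nc.
Qed.

Lemma SI0p_root (z : RR * RR) : SI0p n.+1 z -> ev2 Q (cplx2 z) = 0.
Proof.
case: z => mu r [[hSI _] hf]; have [/= r0 _] := hSI.
have [s [hL par nid]] := SI_dL hSI.
by apply: (fix_root r0 (or_introl erefl) hL par); [exact/pfixesE|].
Qed.

Lemma SI0m_root (z : RR * RR) : SI0m n.+1 z -> ev2 Q (z.1%:C, (- z.2)%:C) = 0.
Proof.
case: z => mu r [[hSI _] hf]; have [/= r0 _] := hSI.
have [s [hL par nid]] := SI_dL hSI.
by apply: (fix_root r0 (or_intror erefl) hL par); [exact/pfixesNE|].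
Qed.

Lemma root_SI0 (mu r rho : RR) : 0 < r -> rho = r \/ rho = - r -> mu != 0 -> `|mu| <= 10^-1 ->
  ev2 Q (mu%:C, rho%:C) = 0 -> SI0 n.+1 (mu, r).
Proof.
move=> r0 hrho mu0 mu1 hQ; have [hf [s hs par]] := root_fix r0 hrho hQ.
have nid : ~ pidentity (1 / (2 * r)) (n.+1%:R / (2 * r)) (mu / r).
  by move=> /(pidentityE _ _ r0); exact: (root_not_identity r0 hrho hQ).
split; last by move=> [_ [/nid]].
split=> //=; split; first by field; rewrite gt_eqF.
split; last by move=> [_ [/nid]].
exists s; split => //; case: hrho hf => -> hf; [left|right]; split => //.
- exact/pfixesE.
- exact/pfixesNE.
Qed.

(** For [n = 0] the only eigenvalue is [mu], so its sign must be prescribed. This is why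
    [infinite_SI0p] uses positive and [infinite_SI0m] negative abscissas. *)
Lemma real_eigen (mu : RR) : mu != 0 ->
  ((0 < n)%N \/ 0 < mu -> exists2 rho : RR, 0 < rho & ev2 Q (mu%:C, rho%:C) = 0) /\
  ((0 < n)%N \/ mu < 0 -> exists2 rho : RR, rho < 0 & ev2 Q (mu%:C, rho%:C) = 0).
Proof.
move=> mu0; have [n0|n0] := posnP n.
  have hmu : ev2 Q (mu%:C, mu%:C) = 0.
    apply: (@kernel_vector_root n mu mu (fun k => (k == 0%N)%:R) 0%N) => //; last by rewrite oner_eq0.
    by rewrite n0; split => // -[|]// _; rewrite mulr0 add0r.
  by split=> -[|h]; [rewrite n0|exists mu|rewrite n0|exists mu].
have muR : mu%:C \is Num.real by apply/complex_realP; exists mu.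
have muC : mu%:C != 0 :> CC by rewrite (inj_eq (@complexI _)).
have [[a ha a0] [b hb b0]] := heun_eigen_signs muR muC n0.
split => _.
- have /complex_realP [x xE] := heun_eigen_real muR ha.
  rewrite xE in ha a0; exists x; first by move: a0; rewrite ltcE /= => /andP[].
  by apply/eqP; rewrite heunQ_root.
- have /complex_realP [x xE] := heun_eigen_real muR hb.
  rewrite xE in hb b0; exists x; first by move: b0; rewrite ltcE /= => /andP[].
  by apply/eqP; rewrite heunQ_root.
Qed.

Lemma infinite_fst (S : set (RR * RR)) (f : nat -> RR) : injective f ->
  (forall k, exists y, S (f k, y)) -> infinite_set S.
Proof.
move=> fi hf fin; apply: infinite_nat.
rewrite -(eq_finite_set (inj_card_eq (in2W fi))).
apply: (sub_finite_set _ (finite_image fst fin)) => _ [k _ <-].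
by have [y hy] := hf k; exists (f k, y).
Qed.

Let small (k : nat) : RR := (k + 11)%:R^-1.
Let small_inj : injective small.
Proof. by move=> i j /invr_inj /eqP; rewrite eqr_nat eqn_add2r => /eqP. Qed.
Let small_gt0 k : 0 < small k. Proof. by rewrite invr_gt0 ltr0n addnS. Qed.
Let small_le k : small k <= 10^-1.
Proof. by rewrite lef_pV2 ?posrE ?ltr0n ?addnS// ler_nat; lia. Qed.

Lemma infinite_SI0p : infinite_set (SI0p n.+1).
Proof.
apply: (infinite_fst small_inj) => k.
have s0 := lt0r_neq0 (small_gt0 k); have [+ _] := real_eigen s0.
case; first by right.
move=> r r0 hr; exists r; split.
  by apply: (root_SI0 r0 (or_introl erefl)) => //; rewrite ger0_norm// ltW.
by apply/pfixesE => //; have [] := root_fix r0 (or_introl erefl) hr.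
Qed.

Lemma infinite_SI0m : infinite_set (SI0m n.+1).
Proof.
apply: (@infinite_fst _ (fun k => - small k)); first by move=> i j /oppr_inj/small_inj.
move=> k; have s0 : - small k != 0 by rewrite oppr_eq0 lt0r_neq0.
have [_ +] := real_eigen s0.
case; first by right; rewrite oppr_lt0.
move=> r r0 hr; have r1 : 0 < - r by rewrite oppr_gt0.
have e : r = - r \/ r = - - r by right; rewrite opprK.
exists (- r); split.
  by apply: (root_SI0 r1 e) => //; rewrite normrN ger0_norm// ltW.
by apply/pfixesNE => //; rewrite opprK; have [] := root_fix r1 e hr.
Qed.
End IntersectionPoints.

(** * Zariski closures *)
Section PrimeSets.
Implicit Types (V W S T : set (CC * CC)) (p q : {poly {poly CC}}).

(** Every infinite subset is Zariski dense: a form of being an irreducible curve that passes easily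
    to images and to closures of real points. *)
Definition prime_set V := infinite_set V /\
  forall S p, infinite_set S -> S `<=` V -> (forall z, S z -> ev2 p z = 0) ->
  forall z, V z -> ev2 p z = 0.

Lemma prime_subset V T : prime_set V -> algebraic_set T -> infinite_set (V `&` T) -> V `<=` T.
Proof.
move=> [_ hV] [P ->] inf z Vz p Pp; apply: (hV _ _ inf) => //.
by move=> w [_ /(_ p Pp)].
Qed.

Lemma prime_irreducible V : algebraic_set V -> prime_set V -> irreducible_algset V.
Proof.
move=> aV pV; split=> //; split; first by move=> V0; apply: pV.1; rewrite V0.
move=> S1 S2 a1 a2 e.
have [fin|inf] := pselect (finite_set S1).
  right; rewrite eqEsubset; split; last by rewrite e.
  apply: (prime_subset pV a2); rewrite setIidr; last by rewrite e.
  by move=> fin2; apply: pV.1; rewrite e finite_setU.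
left; rewrite eqEsubset; split; last by rewrite e.
by apply: (prime_subset pV a1); rewrite setIidr// e.
Qed.

(** Polynomials pull back along [gs], and an infinite subset of the image has an infinite preimage
    in [V]. *)
Lemma prime_image V (g : CC * CC -> CC * CC) (gs : {poly {poly CC}} -> {poly {poly CC}}) :
  (forall p z, ev2 (gs p) z = ev2 p (g z)) -> infinite_set (g @` V) ->
  prime_set V -> prime_set (g @` V).
Proof.
move=> hg ginf [_ hV]; split=> // S p inf SV hS _ [z Vz <-]; rewrite -hg.
apply: (hV (V `&` g @^-1` S)) => //.
- move=> fin; apply: inf; apply: (sub_finite_set _ (finite_image g fin)).
  by move=> w Sw; have [y Vy e] := SV _ Sw; exists y => //; split => //=; rewrite e.
- by move=> w [_ Sw]; rewrite hg; exact: hS.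
Qed.

Lemma infinite_cplx2 (S : set (RR * RR)) : infinite_set S -> infinite_set (cplx2 @` S).
Proof.
move=> inf fin; apply: inf.
apply: (sub_finite_set _ (finite_image (fun z : CC * CC => (complex.Re z.1, complex.Re z.2)) fin)).
by move=> [x y] Sz; exists (cplx2 (x, y)) => //; exists (x, y).
Qed.

Lemma prime_closure V (S : set (RR * RR)) : algebraic_set V -> prime_set V ->
  infinite_set S -> (forall z, S z -> V (cplx2 z)) -> zariski_closure S = V.
Proof.
move=> [P VE] [_ hV] inf SV; rewrite eqEsubset; split=> w.
  by move=> hw; rewrite VE => p Pp; apply: hw => z /SV; rewrite VE; exact.
move=> Vw p hp; apply: (hV (cplx2 @` S)) => //.
- exact: infinite_cplx2.
- by move=> _ [z /SV Vz <-].
- by move=> _ [z Sz <-]; exact: hp.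
Qed.

Lemma algebraic_setI S T : algebraic_set S -> algebraic_set T -> algebraic_set (S `&` T).
Proof.
move=> [P ->] [P' ->]; exists (P `|` P'); rewrite eqEsubset; split=> z.
  by move=> [h h'] p [/h|/h'].
by move=> h; split=> p Pp; apply: h; [left|right].
Qed.

Lemma irreducible_subU V W T : algebraic_set V -> algebraic_set W -> irreducible_algset T ->
  T `<=` V `|` W -> T `<=` V \/ T `<=` W.
Proof.
move=> aV aW [aT [_ hT]] TVW.
have e : T = (T `&` V) `|` (T `&` W) by rewrite -setIUr; apply/esym/setIidl.
by case: (hT _ _ (algebraic_setI aT aV) (algebraic_setI aT aW) e) => ->;
  [left|right]; exact: subIsetr.
Qed.

Lemma component_setU V W T : algebraic_set V -> algebraic_set W -> prime_set V -> prime_set W ->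
  V <> W -> irreducible_component (V `|` W) T <-> T = V \/ T = W.
Proof.
have max V1 W1 : algebraic_set V1 -> algebraic_set W1 -> prime_set V1 -> prime_set W1 -> V1 <> W1 ->
    irreducible_component (V1 `|` W1) V1.
  move=> aV aW pV pW VW; split; first exact: prime_irreducible.
  split; first exact: subsetUl.
  move=> T' iT' VT' /(irreducible_subU aV aW iT') [TV|TW].
    by rewrite eqEsubset.
  exfalso; apply: VW; have VW' := subset_trans VT' TW.
  rewrite eqEsubset; split=> //; apply: (prime_subset pW aV).
  by rewrite setIidr//; exact: pV.1.
move=> aV aW pV pW VW; split; last first.
  by case=> ->; [exact: max|rewrite setUC; apply: max => // e; apply: VW].
move=> [iT [TVW mT]]; case: (irreducible_subU aV aW iT TVW) => h; [left|right].
- by apply/esym/(mT _ (prime_irreducible aV pV) h); exact: subsetUl.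
- by apply/esym/(mT _ (prime_irreducible aW pW) h); exact: subsetUr.
Qed.
End PrimeSets.

Lemma even_odd_comp (p : {poly {poly CC}}) : exists e o : {poly {poly CC}},
  p = e \Po 'X^2 + 'X * (o \Po 'X^2).
Proof.
elim/poly_ind: p => [|p c [e [d ->]]]; first by exists 0, 0; rewrite !comp_poly0 mulr0 addr0.
exists ('X * d + c%:P), e.
by rewrite comp_polyD comp_polyM comp_polyX comp_polyC; ring.
Qed.

Lemma coef_comp_polyNX (q : {poly CC}) i : (q \Po - 'X)`_i = (-1) ^+ i * q`_i.
Proof.
elim/poly_ind: q i => [|q c IH] i; first by rewrite comp_poly0 coef0 mulr0.
rewrite comp_poly_MXaddC mulrN !coefD coefN !coefMX !coefC.
case: i => [|i] /=; first by rewrite oppr0 expr0 mul1r.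
by rewrite IH exprS; ring.
Qed.

(** * The two curves, their difference and their common image *)

Section Curve.
Variable n : nat.
Local Notation Q := (heunQ CC n).
Implicit Types (p : {poly {poly CC}}) (z : CC * CC).

Definition negr z : CC * CC := (z.1, - z.2).
Definition Vp : set (CC * CC) := [set z | ev2 Q z = 0].
Definition Vm : set (CC * CC) := negr @` Vp.

Lemma negrK : involutive negr. Proof. by move=> [x y]; rewrite /negr /= opprK. Qed.

Lemma VmE : Vm = [set z | ev2 Q (negr z) = 0].
Proof.
rewrite eqEsubset; split=> z; first by move=> [w Vw <-]; rewrite /= negrK.
by move=> h; exists (negr z) => //; exact: negrK.
Qed.

Lemma ev2_comp p q z : ev2 (p \Po q) z = (p.[q.[z.2%:P]]).[z.1].
Proof. by rewrite /ev2 horner_comp. Qed.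

Lemma ev2_neg p z : ev2 (p \Po - 'X) z = ev2 p (negr z).
Proof. by rewrite ev2_comp hornerN hornerX /ev2 /= polyCN. Qed.

Lemma ev2_sq p z : ev2 (p \Po 'X^2) z = ev2 p (sqmap z).
Proof. by rewrite ev2_comp hornerXn /ev2 /= polyC_exp. Qed.

Lemma zero_set1 p : zero_set [set p] = [set z | ev2 p z = 0].
Proof. by rewrite eqEsubset; split=> z h; [exact: h|move=> _ ->]. Qed.

Lemma Vp_alg : algebraic_set Vp.
Proof. by exists [set Q]; rewrite zero_set1. Qed.
Lemma Vm_alg : algebraic_set Vm.
Proof. by exists [set Q \Po - 'X]; rewrite zero_set1 VmE; apply/funext => z /=; rewrite ev2_neg. Qed.

Lemma negr_cplx2 (z : RR * RR) : negr (cplx2 z) = (z.1%:C, (- z.2)%:C).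
Proof. by rewrite /negr (rmorphN (real_complex RR)). Qed.

Lemma SI0p_Vp (z : RR * RR) : SI0p n.+1 z -> Vp (cplx2 z).
Proof. exact: SI0p_root. Qed.
Lemma SI0m_Vm (z : RR * RR) : SI0m n.+1 z -> Vm (cplx2 z).
Proof. by move=> /SI0m_root h; rewrite VmE /= negr_cplx2. Qed.

Lemma Vp_infinite : infinite_set Vp.
Proof.
apply: sub_infinite_set (infinite_cplx2 (@infinite_SI0p n)).
by move=> _ [z Sz <-]; exact: SI0p_Vp.
Qed.

Lemma Vp_prime : prime_set Vp.
Proof.
split; first exact: Vp_infinite.
move=> S p inf SV Sp z Vz.
have [u ->] := heunQ_divides CC_char0 inf SV Sp.
by rewrite -[LHS]/(ev2K _ _) ev2KM -[ev2K Q z]/(ev2 Q z) Vz mulr0.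
Qed.

Lemma Vm_prime : prime_set Vm.
Proof.
apply: (prime_image ev2_neg) Vp_prime => fin; apply: Vp_infinite.
apply: sub_finite_set (finite_image negr fin).
by move=> z Vz; exists (negr z); [exists z|exact: negrK].
Qed.

Lemma sqmap_Vp_prime : prime_set (sqmap @` Vp).
Proof.
apply: (prime_image ev2_sq) Vp_prime => fin; apply: Vp_infinite.
(* A point is recovered from its image by a square root up to [negr], so a finite image would make
   [Vp] finite. *)
pose sq (z : CC * CC) := (z.1, sqrtC z.2).
have fin2 := finite_image sq fin.
have : finite_set ((sq @` (sqmap @` Vp)) `|` negr @` (sq @` (sqmap @` Vp))).
  by rewrite finite_setU; split=> //; exact: finite_image.
apply: sub_finite_set => z Vz; have : sqrtC (z.2 ^+ 2) ^+ 2 = z.2 ^+ 2 by exact: sqrtCK.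
move=> /eqP; rewrite eqf_sqr => /orP[] /eqP e; [left|right].
  by exists (sqmap z); [exists z|rewrite /sq /= e; case: (z)].
exists (sq (sqmap z)); first by exists (sqmap z) => //; exists z.
by rewrite /sq /negr /= e opprK; case: (z).
Qed.

Lemma trace_heunM1 : \tr (heunM n (1 : CC)) != 0.
Proof.
have k2 : (n.+1./2 < n.+1)%N by lia.
rewrite gt_eqF// /mxtrace (bigD1 (Ordinal k2))//= ltr_wpDr ?sumr_ge0//.
  by move=> i _; rewrite mxE; do 2![case: ifP => // _].
rewrite mxE /=; case: eqP => // h; case: eqP => [h2|]; first by rewrite ltr0n; lia.
by move=> h2; exfalso; lia.
Qed.

(** Equality would give Q(mu, - r) = u Q(mu, r) with u free of r. At mu = 1 the two highest
    coefficients in r then require opposite signs for u(1) unless the trace vanishes. *)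
Lemma Vp_neq_Vm : Vp <> Vm.
Proof.
move=> e.
have [u hu] : exists u, Q \Po - 'X = u * Q.
  apply: (heunQ_divides CC_char0 Vp_infinite) => // z; rewrite e VmE => h.
  by rewrite -[LHS]/(ev2 _ _) ev2_neg.
have sQN : size (Q \Po - 'X) = n.+2 by rewrite size_comp_poly2 ?size_heunQ// size_polyN size_polyX.
have u0 : u != 0 by apply: contra_eq_neq sQN => /= h; rewrite hu h mul0r size_poly0.
have su : size u = 1%N.
  by move: sQN; rewrite hu size_Mmonic ?heunQ_monic// size_heunQ addnS -[in RHS]add1n => /addIn.
have [q qM] : exists q, q = char_poly (heunM n (1 : CC)) by eexists.
have Qq : map_poly (horner_eval 1) Q = q.
  by rewrite /heunQ map_char_poly heunM_map /= horner_evalE hornerX qM.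
have hq : q \Po - 'X = (u`_0).[1] *: q.
  have := congr1 (map_poly (horner_eval (1 : CC))) hu.
  rewrite map_comp_poly rmorphN /= map_polyX Qq [u in RHS]size1_polyC ?su// mul_polyC.
  by rewrite map_polyZ /= Qq horner_evalE.
have hc i : (-1) ^+ i * q`_i = (u`_0).[1] * q`_i by rewrite -coef_comp_polyNX hq coefZ.
have q1 : q`_n.+1 = 1.
  have := monicP (char_poly_monic (heunM n (1 : CC))).
  by rewrite lead_coefE size_char_poly -qM.
have q0 : q`_n = - \tr (heunM n (1 : CC)) by rewrite qM -[n in LHS]/(n.+1.-1) char_poly_trace.
have c1 : (u`_0).[1] = (-1) ^+ n.+1 by have := hc n.+1; rewrite q1 !mulr1.
have := hc n; rewrite c1 exprS mulN1r mulNr => /eqP.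
rewrite -subr_eq0 opprK -mulrDl -mulr2n mulf_eq0 mulrn_eq0 signr_eq0 /= q0 oppr_eq0.
by rewrite (negPf trace_heunM1).
Qed.

Lemma Vp_curve : algebraic_curve Vp.
Proof.
exists Q; rewrite zero_set1; split=> // c /(congr1 (fun p => size (p : {poly _}))).
by rewrite size_heunQ => h; have := size_polyC_leq1 (c%:P : {poly CC}); rewrite -h.
Qed.
Lemma Vm_curve : algebraic_curve Vm.
Proof.
exists (Q \Po - 'X); rewrite zero_set1; split; last first.
  by rewrite VmE; apply/funext => z /=; rewrite ev2_neg.
move=> c /(congr1 (fun p => size (p : {poly _}))); rewrite size_comp_poly2; last first.
  by rewrite size_polyN size_polyX.
by rewrite size_heunQ => h; have := size_polyC_leq1 (c%:P : {poly CC}); rewrite -h.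
Qed.

(** Writing Q = e(r^2) + r d(r^2), the equation is the norm e^2 - X d^2, which becomes Q(mu, r)
    Q(mu, - r) at X = r^2. Every zero lifts since complex square roots exist, after a change of sign
    of r if necessary. *)
Lemma sqmap_curve : algebraic_curve (sqmap @` Vp).
Proof.
have [e [d Qe]] := even_odd_comp Q.
pose f := e ^+ 2 - 'X * d ^+ 2.
have fE : f \Po 'X^2 = Q * (Q \Po - 'X).
  have c2 (p : {poly {poly CC}}) : (p \Po 'X^2) \Po - 'X = p \Po 'X^2.
    by rewrite -comp_polyA comp_Xn_poly sqrrN.
  have -> : Q \Po - 'X = (e \Po 'X^2) - 'X * (d \Po 'X^2).
    by rewrite Qe comp_polyD comp_polyM !c2 comp_polyX mulNr.
  rewrite [in RHS]Qe.
  by rewrite /f comp_polyB (comp_polyM e e) (comp_polyM 'X) comp_polyX (comp_polyM d d); ring.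
exists f; split.
  move=> c fc; have := congr1 (fun p => size (p : {poly _})) fE.
  rewrite fc comp_polyC size_monicM ?heunQ_monic//; last first.
    by rewrite -size_poly_eq0 size_comp_poly2 ?size_heunQ// size_polyN size_polyX.
  rewrite size_comp_poly2 ?size_polyN ?size_polyX// size_heunQ => h.
  by have := size_polyC_leq1 (c%:P : {poly CC}); rewrite h addnS.
rewrite zero_set1 eqEsubset; split=> w.
  by move=> [z Vz <-]; rewrite /= -ev2_sq fE -[LHS]/(ev2K _ _) ev2KM -[ev2K Q z]/(ev2 Q z) Vz mul0r.
case: w => x y /= hw; have e1 : (x, y) = sqmap (x, sqrtC y) by rewrite /sqmap /= sqrtCK.
move: hw; rewrite e1 -ev2_sq fE -[LHS]/(ev2K _ _) ev2KM => /eqP; rewrite mulf_eq0 => /orP[] /eqP h.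
  by exists (x, sqrtC y).
exists (negr (x, sqrtC y)); first by rewrite /Vp /= -ev2_neg.
by rewrite /sqmap /= sqrrN.
Qed.

Lemma SIhatpE : SIhatp n.+1 = Vp.
Proof. exact: (prime_closure Vp_alg Vp_prime (@infinite_SI0p n) SI0p_Vp). Qed.
Lemma SIhatmE : SIhatm n.+1 = Vm.
Proof. exact: (prime_closure Vm_alg Vm_prime (@infinite_SI0m n) SI0m_Vm). Qed.
(** All of [SI], growth points included, lies on the zero set of Q(mu, r) Q(mu, - r), and the
    closures of its two subsets already fill both curves. *)
Lemma SIhatE : SIhat n.+1 = Vp `|` Vm.
Proof.
rewrite eqEsubset; split=> w.
  move=> /(_ (Q * (Q \Po - 'X))); rewrite -[ev2 _ w]/(ev2K _ _) ev2KM => h.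
  have /eqP : ev2K Q w * ev2K (Q \Po - 'X) w = 0.
    apply: h => z hz; rewrite -[LHS]/(ev2K _ _) ev2KM -[ev2K (_ \Po _) _]/(ev2 _ _) ev2_neg.
    case: (SI_root hz) => [h|h]; first by rewrite -[ev2K Q _]/(ev2 Q _) h mul0r.
    by rewrite negr_cplx2 h mulr0.
  rewrite mulf_eq0 => /orP[] /eqP h1; [left|right] => //.
  by rewrite VmE /= -ev2_neg.
rewrite -SIhatpE -SIhatmE => -[] h p hp; apply: h => z [[hz _] _]; exact: hp.
Qed.
Lemma sqmap_SIhat : sqmap @` SIhat n.+1 = sqmap @` Vp.
Proof.
rewrite SIhatE image_setU; apply/setUidl => _ [_ [z Vz <-] <-].
by exists z => //; rewrite /sqmap /= sqrrN.
Qed.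
End Curve.

Theorem theorem1p20 (l : nat) (hl : (0 < l)%N) :
  irreducible_curve (sqmap @` SIhat l) /\
  irreducible_curve (SIhatp l) /\ irreducible_curve (SIhatm l) /\
  SIhatp l <> SIhatm l /\
  (forall T, irreducible_component (SIhat l) T <-> (T = SIhatp l \/ T = SIhatm l)).
Proof.
case: l hl => // n _; rewrite sqmap_SIhat SIhatpE SIhatmE SIhatE.
have alg S : algebraic_curve S -> algebraic_set S by move=> [f [_ ->]]; exists [set f].
split; first by split; [exact: sqmap_curve|exact: prime_irreducible (alg _ (sqmap_curve n)) (sqmap_Vp_prime n)].
split; first by split; [exact: Vp_curve|exact: prime_irreducible (Vp_alg n) (Vp_prime n)].
split; first by split; [exact: Vm_curve|exact: prime_irreducible (Vm_alg n) (Vm_prime n)].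
split; first exact: Vp_neq_Vm.
by move=> T; apply: component_setU; [exact: Vp_alg|exact: Vm_alg|exact: Vp_prime|exact: Vm_prime|exact: Vp_neq_Vm].
Qed.
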